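(* Let $R$ be a commutative noetherian ring and let $S/R$ be relative Frobenius of rank $4$. Then for every $d\in\mathbb{N}$ the $R$-module $\Pi_R(S)_d$ is projective of rank $$\begin{cases} 5(d+1) & \text{if } d \text{ is even},\\ 4(d+1) & \text{if } d \text{ is odd}.\end{cases}$$
   Context: Relative Frobenius pairs: let $R\to S$ be a morphism of commutative rings. $S/R$ is relative Frobenius of rank $n$ if $S$ is a free $R$-module of rank $n$ and $\operatorname{Hom}_R(S,R)\cong S$ as $S$-modules. Generalized preprojective algebra: given such a pair, let $R\oplus S$ be the product ring. Let $M={}_RS_S$, viewed as an $R\oplus S$-bimodule with $R$ acting on the left, $S$ acting on the right and the other components acting by zero. Let $N={}_SS_R$, viewed as an $R\oplus S$-bimodule with $S$ acting on the left, $R$ acting on the right and the other components acting by zero. Put $T(R,S)=T_{R\oplus S}(M\oplus N)$ (tensor algebra over $R\oplus S$, graded by tensor degree). Then $M\otimes_{R\oplus S}M=N\otimes_{R\oplus S}N=0$, $M\otimes_{R\oplus S}N=S\otimes_SS$ (an $R$-$R$-bimodule) and $N\otimes_{R\oplus S}M=S\otimes_RS$ (an $S$-$S$-bimodule). Let $\lambda$ be a generator of $\operatorname{Hom}_R(S,R)$ as an $S$-module and let $(e_i)_i,(f_j)_j$ be $R$-bases of $S$ with $\lambda(e_if_j)=\delta_{ij}$. Then $\Pi_R(S)=T(R,S)/I$, where $I$ is the two-sided ideal generated by the degree $2$ elements $1\otimes 1\in M\otimes_{R\oplus S}N$ and $\sum_ie_i\otimes f_i\in N\otimes_{R\oplus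 S}M$. It is an $\mathbb{N}$-graded $R$-algebra (via $r\mapsto(r,r\cdot1_S)\in R\oplus S$), independent of the choices up to isomorphism; $\Pi_R(S)_d$ denotes its degree $d$ part. *)

(* Defs.v *)
From HB Require Import structures.
From mathcomp Require Import all_boot all_algebra.
From mathcomp Require Import boolp functions.
From mathcomp Require Import ring.

Set Implicit Arguments.
Unset Strict Implicit.
Unset Printing Implicit Defensive.

Import GRing.Theory.
Local Open Scope ring_scope.
Local Open Scope quotient_scope.

(* Rings are possibly zero (pz) throughout. *)

Section Ideals.
Variable R : comPzRingType.

Definition is_ideal (I : {pred R}) : Prop :=
  zmod_closed I /\ forall a x, x \in I -> a * x \in I.

Definition noetherian : Prop :=
  forall I : {pred R}, is_ideal I ->
    exists (n : nat) (g : 'I_n -> R), forall x,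
      x \in I <-> exists c : 'I_n -> R, x = \sum_(i < n) c i * g i.

Record prime_ideal := PrimeIdeal {
  prime_mem :> {pred R};
  prime_is_ideal : is_ideal prime_mem;
  prime_proper : 1 \notin prime_mem;
  prime_mul : forall x y,
    x * y \in prime_mem -> (x \in prime_mem) || (y \in prime_mem) }.

Record mulset := MulSet {
  mulset_mem :> {pred R};
  mulset1 : 1 \in mulset_mem;
  mulsetM : forall x y, x \in mulset_mem -> y \in mulset_mem ->
    x * y \in mulset_mem }.

Fact prime_compl1 (p : prime_ideal) : 1 \in [predC p].
Proof. exact: prime_proper. Qed.

Fact prime_complM (p : prime_ideal) x y :
  x \in [predC p] -> y \in [predC p] -> x * y \in [predC p].
Proof.
rewrite !inE => xp yp; apply/negP => /prime_mul.
by rewrite (negPf xp) (negPf yp).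
Qed.

Definition prime_compl (p : prime_ideal) : mulset :=
  MulSet (prime_compl1 p) (@prime_complM p).

End Ideals.

Section Modules.
Variable R : pzRingType.
Implicit Type V : lmodType R.

Definition is_basis V n (e : 'I_n -> V) : Prop :=
  forall v, exists! c : {ffun 'I_n -> R}, v = \sum_(i < n) c i *: e i.

Definition free_of_rank V n : Prop := exists e : 'I_n -> V, is_basis e.

Definition finitely_generated V : Prop :=
  exists (n : nat) (g : 'I_n -> V),
    forall v, exists c : 'I_n -> R, v = \sum_(i < n) c i *: g i.

Definition projective V : Prop :=
  forall (M N : lmodType R) (g : {linear M -> N}) (f : {linear V -> N}),
    (forall y, exists x, g x = y) ->
    exists h : {linear V -> M}, forall v, g (h v) = f v.

End Modules.

(* W^-1 V: classes of v/s with v/s = w/t iff u t v = u s w for some u in W. *)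
Section Localization.
Variables (R : comPzRingType) (W : mulset R).

Definition denom := {s : R | s \in mulset_mem W}.

Definition den (s : denom) : R := sval s.
Arguments den : simpl never.

Fact denP (s : denom) : den s \in mulset_mem W. Proof. by case: s. Qed.

Definition denom1 : denom := exist _ 1 (mulset1 W).
Definition denomM (s t : denom) : denom :=
  exist _ (den s * den t) (mulsetM (denP s) (denP t)).

Lemma den1 : den denom1 = 1. Proof. by []. Qed.
Lemma denM s t : den (denomM s t) = den s * den t. Proof. by []. Qed.

Section LocType.
Variable V : lmodType R.

Definition loc_rel (x y : V * denom) : bool :=
  `[< exists u : denom,
        (den u * den y.2) *: x.1 = (den u * den x.2) *: y.1 >].

Fact loc_rel_equiv : equiv_class_of loc_rel.
Proof.
split=> [x|x y|y x z].
- by apply/asboolP; exists denom1.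
- by apply/asboolP/asboolP => -[u eu]; exists u.
- case: x y z => [v s] [w t] [z r] /asboolP[/= u eu] /asboolP[/= u' eu'].
  apply/asboolP; exists (denomM (denomM u u') t) => /=; rewrite !denM.
  have -> : den u * den u' * den t * den r = den u' * den r * (den u * den t).
    by ring.
  rewrite -scalerA eu scalerA.
  have -> : den u' * den r * (den u * den s) = den u * den s * (den u' * den r).
    by ring.
  rewrite -scalerA eu' scalerA. congr (_ *: _); ring.
Qed.

Canonical loc_equiv := EquivRelPack loc_rel_equiv.
Canonical loc_encModRel := defaultEncModRel loc_rel.

Definition loc := {eq_quot loc_rel}.
HB.instance Definition _ := EqQuotient.on loc.
HB.instance Definition _ := Choice.on loc.

Definition frac (v : V) (s : denom) : loc := \pi_loc (v, s).


Definition addl (x y : loc) : loc :=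
  let: (v, s) := repr x in let: (w, t) := repr y in
  frac (den t *: v + den s *: w) (denomM s t).
Definition oppl (x : loc) : loc := let: (v, s) := repr x in frac (- v) s.

Lemma fracP v s w t :
  frac v s = frac w t <->
  exists u : denom, (den u * den t) *: v = (den u * den s) *: w.
Proof.
rewrite /frac; split=> [/eqmodP/asboolP //|h].
by apply/eqmodP/asboolP.
Qed.

Lemma frac_surj (x : loc) : exists v s, x = frac v s.
Proof.
by exists (repr x).1, (repr x).2; rewrite /frac -surjective_pairing reprK.
Qed.

Lemma addlE v s w t :
  addl (frac v s) (frac w t) = frac (den t *: v + den s *: w) (denomM s t).
Proof.
rewrite /addl; case E1: (repr (frac v s)) => [v' s'].
case E2: (repr (frac w t)) => [w' t'].
have /fracP[a ea] : frac v' s' = frac v s by rewrite {1}/frac -E1 reprK.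
have /fracP[b eb] : frac w' t' = frac w t by rewrite {1}/frac -E2 reprK.
apply/fracP; exists (denomM a b); rewrite !denM.
rewrite !scalerDr !scalerA; congr (_ + _).
- have -> : den a * den b * (den s * den t) * den t' =
      (den b * den t * den t') * (den a * den s) by ring.
  by rewrite -scalerA ea scalerA; congr (_ *: _); ring.
- have -> : den a * den b * (den s * den t) * den s' =
      (den a * den s * den s') * (den b * den t) by ring.
  by rewrite -scalerA eb scalerA; congr (_ *: _); ring.
Qed.

Lemma opplE v s : oppl (frac v s) = frac (- v) s.
Proof.
rewrite /oppl; case E1: (repr (frac v s)) => [v' s'].
have /fracP[a ea] : frac v' s' = frac v s by rewrite {1}/frac -E1 reprK.
by apply/fracP; exists a; rewrite !scalerN ea.
Qed.

Lemma frac_eq v s w t : den t *: v = den s *: w -> frac v s = frac w t.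
Proof. by move=> e; apply/fracP; exists (denom1); rewrite -!scalerA e. Qed.

Fact addlA : associative addl.
Proof.
move=> x y z; have [v [s ->]] := frac_surj x; have [w [t ->]] := frac_surj y.
have [z' [r ->]] := frac_surj z; rewrite !addlE; apply: frac_eq; rewrite ?denM ?den1.
rewrite !scalerDr !scalerA addrA; congr (_ + _ + _); congr (_ *: _); ring.
Qed.

Fact addlC : commutative addl.
Proof.
move=> x y; have [v [s ->]] := frac_surj x; have [w [t ->]] := frac_surj y.
rewrite !addlE; apply: frac_eq; rewrite ?denM ?den1 addrC !scalerDr !scalerA.
by congr (_ + _); congr (_ *: _); ring.
Qed.

Fact add0l : left_id (frac 0 denom1) addl.
Proof.
move=> x; have [v [s ->]] := frac_surj x; rewrite !addlE; apply: frac_eq; rewrite ?denM ?den1.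
by rewrite scaler0 add0r scalerA mulr1 mul1r.
Qed.

Fact addNl : left_inverse (frac 0 denom1) oppl addl.
Proof.
move=> x; have [v [s ->]] := frac_surj x; rewrite opplE addlE.
by apply: frac_eq; rewrite ?denM ?den1 scalerN addNr !scaler0.
Qed.

HB.instance Definition _ := GRing.isZmodule.Build loc addlA addlC add0l addNl.

Lemma frac_add v s w t :
  frac v s + frac w t = frac (den t *: v + den s *: w) (denomM s t).
Proof. exact: addlE. Qed.

End LocType.

Section LocScale.
Variable V : lmodType R.

Definition scalel (a : loc R^o) (x : loc V) : loc V :=
  let: (r, s) := repr a in let: (v, t) := repr x in
  frac ((r : R) *: v) (denomM s t).

Lemma scalelE (r : R^o) s v t :
  scalel (frac r s) (frac v t) = frac ((r : R) *: v) (denomM s t).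
Proof.
rewrite /scalel; case E1: (repr (frac r s)) => [r' s'].
case E2: (repr (frac v t)) => [v' t'].
have /fracP[a ea] : frac r' s' = frac r s by rewrite {1}/frac -E1 reprK.
have /fracP[b eb] : frac v' t' = frac v t by rewrite {1}/frac -E2 reprK.
have {}ea : den a * den s * r' = den a * den s' * r := ea.
apply/fracP; exists (denomM a b); rewrite !denM !scalerA.
have -> : den a * den b * (den s * den t) * r' =
   (den a * den s * r') * (den b * den t) by ring.
by rewrite ea -scalerA eb scalerA; congr (_ *: _); ring.
Qed.

End LocScale.

Definition locring := loc R^o.
HB.instance Definition _ := GRing.Zmodule.on locring.

Lemma scalelA V (a b : locring) (x : loc V) :
  scalel a (scalel b x) = scalel (scalel a b : locring) x.
Proof.
have [r [s ->]] := frac_surj a; have [r' [s' ->]] := frac_surj b.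
have [v [t ->]] := frac_surj x; rewrite !scalelE; apply: frac_eq; rewrite ?denM ?den1.
rewrite !scalerA; congr (_ *: _); rewrite /GRing.scale /=; ring.
Qed.

Lemma scale1l V : left_id (frac (1 : R^o) denom1) (@scalel V).
Proof.
move=> x; have [v [t ->]] := frac_surj x; rewrite scalelE.
by apply: frac_eq; rewrite ?denM ?den1 scale1r mul1r.
Qed.

Lemma scalelDr V : right_distributive (@scalel V) +%R.
Proof.
move=> a x y; have [r [s ->]] := frac_surj a.
have [v [t ->]] := frac_surj x; have [w [u ->]] := frac_surj y.
rewrite frac_add !scalelE frac_add; apply: frac_eq; rewrite ?denM ?den1.
by rewrite !(scalerDr, scalerA); congr (_ + _); congr (_ *: _); ring.
Qed.

Lemma scalelDl V (x : loc V) : {morph (scalel (V := V))^~ x : a b / a + b}.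
Proof.
move=> a b; have [r [s ->]] := frac_surj a; have [r' [s' ->]] := frac_surj b.
have [v [t ->]] := frac_surj x.
rewrite frac_add !scalelE frac_add; apply: frac_eq; rewrite ?denM ?den1.
rewrite !(scalerDr, scalerA) -scalerDl; congr (_ *: _).
by rewrite /GRing.scale /=; ring.
Qed.

Fact mullC : commutative (scalel (V := R^o)).
Proof.
move=> a b; have [r [s ->]] := frac_surj a; have [r' [s' ->]] := frac_surj b.
rewrite !scalelE; apply: frac_eq; rewrite ?denM ?den1 /GRing.scale /=; ring.
Qed.

HB.instance Definition _ := GRing.Zmodule_isComPzRing.Build locring
  (@scalelA R^o) mullC (@scale1l R^o) (fun a b x => scalelDl x a b).

HB.instance Definition _ V := GRing.Zmodule_isLmodule.Build locring (loc V)
  (@scalelA V) (@scale1l V) (@scalelDr V) (@scalelDl V).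

Lemma frac_scale (V : lmodType R) (r : R^o) s (v : V) t :
  (frac r s : locring) *: frac v t = frac ((r : R) *: v) (denomM s t).
Proof. exact: scalelE. Qed.

End Localization.

Definition projective_of_rank (R : comPzRingType) (V : lmodType R) (n : nat) :=
  [/\ finitely_generated V, projective V &
      forall p : prime_ideal R,
        @free_of_rank (locring (prime_compl p)) (loc (prime_compl p) V) n].

Section Frobenius.
Variables R S : comPzRingType.

(* S as an R-module through phi. *)
Definition restr (_ : {rmorphism R -> S}) : Type := S.
HB.instance Definition _ phi := GRing.Zmodule.on (restr phi).

Variable phi : {rmorphism R -> S}.
Local Notation Sphi := (restr phi).

Definition restr_scale (r : R) (s : Sphi) : Sphi := phi r * (s : S).

Fact restr_scaleA r r' s :
  restr_scale r (restr_scale r' s) = restr_scale (r * r') s.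
Proof. by rewrite /restr_scale rmorphM /= mulrA. Qed.

Fact restr_scale1 : left_id 1 restr_scale.
Proof. by move=> s; rewrite /restr_scale rmorph1 mul1r. Qed.

Fact restr_scaleDr : right_distributive restr_scale +%R.
Proof. by move=> r s t; rewrite /restr_scale -mulrDr. Qed.

Fact restr_scaleDl s : {morph restr_scale^~ s : r r' / r + r'}.
Proof. by move=> r r'; rewrite /restr_scale rmorphD /= mulrDl. Qed.

HB.instance Definition _ := GRing.Zmodule_isLmodule.Build R Sphi
  restr_scaleA restr_scale1 restr_scaleDr restr_scaleDl.

(* Hom_R(S, R), with S acting by (a f)(x) = f (a x). *)
Definition dual_pred : {pred Sphi -> R} :=
  fun f => `[< linear (f : Sphi -> R^o) >].

Fact dual_predP (f : Sphi -> R) :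
  reflect (linear (f : Sphi -> R^o)) (f \in dual_pred).
Proof. exact: asboolP. Qed.

Fact dual_zmod_closed : zmod_closed dual_pred.
Proof.
split; first by apply/dual_predP => a x y; rewrite /= scaler0 addr0.
move=> f g /dual_predP lf /dual_predP lg; apply/dual_predP => a x y.
by rewrite !fctE lf lg scalerBr opprD addrACA.
Qed.

HB.instance Definition _ :=
  GRing.isZmodClosed.Build (Sphi -> R) dual_pred dual_zmod_closed.

Record dual := Dual { dual_fun :> Sphi -> R; dualP : dual_fun \in dual_pred }.

HB.instance Definition _ := [isSub for dual_fun].
HB.instance Definition _ := [Choice of dual by <:].
HB.instance Definition _ := [SubChoice_isSubZmodule of dual by <:].

Fact dual_scale_subproof (a : S) (f : dual) :
  (fun x : Sphi => f (a * (x : S))) \in dual_pred.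
Proof.
apply/dual_predP => r x y; rewrite -(dual_predP _ (dualP f)) mulrDr.
by rewrite /GRing.scale /= /restr_scale mulrCA.
Qed.

Definition dual_scale (a : S) (f : dual) : dual :=
  Dual (dual_scale_subproof a f).

Lemma dual_ext (f g : dual) : (forall x, f x = g x) -> f = g.
Proof. by move=> fg; apply/val_inj/funext. Qed.

Fact dual_scaleA a b f : dual_scale a (dual_scale b f) = dual_scale (a * b) f.
Proof. by apply: dual_ext => x /=; rewrite mulrA (mulrC b). Qed.

Fact dual_scale1 : left_id 1 dual_scale.
Proof. by move=> f; apply: dual_ext => x /=; rewrite mul1r. Qed.

Fact dual_scaleDr : right_distributive dual_scale +%R.
Proof. by move=> a f g; apply: dual_ext. Qed.

Fact dual_scaleDl f : {morph dual_scale^~ f : a b / a + b}.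
Proof.
move=> a b; apply: dual_ext => x /=; rewrite mulrDl.
have := dual_predP _ (dualP f) 1 (a * (x : S)) (b * (x : S)).
by rewrite !scale1r.
Qed.

HB.instance Definition _ := GRing.Zmodule_isLmodule.Build S dual
  dual_scaleA dual_scale1 dual_scaleDr dual_scaleDl.

Definition relative_frobenius (n : nat) : Prop :=
  free_of_rank Sphi n /\ exists h : {linear S^o -> dual}, bijective h.

Definition generates_dual (lam : dual) : Prop :=
  forall f : dual, exists a : S, f = a *: lam.

End Frobenius.

Record bimodule (A : pzRingType) := Bimodule {
  bim_sort :> zmodType;
  lact : A -> bim_sort -> bim_sort;
  ract : bim_sort -> A -> bim_sort;
  lact1 : forall x, lact 1 x = x;
  lactA : forall a b x, lact a (lact b x) = lact (a * b) x;
  lactDl : forall a b x, lact (a + b) x = lact a x + lact b x;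
  lactDr : forall a x y, lact a (x + y) = lact a x + lact a y;
  ract1 : forall x, ract x 1 = x;
  ractA : forall x a b, ract (ract x a) b = ract x (a * b);
  ractDl : forall x y a, ract (x + y) a = ract x a + ract y a;
  ractDr : forall x a b, ract x (a + b) = ract x a + ract x b;
  lractA : forall a x b, ract (lact a x) b = lact a (ract x b) }.

#[local] Obligation Tactic := idtac.

Section DirectSum.
Variables (A : pzRingType) (M N : bimodule A).

Program Definition bim_sum : bimodule A :=
  @Bimodule A (M * N)%type
    (fun a x => (lact a x.1, lact a x.2)) (fun x a => (ract x.1 a, ract x.2 a))
    _ _ _ _ _ _ _ _ _.
Next Obligation. by move=> [x y] /=; rewrite !lact1. Qed.
Next Obligation. by move=> a b [x y] /=; rewrite !lactA. Qed.
Next Obligation. by move=> a b [x y] /=; rewrite !lactDl. Qed.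
Next Obligation. by move=> a [x y] [z t] /=; rewrite !lactDr. Qed.
Next Obligation. by move=> [x y] /=; rewrite !ract1. Qed.
Next Obligation. by move=> [x y] a b /=; rewrite !ractA. Qed.
Next Obligation. by move=> [x y] [z t] a /=; rewrite !ractDl. Qed.
Next Obligation. by move=> [x y] a b /=; rewrite !ractDr. Qed.
Next Obligation. by move=> a [x y] b /=; rewrite !lractA. Qed.

End DirectSum.

(* The tensor algebra T_A(B) is presented by generators and relations: ring
   expressions in the elements of A and B, modulo the congruence generated by
   the ring axioms, the ring structure of A and the bimodule structure of B.
   [tens_lift] and [tens_lift_uniq] give its universal property. *)
Section TensorAlgebra.
Variables (A : pzRingType) (B : bimodule A).

Inductive texpr : Type :=
  | TScal of A
  | TVec of B
  | TAdd of texpr & texpr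
  | TOpp of texpr
  | TMul of texpr & texpr.

HB.instance Definition _ := gen_eqMixin texpr.
HB.instance Definition _ := gen_choiceMixin texpr.

Inductive teq : texpr -> texpr -> Prop :=
  | teq_refl x : teq x x
  | teq_sym x y : teq x y -> teq y x
  | teq_trans x y z : teq x y -> teq y z -> teq x z
  | teq_add x x' y y' : teq x x' -> teq y y' -> teq (TAdd x y) (TAdd x' y')
  | teq_opp x x' : teq x x' -> teq (TOpp x) (TOpp x')
  | teq_mul x x' y y' : teq x x' -> teq y y' -> teq (TMul x y) (TMul x' y')
  | teq_addA x y z : teq (TAdd x (TAdd y z)) (TAdd (TAdd x y) z)
  | teq_addC x y : teq (TAdd x y) (TAdd y x)
  | teq_add0 x : teq (TAdd (TScal 0) x) x
  | teq_addN x : teq (TAdd (TOpp x) x) (TScal 0)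
  | teq_mulA x y z : teq (TMul x (TMul y z)) (TMul (TMul x y) z)
  | teq_mul1l x : teq (TMul (TScal 1) x) x
  | teq_mul1r x : teq (TMul x (TScal 1)) x
  | teq_mulDl x y z : teq (TMul (TAdd x y) z) (TAdd (TMul x z) (TMul y z))
  | teq_mulDr x y z : teq (TMul x (TAdd y z)) (TAdd (TMul x y) (TMul x z))
  | teq_scalD a b : teq (TScal (a + b)) (TAdd (TScal a) (TScal b))
  | teq_scalM a b : teq (TScal (a * b)) (TMul (TScal a) (TScal b))
  | teq_vecD u v : teq (TVec (u + v)) (TAdd (TVec u) (TVec v))
  | teq_lact a u : teq (TVec (lact a u)) (TMul (TScal a) (TVec u))
  | teq_ract u a : teq (TVec (ract u a)) (TMul (TVec u) (TScal a)).

Definition teqb (x y : texpr) : bool := `[< teq x y >].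

Fact teqb_equiv : equiv_class_of teqb.
Proof.
split=> [x|x y|y x z]; first exact/asboolP/teq_refl.
  by apply/asboolP/asboolP; apply: teq_sym.
by move=> /asboolP xy /asboolP yz; apply/asboolP/(teq_trans xy).
Qed.

Canonical teqb_canonical_equiv := EquivRelPack teqb_equiv.
Canonical teqb_encModRel := defaultEncModRel teqb.

Definition tens := {eq_quot teqb}.
HB.instance Definition _ := EqQuotient.on tens.
HB.instance Definition _ := Choice.on tens.

Definition tclass (x : texpr) : tens := \pi_tens x.

Lemma tclass_eq x y : tclass x = tclass y <-> teq x y.
Proof.
by rewrite /tclass; split=> [/eqmodP/asboolP //|h]; apply/eqmodP/asboolP.
Qed.

Lemma tclass_surj (t : tens) : exists x, t = tclass x.
Proof. by exists (repr t); rewrite /tclass reprK. Qed.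

Lemma teq_repr x : teq (repr (tclass x)) x.
Proof. by apply/tclass_eq; rewrite /tclass reprK. Qed.

Definition tens_add (s t : tens) := tclass (TAdd (repr s) (repr t)).
Definition tens_opp (t : tens) := tclass (TOpp (repr t)).
Definition tens_mul (s t : tens) := tclass (TMul (repr s) (repr t)).

Lemma tens_addE x y : tens_add (tclass x) (tclass y) = tclass (TAdd x y).
Proof. by apply/tclass_eq/teq_add; apply: teq_repr. Qed.

Lemma tens_oppE x : tens_opp (tclass x) = tclass (TOpp x).
Proof. by apply/tclass_eq/teq_opp/teq_repr. Qed.

Lemma tens_mulE x y : tens_mul (tclass x) (tclass y) = tclass (TMul x y).
Proof. by apply/tclass_eq/teq_mul; apply: teq_repr. Qed.

Definition tensE := (tens_addE, tens_oppE, tens_mulE).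

Fact tens_addA : associative tens_add.
Proof.
move=> s t u; have [x ->] := tclass_surj s; have [y ->] := tclass_surj t.
by have [z ->] := tclass_surj u; rewrite !tensE; apply/tclass_eq; constructor.
Qed.

Fact tens_addC : commutative tens_add.
Proof.
move=> s t; have [x ->] := tclass_surj s; have [y ->] := tclass_surj t.
by rewrite !tensE; apply/tclass_eq/teq_addC.
Qed.

Fact tens_add0 : left_id (tclass (TScal 0)) tens_add.
Proof.
move=> t; have [x ->] := tclass_surj t.
by rewrite !tensE; apply/tclass_eq/teq_add0.
Qed.

Fact tens_addN : left_inverse (tclass (TScal 0)) tens_opp tens_add.
Proof.
move=> t; have [x ->] := tclass_surj t.
by rewrite !tensE; apply/tclass_eq/teq_addN.
Qed.

HB.instance Definition _ :=
  GRing.isZmodule.Build tens tens_addA tens_addC tens_add0 tens_addN.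

Fact tens_mulA : associative tens_mul.
Proof.
move=> s t u; have [x ->] := tclass_surj s; have [y ->] := tclass_surj t.
have [z ->] := tclass_surj u; rewrite !tensE.
exact/tclass_eq/teq_mulA.
Qed.

Fact tens_mul1l : left_id (tclass (TScal 1)) tens_mul.
Proof.
move=> t; have [x ->] := tclass_surj t.
by rewrite !tensE; apply/tclass_eq/teq_mul1l.
Qed.

Fact tens_mul1r : right_id (tclass (TScal 1)) tens_mul.
Proof.
move=> t; have [x ->] := tclass_surj t.
by rewrite !tensE; apply/tclass_eq/teq_mul1r.
Qed.

Fact tens_mulDl : left_distributive tens_mul +%R.
Proof.
move=> s t u; have [x ->] := tclass_surj s; have [y ->] := tclass_surj t.
have [z ->] := tclass_surj u; rewrite /GRing.add /= !tensE.
exact/tclass_eq/teq_mulDl.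
Qed.

Fact tens_mulDr : right_distributive tens_mul +%R.
Proof.
move=> s t u; have [x ->] := tclass_surj s; have [y ->] := tclass_surj t.
have [z ->] := tclass_surj u; rewrite /GRing.add /= !tensE.
exact/tclass_eq/teq_mulDr.
Qed.

HB.instance Definition _ := GRing.Zmodule_isPzRing.Build tens
  tens_mulA tens_mul1l tens_mul1r tens_mulDl tens_mulDr.

Lemma tclassD x y : tclass (TAdd x y) = tclass x + tclass y.
Proof. by rewrite -tens_addE. Qed.

Lemma tclassN x : tclass (TOpp x) = - tclass x.
Proof. by rewrite -tens_oppE. Qed.

Lemma tclassM x y : tclass (TMul x y) = tclass x * tclass y.
Proof. by rewrite -tens_mulE. Qed.

Definition tens_scal (a : A) : tens := tclass (TScal a).
Definition tens_vec (u : B) : tens := tclass (TVec u).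

Lemma tens_scalD a b : tens_scal (a + b) = tens_scal a + tens_scal b.
Proof. by rewrite -tclassD; apply/tclass_eq/teq_scalD. Qed.

Lemma tens_scalM a b : tens_scal (a * b) = tens_scal a * tens_scal b.
Proof. by rewrite -tclassM; apply/tclass_eq/teq_scalM. Qed.

Lemma tens_scal1 : tens_scal 1 = 1. Proof. by []. Qed.

Lemma tens_vecD u v : tens_vec (u + v) = tens_vec u + tens_vec v.
Proof. by rewrite -tclassD; apply/tclass_eq/teq_vecD. Qed.

Lemma tens_lact a u : tens_vec (lact a u) = tens_scal a * tens_vec u.
Proof. by rewrite -tclassM; apply/tclass_eq/teq_lact. Qed.

Lemma tens_ract u a : tens_vec (ract u a) = tens_vec u * tens_scal a.
Proof. by rewrite -tclassM; apply/tclass_eq/teq_ract. Qed.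

Section UniversalProperty.
Variables (Q : pzRingType) (al : {rmorphism A -> Q}) (be : B -> Q).
Hypothesis beD : forall u v, be (u + v) = be u + be v.
Hypothesis be_lact : forall a u, be (lact a u) = al a * be u.
Hypothesis be_ract : forall u a, be (ract u a) = be u * al a.

Fixpoint texpr_eval (x : texpr) : Q :=
  match x with
  | TScal a => al a
  | TVec u => be u
  | TAdd y z => texpr_eval y + texpr_eval z
  | TOpp y => - texpr_eval y
  | TMul y z => texpr_eval y * texpr_eval z
  end.

Lemma texpr_eval_teq x y : teq x y -> texpr_eval x = texpr_eval y.
Proof.
elim=> //= *; rewrite ?(rmorph0, rmorph1, rmorphD, rmorphM) //;
  rewrite ?(addrA, mulrA, add0r, addNr, mul1r, mulr1, mulrDl, mulrDr) //.
all: by [congruence | rewrite addrC].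
Qed.

Definition tens_lift (t : tens) : Q := texpr_eval (repr t).

Lemma tens_liftE x : tens_lift (tclass x) = texpr_eval x.
Proof. exact/texpr_eval_teq/teq_repr. Qed.

Fact tens_lift_zmod : zmod_morphism tens_lift.
Proof.
move=> s t; have [x ->] := tclass_surj s; have [y ->] := tclass_surj t.
by rewrite -tclassN -tclassD !tens_liftE.
Qed.

Fact tens_lift_monoid : monoid_morphism tens_lift.
Proof.
split; first by rewrite -tens_scal1 tens_liftE /= rmorph1.
move=> s t; have [x ->] := tclass_surj s; have [y ->] := tclass_surj t.
by rewrite -tclassM !tens_liftE.
Qed.

HB.instance Definition _ :=
  GRing.isZmodMorphism.Build tens Q tens_lift tens_lift_zmod.
HB.instance Definition _ :=
  GRing.isMonoidMorphism.Build tens Q tens_lift tens_lift_monoid.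

Lemma tens_lift_scal a : tens_lift (tens_scal a) = al a.
Proof. exact: tens_liftE. Qed.

Lemma tens_lift_vec u : tens_lift (tens_vec u) = be u.
Proof. exact: tens_liftE. Qed.

Lemma tens_lift_uniq (h : {rmorphism tens -> Q}) :
  (forall a, h (tens_scal a) = al a) -> (forall u, h (tens_vec u) = be u) ->
  h =1 tens_lift.
Proof.
move=> ha hb t; have [x ->] := tclass_surj t; rewrite tens_liftE.
elim: x => //= [x <- y <-|x <-|x <- y <-].
- by rewrite -rmorphD -tclassD.
- by rewrite -rmorphN -tclassN.
- by rewrite -rmorphM -tclassM.
Qed.

End UniversalProperty.

(* The degree d part is spanned by the a u_1 ... u_d, with a in A and the u_i
   in B; the factor a is only needed for d = 0. *)
Inductive tens_deg (d : nat) : tens -> Prop :=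
  | tens_deg_pure a (u : 'I_d -> B) :
      tens_deg d (tens_scal a * \prod_(i < d) tens_vec (u i))
  | tens_degB s t : tens_deg d s -> tens_deg d t -> tens_deg d (s - t).

End TensorAlgebra.

Section TwoSidedIdeal.
Variables (T : pzRingType) (G : T -> Prop).

Inductive gen_ideal : T -> Prop :=
  | gen_ideal0 : gen_ideal 0
  | gen_ideal_gen x : G x -> gen_ideal x
  | gen_idealB x y : gen_ideal x -> gen_ideal y -> gen_ideal (x - y)
  | gen_idealMl a x : gen_ideal x -> gen_ideal (a * x)
  | gen_idealMr a x : gen_ideal x -> gen_ideal (x * a).

Definition gen_ideal_pred : {pred T} := fun x => `[< gen_ideal x >].

Fact gen_ideal_zmod : zmod_closed gen_ideal_pred.
Proof.
split; first exact/asboolP/gen_ideal0.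
by move=> x y /asboolP ix /asboolP iy; apply/asboolP/gen_idealB.
Qed.

HB.instance Definition _ := GRing.isZmodClosed.Build T gen_ideal_pred
  gen_ideal_zmod.

Definition quot_ring := Quotient.quot gen_ideal_pred.
HB.instance Definition _ := GRing.Zmodule.on quot_ring.

Definition quot_pi (x : T) : quot_ring := \pi_quot_ring x.

Lemma quot_pi_eq x y : quot_pi x = quot_pi y <-> gen_ideal (x - y).
Proof.
rewrite /quot_pi; split=> [/eqP|h].
  by rewrite -Quotient.idealrBE => /asboolP.
by apply/eqP; rewrite -Quotient.idealrBE; apply/asboolP.
Qed.

Lemma quot_pi_surj (q : quot_ring) : exists x, q = quot_pi x.
Proof. by exists (repr q); rewrite /quot_pi reprK. Qed.

Fact quot_pi_zmod : zmod_morphism quot_pi.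
Proof. exact: raddfB. Qed.
HB.instance Definition _ :=
  GRing.isZmodMorphism.Build T quot_ring quot_pi quot_pi_zmod.

Definition quot_mul (p q : quot_ring) : quot_ring := quot_pi (repr p * repr q).

Lemma quot_mulE x y : quot_mul (quot_pi x) (quot_pi y) = quot_pi (x * y).
Proof.
apply/quot_pi_eq; set x' := repr _; set y' := repr _.
have ix : gen_ideal (x' - x) by apply/quot_pi_eq; rewrite /quot_pi reprK.
have iy : gen_ideal (y - y') by apply/quot_pi_eq; rewrite /quot_pi reprK.
have -> : x' * y' - x * y = (x' - x) * y' - x * (y - y').
  by rewrite mulrBl mulrBr opprB addrA subrK.
by apply: gen_idealB; [apply: gen_idealMr|apply: gen_idealMl].
Qed.

Fact quot_mulA : associative quot_mul.
Proof.
move=> p q r; have [x ->] := quot_pi_surj p; have [y ->] := quot_pi_surj q.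
by have [z ->] := quot_pi_surj r; rewrite !quot_mulE mulrA.
Qed.

Fact quot_mul1l : left_id (quot_pi 1) quot_mul.
Proof. by move=> p; have [x ->] := quot_pi_surj p; rewrite quot_mulE mul1r. Qed.

Fact quot_mul1r : right_id (quot_pi 1) quot_mul.
Proof. by move=> p; have [x ->] := quot_pi_surj p; rewrite quot_mulE mulr1. Qed.

Fact quot_mulDl : left_distributive quot_mul +%R.
Proof.
move=> p q r; have [x ->] := quot_pi_surj p; have [y ->] := quot_pi_surj q.
have [z ->] := quot_pi_surj r.
by rewrite -raddfD !quot_mulE -raddfD mulrDl.
Qed.

Fact quot_mulDr : right_distributive quot_mul +%R.
Proof.
move=> p q r; have [x ->] := quot_pi_surj p; have [y ->] := quot_pi_surj q.
have [z ->] := quot_pi_surj r.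
by rewrite -raddfD !quot_mulE -raddfD mulrDr.
Qed.

HB.instance Definition _ := GRing.Zmodule_isPzRing.Build quot_ring
  quot_mulA quot_mul1l quot_mul1r quot_mulDl quot_mulDr.

Fact quot_pi_monoid : monoid_morphism quot_pi.
Proof. by split=> // x y; rewrite -quot_mulE. Qed.
HB.instance Definition _ :=
  GRing.isMonoidMorphism.Build T quot_ring quot_pi quot_pi_monoid.

End TwoSidedIdeal.

Section Preprojective.
Variables (R S : comPzRingType) (phi : {rmorphism R -> S}).

Local Notation A := (R * S)%type.

(* M = _R S_S *)
Program Definition bimM : bimodule A :=
  @Bimodule A S (fun a m => phi a.1 * m) (fun m a => m * a.2)
    _ _ _ _ _ _ _ _ _.
Next Obligation. by move=> m /=; rewrite rmorph1 mul1r. Qed.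
Next Obligation. by move=> a b m /=; rewrite rmorphM mulrA. Qed.
Next Obligation. by move=> a b m /=; rewrite rmorphD mulrDl. Qed.
Next Obligation. by move=> a m m' /=; rewrite mulrDr. Qed.
Next Obligation. by move=> m /=; rewrite mulr1. Qed.
Next Obligation. by move=> m a b /=; rewrite mulrA. Qed.
Next Obligation. by move=> m m' a /=; rewrite mulrDl. Qed.
Next Obligation. by move=> m a b /=; rewrite mulrDr. Qed.
Next Obligation. by move=> a m b /=; rewrite mulrA. Qed.

(* N = _S S_R *)
Program Definition bimN : bimodule A :=
  @Bimodule A S (fun a m => a.2 * m) (fun m a => m * phi a.1)
    _ _ _ _ _ _ _ _ _.
Next Obligation. by move=> m /=; rewrite mul1r. Qed.
Next Obligation. by move=> a b m /=; rewrite mulrA. Qed.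
Next Obligation. by move=> a b m /=; rewrite mulrDl. Qed.
Next Obligation. by move=> a m m' /=; rewrite mulrDr. Qed.
Next Obligation. by move=> m /=; rewrite rmorph1 mulr1. Qed.
Next Obligation. by move=> m a b /=; rewrite rmorphM mulrA. Qed.
Next Obligation. by move=> m m' a /=; rewrite mulrDl. Qed.
Next Obligation. by move=> m a b /=; rewrite rmorphD mulrDr. Qed.
Next Obligation. by move=> a m b /=; rewrite mulrA. Qed.

Definition TRS := tens (bim_sum bimM bimN).

Definition inM (m : S) : TRS := tens_vec ((m, 0) : bim_sum bimM bimN).
Definition inN (m : S) : TRS := tens_vec ((0, m) : bim_sum bimM bimN).

Variables (n : nat) (e f : 'I_n -> S).

Definition preproj_rel (t : TRS) : Prop :=
  t = inM 1 * inN 1 \/ t = \sum_(i < n) inN (e i) * inM (f i).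

Definition preproj := quot_ring preproj_rel.
HB.instance Definition _ := GRing.PzRing.on preproj.

Definition preproj_of (t : TRS) : preproj := quot_pi preproj_rel t.

(* R acts through r |-> (r, r 1_S) in A. *)
Definition preproj_scale (r : R) (x : preproj) : preproj :=
  preproj_of (tens_scal _ (r, phi r)) * x.

Fact preproj_scaleA r s x :
  preproj_scale r (preproj_scale s x) = preproj_scale (r * s) x.
Proof.
rewrite /preproj_scale mulrA; congr (_ * _).
rewrite /preproj_of -[LHS](rmorphM (quot_pi preproj_rel)) -tens_scalM.
by rewrite rmorphM.
Qed.

Fact preproj_scale1 : left_id 1 preproj_scale.
Proof.
move=> x; rewrite /preproj_scale rmorph1 tens_scal1 /preproj_of.
by rewrite (rmorph1 (quot_pi preproj_rel)) mul1r.
Qed.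

Fact preproj_scaleDr : right_distributive preproj_scale +%R.
Proof. by move=> r x y; rewrite /preproj_scale mulrDr. Qed.

Fact preproj_scaleDl x : {morph preproj_scale^~ x : r s / r + s}.
Proof.
move=> r s; rewrite /preproj_scale -mulrDl; congr (_ * _).
rewrite /preproj_of -(rmorphD (quot_pi preproj_rel)) -tens_scalD.
by rewrite rmorphD.
Qed.

HB.instance Definition _ := GRing.Zmodule_isLmodule.Build R preproj
  preproj_scaleA preproj_scale1 preproj_scaleDr preproj_scaleDl.

(* Degree d part of T/I: the image of the degree d part of T. *)
Definition preproj_deg (d : nat) : {pred preproj} :=
  fun x => `[< exists2 t, tens_deg d t & x = preproj_of t >].

Fact tens_deg_scal (B : bimodule A) d a (t : tens B) :
  tens_deg d t -> tens_deg d (tens_scal B a * t).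
Proof.
elim=> [b u|s s' _ ds _ ds']; last by rewrite mulrBr; apply: tens_degB.
by rewrite mulrA -tens_scalM; apply: tens_deg_pure.
Qed.

Fact tens_deg0 (B : bimodule A) d : tens_deg d (0 : tens B).
Proof.
have h := tens_deg_pure 1 (fun _ : 'I_d => (0 : B)).
by rewrite -(subrr (tens_scal B 1 * \prod_(i < d) tens_vec 0)); apply: tens_degB.
Qed.

Fact preproj_deg_submod d : submod_closed (preproj_deg d).
Proof.
split.
  apply/asboolP; exists 0; first exact: tens_deg0.
  by rewrite /preproj_of (rmorph0 (quot_pi preproj_rel)).
move=> r x y /asboolP[s ds ->] /asboolP[t dt ->]; apply/asboolP.
exists (tens_scal _ (r, phi r) * s - (0 - t)).
  apply: tens_degB; first exact: tens_deg_scal.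
  by apply: tens_degB => //; apply: tens_deg0.
rewrite sub0r opprK /preproj_of.
by rewrite (rmorphD (quot_pi preproj_rel)) (rmorphM (quot_pi preproj_rel)).
Qed.

HB.instance Definition _ d := GRing.isSubmodClosed.Build R preproj
  (preproj_deg d) (preproj_deg_submod d).

Record preproj_part (d : nat) := PreprojPart {
  preproj_part_val :> preproj;
  preproj_partP : preproj_part_val \in preproj_deg d }.

HB.instance Definition _ d := [isSub for @preproj_part_val d].
HB.instance Definition _ d := [Choice of preproj_part d by <:].
HB.instance Definition _ d :=
  [SubChoice_isSubLmodule of preproj_part d by <:].

End Preprojective.

(* Main.v *)
(* Let E a b m be the part of degree m - 1 of the corner of the algebra cut out
   by the idempotents of a and b, where a and b are R or S. Right multiplication
   by M 1 and N 1, respectively by the N (e i) and M (f i), gives sequences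
     E a R m -> E a S (m+1) -> E a R (m+2) -> 0,
     E a S m -> (E a R (m+1))^4 -> E a S (m+2) -> 0
   that are exact, which is seen on a representation of the tensor algebra by
   3 x 3 block matrices over the algebra. If the middle term is locally free of
   rank r, and the outer terms have q and r - q local generators, then these
   generators are local bases, because a surjective endomorphism of a finite
   free module is injective. By induction it remains to generate E R R (2k+1)
   locally by 2k+1 elements.

   This corner is generated by x s = M s * N 1, with x 1 = 0 and
   sum_i x (s e_i) x (f_i) = 0, so locally by three elements y_i. Over the
   residue field the relations say that a linear form on the six symmetric
   products y_i y_j + y_j y_i, y_i^2 is a conic of the pencil that vanishes on
   the four points of the fibre; hence two combinations c1, c2 suffice to
   express these products. A linear form on the commutators of the y_i with the
   symmetric products is a linear syzygy between the conics of the pencil, which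
   has to vanish, so c1 and c2 are central. Locally the corner is therefore a
   quotient of a Clifford algebra of rank 8 over R[c1, c2], with 2k+1 spanning
   words in degree 2k: one for each monomial in c1, c2 times one of 1, y1y2,
   y1y3, y2y3 if k is even, or one of y1, y2, y3, y1y2y3 if k is odd. *)

(* No normal form for the algebra is ever shown to be independent. Rewriting gives only upper bounds
   on the number of local generators, in all degrees; freeness is checked by hand in degree 0 and
   then propagates, since the bounds for the outer terms of a sequence add up to the rank of its
   middle term. The ranks r are the solution of r(a,S,m+1) = r(a,R,m) + r(a,R,m+2) and 4 r(a,R,m+1)
   = r(a,S,m) + r(a,S,m+2). The fibre at a prime may be non-reduced, over a residue field of any
   characteristic that need not be algebraically closed. Its four points are therefore replaced by
   the trace form l: an element z vanishes on the fibre if l(zw) lies in p for all w. Squares are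
   kept apart from anticommutators because 2 may fail to be invertible. Linear syzygies vanish for
   this reason: a nonzero one would exhibit a linear form m as a common factor of the conics of the
   pencil, which nondegeneracy of the trace form excludes. Localization at p is mostly replaced by
   explicit denominators outside p, so that the noncommutative algebra itself is never localized
   during the computations. *)
Require Import Defs.
From HB Require Import structures.
From mathcomp Require Import all_boot all_algebra.
From mathcomp Require Import boolp classical_sets functions.
From mathcomp Require Import ring zify.

Set Implicit Arguments.
Unset Strict Implicit.
Unset Printing Implicit Defensive.

Import GRing.Theory.
Local Open Scope ring_scope.
Local Notation frac := Defs.frac.

(** * Residue fields and Nakayama's lemma *)

Section PrimeIdeals.
Variable R : comPzRingType.
Implicit Type p : prime_ideal R.

Lemma prime0 p : 0 \in p.
Proof. by have [[]] := prime_is_ideal p. Qed.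

Lemma primeB p x y : x \in p -> y \in p -> x - y \in p.
Proof. by have [[_ h] _] := prime_is_ideal p; apply: h. Qed.

Lemma primeMl p a x : x \in p -> a * x \in p.
Proof. by have [_ h] := prime_is_ideal p; apply: h. Qed.

Lemma primeMr p a x : x \in p -> x * a \in p.
Proof. by rewrite mulrC; apply: primeMl. Qed.

Lemma primeN p x : x \in p -> - x \in p.
Proof. by move=> px; rewrite -sub0r primeB // prime0. Qed.

Lemma primeD p x y : x \in p -> y \in p -> x + y \in p.
Proof. by move=> px py; rewrite -[y]opprK primeB // primeN. Qed.

Lemma prime_sum p (I : finType) (F : I -> R) :
  (forall i, F i \in p) -> \sum_i F i \in p.
Proof. by move=> h; elim/big_rec: _ => [|i x _ px]; rewrite ?prime0 ?primeD. Qed.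

Lemma prime1N p : 1 \notin p.
Proof. exact: prime_proper. Qed.

Lemma primeMN p x y : x \notin p -> y \notin p -> x * y \notin p.
Proof. by move=> nx ny; apply/negP => /prime_mul; rewrite (negPf nx) (negPf ny). Qed.

Lemma primeMI p x y : x \notin p -> x * y \in p -> y \in p.
Proof. by move=> nx /prime_mul; rewrite (negPf nx). Qed.

Lemma prime_prodN p (I : finType) (F : I -> R) :
  (forall i, F i \notin p) -> \prod_i F i \notin p.
Proof.
by move=> h; elim/big_rec: _ => [|i x _ px]; [exact: prime1N|rewrite primeMN].
Qed.

Lemma common_denom p (I : finType) (P : I -> R -> Prop) :
  (forall i s t, P i s -> P i (t * s)) ->
  (forall i, exists2 s, s \notin p & P i s) ->
  exists2 s, s \notin p & forall i, P i s.
Proof.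
move=> PM h.
have /choice[s sp] i : exists s, s \notin p /\ P i s by have [s] := h i; exists s.
exists (\prod_i s i); first by apply: prime_prodN => i; case: (sp i).
by move=> i; rewrite (bigD1 i) //= mulrC; apply: PM; case: (sp i).
Qed.

End PrimeIdeals.

Section ResidueField.
Variables (R : comPzRingType) (p : prime_ideal R).
Local Notation W := (prime_compl p).
Local Notation Rp := (locring W).

Definition max_ideal (x : Rp) : Prop :=
  exists2 r : R, r \in p & exists s, x = frac (r : R^o) s.

Definition residue := quot_ring max_ideal.
HB.instance Definition _ := GRing.PzRing.on residue.

Lemma denN (s : denom W) : den s \notin p.
Proof. by have := denP s. Qed.

Lemma denomN (s : R) : s \notin p -> {d : denom W | den d = s}.
Proof. by move=> sp; exists (exist _ s sp). Qed.

Lemma locring_frac (x : Rp) : exists (r : R) s, x = frac (r : R^o) s.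
Proof. by have [r [s ->]] := frac_surj x; exists r, s. Qed.

Lemma frac_mul (r r' : R) (s s' : denom W) :
  (frac (r : R^o) s : Rp) * (frac (r' : R^o) s' : Rp) =
  (frac (r * r' : R^o) (denomM s s') : Rp).
Proof. exact: scalelE. Qed.

(** Fractions with numerator in p already form an ideal, so equality in the quotient can be tested
    on numerators. *)
Lemma gen_max_ideal (x : Rp) : gen_ideal max_ideal x <-> max_ideal x.
Proof.
split; last exact: gen_ideal_gen.
elim=> {x} [|//|x y _ [r rp [s ->]] _ [r' rp' [s' ->]]|a x _ [r rp [s ->]]
  |a x _ [r rp [s ->]]].
- by exists 0; [exact: prime0|exists (denom1 W)].
- exists (den s' * r - den s * r'); first by rewrite primeB // primeMl.
  exists (denomM s s'); rewrite -[X in _ - X]/(frac _ _ : Rp).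
  have -> : - (frac (r' : R^o) s' : Rp) = frac (- r' : R^o) s' by exact: opplE.
  by rewrite [LHS]frac_add; congr frac; rewrite scalerN.
- have [b [t ->]] := locring_frac a; exists (b * r); first by rewrite primeMl.
  by exists (denomM t s); rewrite frac_mul.
- have [b [t ->]] := locring_frac a; exists (r * b); first by rewrite primeMr.
  by exists (denomM s t); rewrite frac_mul.
Qed.

Definition residue_pi (x : Rp) : residue := quot_pi max_ideal x.

Lemma residue_eq x y : residue_pi x = residue_pi y <-> max_ideal (x - y).
Proof. by rewrite /residue_pi quot_pi_eq gen_max_ideal. Qed.

Lemma residue_surj (k : residue) : exists x, k = residue_pi x.
Proof. exact: quot_pi_surj. Qed.

Fact residue_mulC : commutative (@GRing.mul residue).
Proof.
move=> k k'; have [x ->] := residue_surj k; have [y ->] := residue_surj k'.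
by rewrite /residue_pi -!(rmorphM (quot_pi max_ideal)) mulrC.
Qed.
HB.instance Definition _ :=
  GRing.PzRing_hasCommutativeMul.Build residue residue_mulC.

Lemma max_ideal_frac (r : R) s : max_ideal (frac (r : R^o) s) <-> r \in p.
Proof.
split=> [[r' r'p [s']]|rp]; last by exists r => //; exists s.
move=> /fracP[u]; rewrite /GRing.scale /= => e.
have : den u * den s' * r \in p by rewrite e primeMl.
by apply: primeMI; rewrite primeMN // denN.
Qed.

Lemma residue_eq0 (x : Rp) : residue_pi x = 0 <-> max_ideal x.
Proof.
by rewrite -[0](rmorph0 (quot_pi max_ideal)) residue_eq subr0.
Qed.

Fact residue_nz : 1 != 0 :> residue.
Proof.
apply/eqP; rewrite -[1](rmorph1 (quot_pi max_ideal)) => /residue_eq0.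
by move=> /(max_ideal_frac 1 _); apply/negP/prime1N.
Qed.
HB.instance Definition _ := GRing.PzSemiRing_isNonZero.Build residue residue_nz.

Fact residue_inv_ex (k : residue) : exists k' : residue,
  (k = 0 -> k' = 0) /\ (k != 0 -> k' * k = 1).
Proof.
have [->|k0] := eqVneq k 0; first by exists 0.
have [x kE] := residue_surj k; have [r [s xE]] := locring_frac x.
have rp : r \notin p.
  apply/negP => rp; case/eqP: k0; rewrite kE xE; apply/residue_eq0.
  exact/max_ideal_frac.
have [d dE] := denomN rp; exists (residue_pi (frac (den s : R^o) d)).
split=> [k0'|_]; first by rewrite k0' eqxx in k0.
rewrite kE xE /residue_pi -(rmorphM (quot_pi max_ideal)).
rewrite frac_mul -(rmorph1 (quot_pi max_ideal)); congr (quot_pi _ _).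
by apply: frac_eq; rewrite den1 denM dE /GRing.scale /=; ring.
Qed.

Definition residue_inv (k : residue) : residue := projT1 (cid (residue_inv_ex k)).

Fact residue_mulVf k : k != 0 -> residue_inv k * k = 1.
Proof. by rewrite /residue_inv; case: cid => k' /= []. Qed.

Fact residue_inv0 : residue_inv 0 = 0.
Proof. by rewrite /residue_inv; case: cid => k' /= [h _]; apply: h. Qed.

HB.instance Definition _ :=
  GRing.ComNzRing_isField.Build residue residue_mulVf residue_inv0.

Definition to_residue (r : R) : residue := residue_pi (frac (r : R^o) (denom1 W)).

Fact to_residue_zmod : zmod_morphism to_residue.
Proof.
move=> r r'; rewrite /to_residue /residue_pi -(rmorphB (quot_pi max_ideal)).
congr (quot_pi _ _).
have -> : - (frac (r' : R^o) (denom1 W) : Rp) = frac (- r' : R^o) (denom1 W).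
  exact: opplE.
rewrite [RHS]frac_add; apply: frac_eq.
by rewrite denM den1 mulr1 !scale1r.
Qed.
HB.instance Definition _ :=
  GRing.isZmodMorphism.Build R residue to_residue to_residue_zmod.

Fact to_residue_monoid : monoid_morphism to_residue.
Proof.
split; first exact: (rmorph1 (quot_pi max_ideal)).
move=> r r'; rewrite /to_residue /residue_pi -(rmorphM (quot_pi max_ideal)).
by congr (quot_pi _ _); rewrite frac_mul; apply: frac_eq; rewrite denM den1 mulr1.
Qed.
HB.instance Definition _ :=
  GRing.isMonoidMorphism.Build R residue to_residue to_residue_monoid.

Lemma to_residue_eq0 r : (to_residue r == 0) = (r \in p).
Proof.
apply/eqP/idP => [/residue_eq0 h|rp]; first exact/(max_ideal_frac r (denom1 W)).
by apply/residue_eq0; apply/(max_ideal_frac r (denom1 W)).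
Qed.

Lemma residue_frac (k : residue) :
  exists (r : R), exists2 s, s \notin p & to_residue s * k = to_residue r.
Proof.
have [x ->] := residue_surj k; have [r [s ->]] := locring_frac x.
exists r, (den s); first exact: denN.
rewrite /to_residue /residue_pi -(rmorphM (quot_pi max_ideal)).
congr (quot_pi _ _); rewrite frac_mul; apply: frac_eq.
by rewrite denM den1 /GRing.scale /=; ring.
Qed.

End ResidueField.

Section LinearCombinations.
Variables (R : pzRingType) (V : lmodType R).

Definition mxcomb m n (A : 'M[R]_(m, n)) (z : 'I_n -> V) (i : 'I_m) : V :=
  \sum_j A i j *: z j.

Lemma mxcombM m n k (A : 'M[R]_(m, n)) (B : 'M[R]_(n, k)) z i :
  mxcomb (A *m B) z i = mxcomb A (mxcomb B z) i.
Proof.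
rewrite /mxcomb; under eq_bigr do rewrite mxE scaler_suml.
rewrite exchange_big; apply: eq_bigr => j _; rewrite scaler_sumr.
by apply: eq_bigr => l _; rewrite scalerA.
Qed.

Lemma mxcombD m n (A B : 'M[R]_(m, n)) z i :
  mxcomb (A + B) z i = mxcomb A z i + mxcomb B z i.
Proof. by rewrite -big_split; apply: eq_bigr => j _; rewrite mxE scalerDl. Qed.

Lemma mxcomb_scalar n (a : R) (z : 'I_n -> V) i : mxcomb a%:M z i = a *: z i.
Proof.
rewrite /mxcomb (bigD1 i) //= mxE eqxx big1 ?addr0 // => j ji.
by rewrite mxE eq_sym (negPf ji) scale0r.
Qed.

Lemma mxcomb_eq0 m n (A : 'M[R]_(m, n)) z i :
  (forall j, z j = 0) -> mxcomb A z i = 0.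
Proof. by move=> z0; rewrite /mxcomb big1 // => j _; rewrite z0 scaler0. Qed.

Lemma eq_mxcomb m n (A : 'M[R]_(m, n)) z z' i :
  z =1 z' -> mxcomb A z i = mxcomb A z' i.
Proof. by move=> zz; apply: eq_bigr => j _; rewrite zz. Qed.

End LinearCombinations.

Section Nakayama.
Variables (R : comPzRingType) (p : prime_ideal R).
Local Notation K := (residue p).
Local Notation rho := (@to_residue R p).

(** A common denominator of the entries allows a nonzero multiple of a matrix over the residue field
    to be lifted to [R]. *)
Lemma residue_mx m n (A : 'M[K]_(m, n)) :
  exists2 s, s \notin p & exists N : 'M[R]_(m, n), rho s *: A = map_mx rho N.
Proof.
have [|[i j] /=|s sp h] := @common_denom R p ('I_m * 'I_n)%type
  (fun ij s => exists r, rho s * A ij.1 ij.2 = rho r).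
- by move=> ij s t [r e]; exists (t * r); rewrite rmorphM -mulrA e -rmorphM.
- by have [r [s sp e]] := residue_frac (A i j); exists s => //; exists r.
exists s => //; have /choice[N eN] := h; exists (\matrix_(i, j) N (i, j)).
by apply/matrixP => i j; rewrite !mxE (eN (i, j)).
Qed.

(* The linear forms on the fibre at p of the module spanned by z are the
   vectors killed by all relations between the z_j; if these forms have rank at
   most r, then r elements generate locally. *)
Lemma nakayama (V : lmodType R) n (z : 'I_n -> V) r :
  (forall G : 'M[K]_n,
     (forall c : 'rV[R]_n, mxcomb c z 0 = 0 -> map_mx rho c *m G = 0) ->
     (\rank G <= r)%N) ->
  exists2 s, s \notin p & exists (B : 'M[R]_(r, n)) (C : 'M[R]_(n, r)),
    forall j, s *: z j = mxcomb C (mxcomb B z) j.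
Proof.
(* Among all matrices of relations, [N] is one whose reduction has maximal rank; this replaces the
   choice of generators for the module of relations. *)
move=> hr; pose rel k (N : 'M[R]_(k, n)) := forall i, mxcomb N z i = 0.
pose P m := `[< exists k (N : 'M[R]_(k, n)), rel k N /\ \rank (map_mx rho N) = m >].
have exP : exists m, P m.
  exists 0; apply/asboolP; exists 0, 0; split; first by case.
  by apply/eqP; rewrite -leqn0 rank_leq_row.
have ubP m : P m -> (m <= n)%N by move=> /asboolP[k [N [_ <-]]]; apply: rank_leq_col.
case: (ex_maxnP exP ubP) => m /asboolP[k [N [relN rkN]]] maxm.
(* By maximality, appending a further relation to [N] cannot enlarge the row space of its
   reduction. *)
have subN (c : 'rV[R]_n) : mxcomb c z 0 = 0 -> (map_mx rho c <= map_mx rho N)%MS.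
  move=> c0; have : (\rank (map_mx rho (col_mx N c)) <= m)%N.
    apply: maxm; apply/asboolP; exists (k + 1)%N, (col_mx N c); split=> // i.
    case: (split_ordP i) => j ->.
      by rewrite -(relN j); apply: eq_bigr => l _; rewrite col_mxEu.
    by rewrite -c0; apply: eq_bigr => l _; rewrite col_mxEd ord1.
  rewrite map_col_mx -addsmxE -rkN => le.
  have [_ eqN] := mxrank_leqif_sup (addsmxSl (map_mx rho N) (map_mx rho c)).
  apply: submx_trans (addsmxSr (map_mx rho N) _) _.
  by rewrite -eqN eqn_leq le mxrankS // addsmxSl.
(* The cokernel matrix of [N] is killed by all relations, so the hypothesis bounds its rank. *)
have rk_compl : (\rank (map_mx rho N)^C <= r)%N.
  rewrite mxrank_compl -mxrank_coker; apply: hr => c /subN.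
  by rewrite submxE => /eqP.
set D := (map_mx rho N)^C%MS in rk_compl *; set q := \rank D in rk_compl.
have : (1%:M <= map_mx rho N + row_base D)%MS.
  have -> : (map_mx rho N + row_base D :=: map_mx rho N + D)%MS.
    by apply: adds_eqmx => //; apply: eq_row_base.
  by rewrite sub1mx addsmx_compl_full.
move=> /sub_addsmxP[[P1 P2] /= e1].
(* A basis of the complement is padded with zero rows, since exactly [r] rows are asked for and the
   complement may have smaller dimension [q]. *)
pose B0 : 'M[K]_(r, n) := (pid_mx q : 'M_(r, q)) *m row_base D.
have B0E : row_base D = (pid_mx q : 'M_(q, r)) *m B0.
  by rewrite mulmxA mul_pid_mx minnn (minn_idPr rk_compl) pid_mx_1 mul1mx.
have [s1 s1p [Q1 eQ1]] := residue_mx P1.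
have [s2 s2p [Q2 eQ2]] := residue_mx (P2 *m (pid_mx q : 'M_(q, r))).
have [t tp [B eB]] := residue_mx B0.
(* [W] reduces to the scalar [t * s2 * s1], so its determinant lies outside p. Applied to [z], its
   first summand vanishes because [N] consists of relations; the adjugate of [W] then expresses [z]
   through [B]. *)
pose W := (t * s2) *: (Q1 *m N) + s1 *: (Q2 *m B).
have detW : \det W \notin p.
  rewrite -to_residue_eq0 -det_map_mx.
  have -> : map_mx rho W = (rho (t * s2 * s1))%:M.
    rewrite map_mxD !map_mxZ !map_mxM -eQ1 -eQ2 -eB.
    rewrite -?(scalemxAl, scalemxAr) -mulmxA -B0E !scalerA.
    have -> : rho s1 * rho s2 * rho t = rho (t * s2 * s1) by rewrite !rmorphM /=; ring.
    rewrite -[_ * rho s1]rmorphM.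
    by rewrite -scalerDr -e1 scalemx1.
  have /negPf s_p : t * s2 * s1 \notin p by rewrite !primeMN.
  by rewrite det_scalar expf_eq0 to_residue_eq0 s_p andbF.
exists (\det W) => //; exists B, (\adj W *m (s1 *: Q2)) => j.
rewrite -mxcomb_scalar -mul_adj_mx /W !scalemxAl mulmxDr mxcombD !mulmxA.
rewrite mxcombM [X in X + _]mxcomb_eq0 ?add0r //.
by rewrite mxcombM.
Qed.

End Nakayama.

(** * Prime ideals containing a proper ideal *)

Section PrimeExistence.
Variable R : comPzRingType.

Definition ideal_set (A : set R) : Prop :=
  [/\ A 0, forall x y, A x -> A y -> A (x - y) & forall a x, A x -> A (a * x)].

Lemma exists_prime (J : set R) : ideal_set J -> ~ J 1 ->
  exists p : prime_ideal R, forall x, J x -> x \in p.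
Proof.
move=> idJ J1.
pose P (A : set R) := A = set0 \/ [/\ ideal_set A, J `<=` A & ~ A 1]%classic.
have [F FP totF|A [PA maxA]] := @Zorn_bigcup R P.
  have [[B FB B0]|nF] := EM (exists2 B, F B & B !=set0)%classic; last first.
    left; rewrite -subset0 => x [B FB Bx]; apply: nF; exists B => //.
    by exists x.
  right; have good C : F C -> (C !=set0)%classic ->
      [/\ ideal_set C, J `<=` C & ~ C 1]%classic.
    by move=> /FP[-> [x []]|].
  have [[B_0 _ _] JB _] := good _ FB B0; split; last 1 first.
  - move=> [C FC C1]; have C0 : (C !=set0)%classic by exists 1.
    by have [_ _] := good _ FC C0.
  - split; first by exists B.
    + move=> x y [C FC Cx] [D FD Dy].
      have [CD|DC] := totF _ _ FC FD.
        have Dx := CD _ Cx; have D0 : (D !=set0)%classic by exists x.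
        by have [[_ h _] _ _] := good _ FD D0; exists D => //; apply: h.
      have Cy := DC _ Dy; have C0 : (C !=set0)%classic by exists x.
      by have [[_ h _] _ _] := good _ FC C0; exists C => //; apply: h.
    + move=> a x [C FC Cx]; have C0 : (C !=set0)%classic by exists x.
      by have [[_ _ h] _ _] := good _ FC C0; exists C => //; apply: h.
  - by move=> x /JB Bx; exists B.
have [A0|[[A_0 AB AM] JA A1]] := PA.
  have [J0 _ _] := idJ; exfalso; apply: (maxA J); last by right; split.
  by rewrite A0; split=> // /(_ _ J0).
(* By maximality, [A] and an element outside it generate the unit ideal. Multiplying two such
   expressions of 1 shows that [A] is prime. *)
have big x : ~ A x -> exists a r, A a /\ 1 = a + r * x.
  move=> nAx; pose B : set R := fun z => exists a r, A a /\ z = a + r * x.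
  apply: contrapT => nB; apply: (maxA B).
    split=> [z Az|/(_ x)]; first by exists z, 0; rewrite mul0r addr0.
    by move=> h; apply: nAx; apply: h; exists 0, 1; rewrite add0r mul1r.
  right; split=> //; last first.
    by move=> z /JA Az; exists z, 0; rewrite mul0r addr0.
  split; first by exists 0, 0; rewrite mul0r addr0.
  - move=> _ _ [a [r [Aa ->]]] [b [s [Ab ->]]]; exists (a - b), (r - s).
    by split; [apply: AB|ring].
  - move=> c _ [a [r [Aa ->]]]; exists (c * a), (c * r).
    by split; [apply: AM|ring].
have [p pA] : exists p : prime_ideal R, forall x, x \in p <-> A x.
  pose I : {pred R} := fun x => `[< A x >].
  have inI x : x \in I <-> A x by split=> /asboolP.
  have I_ideal : is_ideal I.
    split; first split; first exact/inI.
    - by move=> x y /inI Ax /inI Ay; apply/inI; apply: AB.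
    - by move=> a x /inI Ax; apply/inI; apply: AM.
  have I1 : 1 \notin I by apply/negP => /inI.
  have AD x y : A x -> A y -> A (x + y).
    by move=> Ax Ay; rewrite -[y]opprK -(sub0r y); apply/AB/AB.
  have IM x y : x * y \in I -> (x \in I) || (y \in I).
    move=> /inI Axy; apply/orP; apply: contrapT => /not_orP[/inI nx /inI ny].
    have [a [r [Aa e]]] := big _ nx; have [b [s [Ab e']]] := big _ ny.
    apply: A1; have -> : 1 = (b + s * y) * a + (r * x) * b + (r * s) * (x * y).
      rewrite -{1}[1]mulr1 {1}e {1}e'; ring.
    by apply/AD/AM/Axy; apply/AD/AM/Ab/AM.
  by exists (PrimeIdeal I_ideal I1 IM).
by exists p => x /JA /pA.
Qed.

End PrimeExistence.

(** * Local freeness *)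

Section LocalGeneration.
Variables (R : comPzRingType) (p : prime_ideal R).
Implicit Types U V : lmodType R.

Definition submod V (W : V -> Prop) : Prop :=
  W 0 /\ forall a x y, W x -> W y -> W (a *: x + y).

(** Generation after localization at p, with one denominator [s] serving all of [W]. Submodules are
    predicates, so that the corners of one algebra can be compared without subtypes. *)
Definition gens V (W : V -> Prop) n (y : 'I_n -> V) (s : R) : Prop :=
  [/\ s \notin p, forall i, W (y i) &
      forall v, W v -> exists c : 'rV[R]_n, s *: v = mxcomb c y 0].

Definition locally_gen V (W : V -> Prop) n : Prop := exists y s, @gens V W n y s.

(** Independence after localization at p: relations may be nonzero over [R], but a single [s] kills
    all of them. *)
Definition indep V n (y : 'I_n -> V) (s : R) : Prop :=
  forall c : 'rV[R]_n, mxcomb c y 0 = 0 -> s *: c = 0.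

Definition locally_free V (W : V -> Prop) n : Prop :=
  exists y s, @gens V W n y s /\ indep y s.

Lemma locally_free_gen V (W : V -> Prop) n : locally_free W n -> locally_gen W n.
Proof. by move=> [y [s [g _]]]; exists y, s. Qed.

Lemma submodD V (W : V -> Prop) x y : submod W -> W x -> W y -> W (x + y).
Proof. by move=> [_ h] *; rewrite -[x]scale1r; apply: h. Qed.

Lemma submodZ V (W : V -> Prop) a x : submod W -> W x -> W (a *: x).
Proof. by move=> [h0 h] *; rewrite -[_ *: _]addr0; apply: h. Qed.

Lemma submodB V (W : V -> Prop) x y : submod W -> W x -> W y -> W (x - y).
Proof.
by move=> mW Wx Wy; rewrite -scaleN1r; apply: submodD => //; apply: submodZ.
Qed.

Lemma submod_sum V (W : V -> Prop) (I : finType) (F : I -> V) :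
  submod W -> (forall i, W (F i)) -> W (\sum_i F i).
Proof.
move=> mW h; elim/big_rec: _ => [|i x _ Wx]; first by case: mW.
exact: submodD.
Qed.

Lemma submod_comb V (W : V -> Prop) m n (A : 'M[R]_(m, n)) (y : 'I_n -> V) i :
  submod W -> (forall i, W (y i)) -> W (mxcomb A y i).
Proof. by move=> mW Wy; apply: submod_sum => // j; apply: submodZ. Qed.

Lemma linear_comb U V (f : {linear U -> V}) m n (A : 'M[R]_(m, n)) y i :
  f (mxcomb A y i) = mxcomb A (f \o y) i.
Proof. by rewrite linear_sum; apply: eq_bigr => j _; rewrite linearZ. Qed.

Definition cat_fam V m n (y : 'I_m -> V) (z : 'I_n -> V) (i : 'I_(m + n)) : V :=
  match fintype.split i with inl j => y j | inr j => z j end.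

Lemma mxcomb_row_mx V k m n (A : 'M[R]_(k, m)) (B : 'M[R]_(k, n))
    (y : 'I_m -> V) z i :
  mxcomb (row_mx A B) (cat_fam y z) i = mxcomb A y i + mxcomb B z i.
Proof.
rewrite /mxcomb big_split_ord /=; congr (_ + _); apply: eq_bigr => j _.
  rewrite row_mxEl /cat_fam; case: split_ordP => l; first by move/lshift_inj->.
  by move/eqP; rewrite eq_lrshift.
rewrite row_mxEr /cat_fam; case: split_ordP => l; last by move/rshift_inj->.
by move/eqP; rewrite eq_rlshift.
Qed.

Lemma cat_famP V m n (y : 'I_m -> V) (z : 'I_n -> V) (W : V -> Prop) :
  (forall i, W (y i)) -> (forall i, W (z i)) -> forall i, W (cat_fam y z i).
Proof. by move=> Wy Wz i; rewrite /cat_fam; case: fintype.split. Qed.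

Lemma scale_mxcomb V m n a (A : 'M[R]_(m, n)) (y : 'I_n -> V) i :
  mxcomb (a *: A) y i = a *: mxcomb A y i.
Proof. by rewrite scaler_sumr; apply: eq_bigr => j _; rewrite mxE scalerA. Qed.

Lemma mxcombN V m n (A : 'M[R]_(m, n)) (y : 'I_n -> V) i :
  mxcomb (- A) y i = - mxcomb A y i.
Proof. by rewrite -[- A]scaleN1r scale_mxcomb scaleN1r. Qed.

Lemma gens_mx V (W : V -> Prop) n (y : 'I_n -> V) s m (z : 'I_m -> V) :
  gens W y s -> (forall i, W (z i)) ->
  exists A : 'M[R]_(m, n), forall i, s *: z i = mxcomb A y i.
Proof.
move=> [_ _ h] Wz; have /choice[c hc] i := h _ (Wz i).
exists (\matrix_i c i) => i; rewrite hc; apply: eq_bigr => j _.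
by rewrite !mxE.
Qed.

(* As many local generators as the local rank form a local basis, since a
   surjective endomorphism of a finite free module is bijective. *)
Lemma gens_indep V (W : V -> Prop) n (z : 'I_n -> V) s :
  locally_free W n -> gens W z s -> exists2 t, t \notin p & indep z t.
Proof.
move=> [y [t [gy iy]]] gz.
have [A eA] : exists A : 'M[R]_n, forall i, t *: z i = mxcomb A y i.
  by apply: gens_mx gy _; case: gz.
have [B eB] : exists B : 'M[R]_n, forall i, s *: y i = mxcomb B z i.
  by apply: gens_mx gz _; case: gy.
have rowE (M : 'M[R]_n) i : mxcomb (row i M) y 0 = mxcomb M y i.
  by apply: eq_bigr => j _; rewrite mxE.
have BA : t *: (B *m A - (s * t)%:M) = 0.
  apply/row_matrixP => i; rewrite row0 linearZ /=; apply: iy.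
  rewrite rowE mxcombD mxcombN mxcombM mxcomb_scalar; apply/eqP; rewrite subr_eq0.
  have /eq_mxcomb-> : mxcomb A y =1 (fun i => t *: z i) by move=> j; rewrite eA.
  rewrite mulrC -scalerA eB /mxcomb scaler_sumr; apply/eqP/eq_bigr => j _.
  by rewrite !scalerA mulrC.
have {}BA : (t *: B) *m A = (t * (s * t))%:M.
  by apply/eqP; rewrite -scalemxAl -scale_scalar_mx -subr_eq0 -scalerBr BA.
have [tp _ _] := gy; have [sp _ _] := gz.
(* [\det A] divides a power of [t * (s * t)], which is invertible at p. *)
have detA : \det A \notin p.
  apply: (contra (@primeMl _ p (\det (t *: B)) _)).
  rewrite -det_mulmx BA det_scalar; elim: n {y z gy iy gz A B eA eB rowE BA} => [|n IH].
    exact: prime1N.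
  by rewrite exprS !primeMN.
exists (t * \det A); first by rewrite primeMN.
move=> c c0; have : t *: (c *m A) = 0.
  apply: iy; rewrite mxcombM.
  have /eq_mxcomb-> : mxcomb A y =1 (fun i => t *: z i) by move=> j; rewrite eA.
  transitivity (t *: mxcomb c z 0); last by rewrite c0 scaler0.
  by rewrite /mxcomb scaler_sumr; apply: eq_bigr => j _; rewrite !scalerA mulrC.
move/(congr1 (mulmx^~ (\adj A))); rewrite mul0mx -scalemxAl -mulmxA mul_mx_adj.
by rewrite mul_mx_scalar scalerA.
Qed.

Lemma gensZ V (W : V -> Prop) n (y : 'I_n -> V) s t :
  t \notin p -> gens W y s -> gens W y (t * s).
Proof.
move=> tp [sp Wy h]; split=> //; first by rewrite primeMN.
move=> v /h[c e]; exists (t *: c); by rewrite scale_mxcomb -e scalerA.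
Qed.

Section Exact.
Variables (U Y Z : lmodType R) (f : {linear U -> Y}) (g : {linear Y -> Z}).
Variables (WU : U -> Prop) (WY : Y -> Prop) (WZ : Z -> Prop).
Hypothesis submodY : submod WY.
Hypothesis f_in : forall u, WU u -> WY (f u).
Hypothesis g_surj : forall z, WZ z -> exists2 y, WY y & g y = z.
Hypothesis g_in : forall y, WY y -> WZ (g y).
Hypothesis g_ker : forall y, WY y -> g y = 0 -> exists2 u, WU u & y = f u.

(** After subtraction of a combination of the lifts [y], a multiple of an element of the middle term
    lies in the kernel of [g], which [f] covers. *)
Lemma exact_gens m n (u : 'I_m -> U) s (y : 'I_n -> Y) t :
  gens WU u s -> (forall i, WY (y i)) -> gens WZ (g \o y) t ->
  gens WY (cat_fam (f \o u) y) (s * t).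
Proof.
move=> [sp Wu hu] Wy [tp _ hz]; split; first by rewrite primeMN.
  by apply: cat_famP => // i; apply: f_in.
move=> v Wv; have [c e] := hz _ (g_in Wv).
have [||w Ww e'] := @g_ker (t *: v - mxcomb c y 0).
- by apply: submodB => //; [apply: submodZ|apply: submod_comb].
- by rewrite linearB linearZ /= linear_comb e subrr.
have [d e''] := hu _ Ww; exists (row_mx d (s *: c)).
rewrite mxcomb_row_mx scale_mxcomb -linear_comb -e'' linearZ /= -e' scalerBr.
by rewrite subrK scalerA.
Qed.

Lemma exact_lift n (z : 'I_n -> Z) t : gens WZ z t ->
  exists y : 'I_n -> Y, (forall i, WY (y i)) /\ gens WZ (g \o y) t.
Proof.
move=> [tp Wz h].
have /choice[y hy] i : exists y, WY y /\ g y = z i.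
  by have [y Wy e] := g_surj (Wz i); exists y.
exists y; split=> [i|]; first by case: (hy i).
split=> // [i|v /h[c ->]]; first by rewrite /= (proj2 (hy i)).
by exists c; apply: eq_mxcomb => i /=; case: (hy i).
Qed.

Lemma exact_locally_gen m n :
  locally_gen WU m -> locally_gen WZ n -> locally_gen WY (m + n).
Proof.
move=> [u [s gu]] [z [t /exact_lift[y [Wy gz]]]].
by exists (cat_fam (f \o u) y), (s * t); apply: exact_gens.
Qed.

(** The [m + n] generators obtained for the middle term form a local basis by [gens_indep]. A
    relation between the images in [Z] extends by a combination of the [f (u i)] to a relation in
    [Y], so its coefficients are locally zero. *)
Lemma exact_locally_free m n :
  locally_free WY (m + n) -> locally_gen WU m -> locally_gen WZ n ->
  locally_free WZ n.
Proof.
move=> fY [u [s gu]] [z [t /exact_lift[y [Wy gz]]]].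
have gY := exact_gens gu Wy gz; have [r rp ir] := gens_indep fY gY.
have [sp _ _] := gu.
exists (g \o y), (r * s * t); split; first by apply: gensZ; rewrite ?primeMN.
move=> c c0.
have [||w Ww e'] := @g_ker (mxcomb c y 0).
- exact: submod_comb.
- by rewrite linear_comb.
have [_ _ /(_ _ Ww)[d e]] := gu.
have /ir : mxcomb (row_mx (- d) (s *: c)) (cat_fam (f \o u) y) 0 = 0.
  rewrite mxcomb_row_mx scale_mxcomb e' mxcombN -linear_comb -e linearZ /=.
  by rewrite addNr.
rewrite scale_row_mx -row_mx0 => /eq_row_mx[_].
by rewrite scalerA => rs0; rewrite mulrC -scalerA rs0 scaler0.
Qed.

End Exact.

Lemma locally_free_fin V (W : V -> Prop) (I : finType) (y : I -> V) s
    n (h : 'I_n -> I) : bijective h ->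
  s \notin p -> (forall i, W (y i)) ->
  (forall v, W v -> exists c : I -> R, s *: v = \sum_i c i *: y i) ->
  (forall c : I -> R, \sum_i c i *: y i = 0 -> forall i, s * c i = 0) ->
  locally_free W n.
Proof.
move=> bh sp Wy hg hi; exists (y \o h), s.
have sumE (c : I -> R) : mxcomb (\row_i c (h i)) (y \o h) 0 = \sum_i c i *: y i.
  rewrite (reindex h) /=; last exact: onW_bij.
  by apply: eq_bigr => i _; rewrite mxE.
split; first split=> // [i|v /hg[c ->]]; first exact: Wy.
  by exists (\row_i c (h i)).
have [k hK kK] := bh => c; have -> : c = \row_i c 0 (k (h i)).
  by apply/rowP => i; rewrite mxE hK.
rewrite (sumE (fun i => c 0 (k i))) => /hi e; apply/rowP => i.
by rewrite !mxE; apply: e.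
Qed.

Lemma locally_free_ffun V (W : V -> Prop) k n : W 0 -> locally_free W n ->
  locally_free (fun F : {ffun 'I_k -> V} => forall i, W (F i)) (k * n).
Proof.
move=> W0 [y [s [[sp Wy hg] hi]]].
pose e (ij : 'I_k * 'I_n) : {ffun 'I_k -> V} :=
  [ffun l => if l == ij.1 then y ij.2 else 0].
have sumE (c : 'I_k * 'I_n -> R) l :
    (\sum_ij c ij *: e ij) l = mxcomb (\row_j c (l, j)) y 0.
  transitivity (\sum_i \sum_j (c (i, j) *: e (i, j)) l).
    by rewrite sum_ffunE pair_bigA /=; apply: eq_bigr => -[].
  rewrite (bigD1 l) //= [X in _ + X]big1 ?addr0.
    by apply: eq_bigr => j _; rewrite !ffunE eqxx mxE.
  by move=> i il; apply: big1 => j _; rewrite !ffunE eq_sym (negPf il) scaler0.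
have [k' kK Kk] := onT_bij (curry_mxvec_bij k n).
apply: (@locally_free_fin _ _ _ e s _ k') => //; first exact: Bijective Kk kK.
- by move=> ij l; rewrite ffunE; case: ifP.
- move=> F WF; have /choice[c hc] l := hg _ (WF l).
  exists (fun ij => c ij.1 0 ij.2); apply/ffunP => l; rewrite ffunE hc sumE.
  by apply: eq_bigr => j _; rewrite mxE.
- move=> c /ffunP h [l j].
  have /hi/rowP/(_ j) : mxcomb (\row_j c (l, j)) y 0 = 0 by rewrite -sumE h ffunE.
  by rewrite !mxE.
Qed.

Lemma locally_free_add V (W W1 W2 : V -> Prop) m n :
  (forall v, W v <-> exists v1 v2, [/\ W1 v1, W2 v2 & v = v1 + v2]) ->
  submod W1 -> submod W2 ->
  (forall v1 v2, W1 v1 -> W2 v2 -> v1 + v2 = 0 -> v1 = 0 /\ v2 = 0) ->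
  locally_free W1 m -> locally_free W2 n -> locally_free W (m + n).
Proof.
move=> WE mW1 mW2 dir [y [s [[sp Wy hy] iy]]] [z [t [[tp Wz hz] iz]]].
exists (cat_fam y z), (s * t); split.
  split; first by rewrite primeMN.
    apply: cat_famP => i; apply/WE.
      by exists (y i), 0; rewrite addr0; split=> //; case: mW2.
    by exists 0, (z i); rewrite add0r; split=> //; case: mW1.
  move=> _ /WE[v1 [v2 [/hy[c ec] /hz[d ed] ->]]].
  exists (row_mx (t *: c) (s *: d)); rewrite mxcomb_row_mx !scale_mxcomb.
  by rewrite -ec -ed scalerDr !scalerA [t * s]mulrC.
move=> c; rewrite -[c]hsubmxK mxcomb_row_mx => /dir[||/iy e1 /iz e2].
- exact: submod_comb.
- exact: submod_comb.
rewrite scale_row_mx -{1}[s * t]mulrC -!scalerA e1 e2 !scaler0; exact: row_mx0.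
Qed.

Lemma locally_free0 V (W : V -> Prop) : W 0 -> (forall v, W v -> v = 0) ->
  locally_free W 0.
Proof.
move=> W0 WE; exists (fun _ => 0), 1; split.
  split; [exact: prime1N|by []|move=> v /WE->; exists 0].
  by rewrite scaler0 mxcomb_eq0.
by move=> c _; apply/rowP => -[].
Qed.

End LocalGeneration.

(** * From local bases to finitely generated projective modules *)

Section LocallyFreeProjective.
Variables (R : comPzRingType) (V : lmodType R) (n : nat).
Hypothesis freeV : forall p : prime_ideal R, locally_free p (fun _ : V => True) n.

(** The elements r such that multiplication by r factors through a finite free module. For r = 1
    this is the dual basis criterion for a finitely generated projective module. *)
Definition dual_basis_set (r : R) : Prop :=
  exists m (y : 'I_m -> V) (phi : 'I_m -> {linear V -> R^o}),
    forall v, r *: v = \sum_i (phi i v : R) *: y i.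

Lemma dual_basis_ideal : ideal_set dual_basis_set.
Proof.
split.
- exists 0, (fun _ => 0), (fun _ => \0%R) => v.
  by rewrite big_ord0 scale0r.
- move=> r r' [m [y [phi h]]] [m' [y' [phi' h']]].
  exists (m + m')%N, (cat_fam y (fun i => - y' i)).
  exists (fun i => match fintype.split i with inl j => phi j | inr j => phi' j end).
  move=> v; rewrite scalerBl h h' big_split_ord /=; congr (_ + _).
    apply: eq_bigr => i _; rewrite /cat_fam; case: split_ordP => j.
      by move/lshift_inj->.
    by move/eqP; rewrite eq_lrshift.
  rewrite -sumrN; apply: eq_bigr => i _; rewrite /cat_fam.
  case: split_ordP => j; last by move/rshift_inj->; rewrite scalerN.
  by move/eqP; rewrite eq_rlshift.
- move=> a r [m [y [phi h]]]; exists m, (fun i => a *: y i), phi => v.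
  rewrite -scalerA h scaler_sumr; apply: eq_bigr => i _.
  by rewrite !scalerA mulrC.
Qed.

(** Otherwise this ideal lies in a prime p, while a local basis at p puts into it the element
    [s * s], which is outside p. *)
Lemma dual_basis1 : dual_basis_set 1.
Proof.
apply: contrapT => /(exists_prime dual_basis_ideal)[p hp].
have [y [s [[sp _ hy] iy]]] := freeV p.
have /choice[c hc] v := hy v I.
(* The coordinates [c v] are merely chosen, but two choices differ by a relation, which [s]
   kills. *)
have lin i : linear (fun v => s * c v 0 i : R^o).
  move=> a v w; have : mxcomb (a *: c v + c w - c (a *: v + w)) y 0 = 0.
    by rewrite !mxcombD mxcombN scale_mxcomb -!hc scalerDr !scalerA mulrC subrr.
  move/iy/rowP/(_ i); rewrite !mxE mulrBr => /eqP; rewrite subr_eq0 => /eqP <-.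
  by rewrite mulrDr mulrCA.
pose phi i : {linear V -> R^o} :=
  HB.pack (fun v => s * c v 0 i : R^o) (GRing.isLinear.Build _ _ _ _ _ (lin i)).
have : s * s \in p.
  apply: hp; exists n, y, phi => v; rewrite -[LHS]scalerA (hc v) /mxcomb scaler_sumr.
  by apply: eq_bigr => i _; rewrite scalerA.
by move/prime_mul; rewrite orbb (negPf sp).
Qed.

Lemma locally_free_fg : finitely_generated V.
Proof.
have [m [y [phi h]]] := dual_basis1; exists m, y => v.
by exists (fun i => phi i v); rewrite -h scale1r.
Qed.

Lemma locally_free_projective : projective V.
Proof.
have [m [y [phi h]]] := dual_basis1 => M N g f gsurj.
have /choice[x hx] i := gsurj (f (y i)).
have lin : linear (fun v => \sum_i (phi i v : R) *: x i).
  move=> a v w; rewrite scaler_sumr -big_split; apply: eq_bigr => i _ /=.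
  by rewrite linearD linearZ scalerDl scalerA.
pose k : {linear V -> M} := HB.pack (fun v => \sum_i (phi i v : R) *: x i)
  (GRing.isLinear.Build _ _ _ _ _ lin).
exists k => v; rewrite -[in RHS](scale1r v) h !linear_sum.
by apply: eq_bigr => i _; rewrite !linearZ /= hx.
Qed.

Lemma locally_free_loc (p : prime_ideal R) :
  @free_of_rank (locring (prime_compl p)) (loc (prime_compl p) V) n.
Proof.
pose W := prime_compl p; have [y [s [[sp _ hy] iy]]] := freeV p.
have [s' es] := denomN sp.
have frac_sum m (t : denom W) (v : 'I_m -> V) :
    \sum_i (frac (v i) t : loc W V) = frac (\sum_i v i) t.
  elim/big_rec2: _ => [|i v1 v2 _ ->].
    by apply: frac_eq; rewrite den1 !scaler0.
  rewrite frac_add; apply: frac_eq; rewrite denM !(scalerDr, scalerA).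
  by [].
have combE (c : 'I_n -> R) (t : denom W) :
    \sum_i (frac (c i : R^o) t : locring W) *: (frac (y i) (denom1 W) : loc W V) =
    frac (\sum_i c i *: y i) t.
  rewrite -frac_sum; apply: eq_bigr => i _; rewrite frac_scale.
  by apply: frac_eq; rewrite denM den1 mulr1.
exists (fun i => frac (y i) (denom1 W)) => x; have [v [t ->]] := frac_surj x.
have [c hc] := hy v I.
(* Since [s *: v] is the combination with coefficients [c], the coordinates of v/t have denominator
   s t. *)
pose c0 : {ffun 'I_n -> locring W} := [ffun i => frac (c 0 i : R^o) (denomM s' t)].
have c0E : frac v t = \sum_i c0 i *: (frac (y i) (denom1 W) : loc W V).
  under eq_bigr do rewrite ffunE.
  by rewrite combE -[\sum_i _]hc; apply: frac_eq; rewrite denM es scalerA mulrC.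
exists c0; split=> // c1 e.
have [|i|t1 t1p ht] := @common_denom R p 'I_n (fun i r => exists b : R,
    forall d : denom W, den d = r -> c1 i = frac (b : R^o) d).
- move=> i r r' [b hb]; exists (r' * b) => d ed.
  have rp : r \notin p by apply: (contra (@primeMl _ p r' r)); rewrite -ed denN.
  have [d' ed'] := denomN rp; rewrite (hb d' ed'); apply: frac_eq.
  by rewrite ed ed' /GRing.scale /=; ring.
- have [b [d ->]] := locring_frac (c1 i); exists (den d); first exact: denN.
  by exists b => d' ed'; apply: frac_eq; rewrite ed'.
have [d ed] := denomN t1p; have /choice[b hb] := ht.
have eb i : c1 i = frac (b i : R^o) d by apply: hb.
have e1 : frac v t = frac (\sum_i b i *: y i) d.
  by rewrite e -combE; apply: eq_bigr => i _; rewrite eb.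
have [u hu] := (fracP _ _ _ _).1 e1.
(* Cross-multiplying the two expressions of v/t yields a relation between the [y i] over [R];
   killing it by [s] identifies the coordinates as fractions. *)
have : mxcomb ((den u * den d) *: c - \row_i (den u * den t * s * b i)) y 0 = 0.
  rewrite mxcombD mxcombN scale_mxcomb -hc scalerA mulrC -scalerA hu !scalerA.
  rewrite /mxcomb scaler_sumr; apply/eqP; rewrite subr_eq0; apply/eqP.
  by apply: eq_bigr => i _; rewrite !mxE scalerA; congr (_ *: _); ring.
move/iy/rowP => h; apply/ffunP => i; rewrite ffunE eb; apply: (fracP _ _ _ _).2.
have [u' eu'] : exists u' : denom W, den u' = den u * s.
  have [u' eu'] := denomN (primeMN (denN u) sp); by exists u'.
exists u'; move/eqP: (h i); rewrite !mxE mulrBr subr_eq0 => /eqP ei.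
rewrite eu' denM es /GRing.scale /=.
transitivity (s * (den u * den d * c 0 i)); first by ring.
by rewrite ei; ring.
Qed.

Lemma locally_free_projective_of_rank : projective_of_rank V n.
Proof.
split; [exact: locally_free_fg|exact: locally_free_projective|].
exact: locally_free_loc.
Qed.

End LocallyFreeProjective.

(** * Generators and relations of the preprojective algebra *)

Section Preprojective.
Variables (R S : comPzRingType) (phi : {rmorphism R -> S}).

Local Notation A := (R * S)%type.
Local Notation B := (bim_sum (bimM phi) (bimN phi)).
Local Notation T := (TRS phi).

Lemma TRS_vec (u : B) : tens_vec u = inM phi u.1 + inN phi u.2.
Proof.
rewrite -[RHS]tens_vecD; congr tens_vec.
by case: u => m m'; congr pair; rewrite /= ?addr0 ?add0r.
Qed.

Lemma TRS_ind (Q : T -> Prop) :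
  (forall a, Q (tens_scal _ a)) -> (forall m, Q (inM phi m)) ->
  (forall m, Q (inN phi m)) -> (forall x y, Q x -> Q y -> Q (x + y)) ->
  (forall x, Q x -> Q (- x)) -> (forall x y, Q x -> Q y -> Q (x * y)) ->
  forall t, Q t.
Proof.
move=> Qa QM QN QD QO Qmul t; have [x ->] := tclass_surj t.
elim: x => [a|u|x Qx y Qy|x Qx|x Qx y Qy].
- exact: Qa.
- by rewrite -[tclass _]/(tens_vec u) TRS_vec; apply: QD.
- by rewrite tclassD; apply: QD.
- by rewrite tclassN; apply: QO.
- by rewrite tclassM; apply: Qmul.
Qed.

Lemma TRS_lift (Q : pzRingType) (al : {rmorphism A -> Q}) (bM bN : S -> Q) :
  {morph bM : x y / x + y} -> {morph bN : x y / x + y} ->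
  (forall a m, bM (phi a.1 * m) = al a * bM m) ->
  (forall a m, bM (m * a.2) = bM m * al a) ->
  (forall a m, bN (a.2 * m) = al a * bN m) ->
  (forall a m, bN (m * phi a.1) = bN m * al a) ->
  exists h : {rmorphism T -> Q}, [/\ forall a, h (tens_scal _ a) = al a,
    forall m, h (inM phi m) = bM m & forall m, h (inN phi m) = bN m].
Proof.
move=> MD ND Ml Mr Nl Nr.
pose be (u : B) : Q := bM u.1 + bN u.2.
have beD u v : be (u + v) = be u + be v by rewrite /be MD ND addrACA.
have bel a u : be (lact a u) = al a * be u by rewrite /be Ml Nl -mulrDr.
have ber u a : be (ract u a) = be u * al a by rewrite /be Mr Nr -mulrDl.
have M0 : bM 0 = 0 by apply: (addIr (bM 0)); rewrite -MD !add0r.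
have N0 : bN 0 = 0 by apply: (addIr (bN 0)); rewrite -ND !add0r.
have zmodL : zmod_morphism (tens_lift al be) := tens_lift_zmod beD bel ber.
have monoidL : monoid_morphism (tens_lift al be) := tens_lift_monoid beD bel ber.
have scalL a : tens_lift al be (tens_scal _ a) = al a := tens_lift_scal beD bel ber a.
have vecL u : tens_lift al be (tens_vec u) = be u := tens_lift_vec beD bel ber u.
move: (tens_lift al be) zmodL monoidL scalL vecL => k zmodL monoidL scalL vecL.
pose h : {rmorphism T -> Q} := HB.pack (k : T -> Q)
  (GRing.isZmodMorphism.Build _ _ _ zmodL)
  (GRing.isMonoidMorphism.Build _ _ _ monoidL).
exists h; split=> [//|m|m].
- by rewrite [LHS]vecL /be N0 addr0.
- by rewrite [LHS]vecL /be M0 add0r.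
Qed.

Variables (n : nat) (e f : 'I_n -> S).
Local Notation P := (preproj phi e f).

Fact preproj_of_zmod : zmod_morphism (@preproj_of R S phi n e f).
Proof. exact: quot_pi_zmod. Qed.
HB.instance Definition _ := GRing.isZmodMorphism.Build T P
  (@preproj_of R S phi n e f) preproj_of_zmod.

Fact preproj_of_monoid : monoid_morphism (@preproj_of R S phi n e f).
Proof. exact: quot_pi_monoid. Qed.
HB.instance Definition _ := GRing.isMonoidMorphism.Build T P
  (@preproj_of R S phi n e f) preproj_of_monoid.

Local Notation pr := (@preproj_of R S phi n e f).

Definition scal (a : A) : P := pr (tens_scal _ a).
Definition gM (m : S) : P := pr (inM phi m).
Definition gN (m : S) : P := pr (inN phi m).

Fact scal_zmod : zmod_morphism scal.
Proof.
move=> a b; rewrite /scal -rmorphB; congr pr.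
by apply/eqP; rewrite eq_sym subr_eq -tens_scalD subrK.
Qed.
HB.instance Definition _ := GRing.isZmodMorphism.Build A P scal scal_zmod.

Fact scal_monoid : monoid_morphism scal.
Proof.
split=> [|a b]; first by rewrite /scal tens_scal1 rmorph1.
by rewrite /scal tens_scalM rmorphM.
Qed.
HB.instance Definition _ := GRing.isMonoidMorphism.Build A P scal scal_monoid.

Lemma inMD : {morph inM phi : x y / x + y}.
Proof.
by move=> x y; rewrite -[RHS]tens_vecD; congr tens_vec; congr pair; rewrite addr0.
Qed.

Lemma inND : {morph inN phi : x y / x + y}.
Proof.
by move=> x y; rewrite -[RHS]tens_vecD; congr tens_vec; congr pair; rewrite addr0.
Qed.

Fact gM_zmod : zmod_morphism gM.
Proof.
move=> x y; rewrite /gM; apply/eqP; rewrite eq_sym subr_eq -rmorphD.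
by rewrite -inMD subrK.
Qed.
HB.instance Definition _ := GRing.isZmodMorphism.Build S P gM gM_zmod.

Fact gN_zmod : zmod_morphism gN.
Proof.
move=> x y; rewrite /gN; apply/eqP; rewrite eq_sym subr_eq -rmorphD.
by rewrite -inND subrK.
Qed.
HB.instance Definition _ := GRing.isZmodMorphism.Build S P gN gN_zmod.

Lemma scal_gM a m : scal a * gM m = gM (phi a.1 * m).
Proof.
rewrite /scal /gM -rmorphM -tens_lact; congr (pr (tens_vec _)).
by congr pair; rewrite /= mulr0.
Qed.

Lemma gM_scal a m : gM m * scal a = gM (m * a.2).
Proof.
rewrite /scal /gM -rmorphM -tens_ract; congr (pr (tens_vec _)).
by congr pair; rewrite /= mul0r.
Qed.

Lemma scal_gN a m : scal a * gN m = gN (a.2 * m).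
Proof.
rewrite /scal /gN -rmorphM -tens_lact; congr (pr (tens_vec _)).
by congr pair; rewrite /= mulr0.
Qed.

Lemma gN_scal a m : gN m * scal a = gN (m * phi a.1).
Proof.
rewrite /scal /gN -rmorphM -tens_ract; congr (pr (tens_vec _)).
by congr pair; rewrite /= mul0r.
Qed.

Lemma preproj_rel0 t : preproj_rel (phi := phi) e f t -> pr t = 0.
Proof.
move=> rt; rewrite -(rmorph0 pr); apply/quot_pi_eq.
by rewrite subr0; apply: gen_ideal_gen.
Qed.

Lemma gM1_gN1 : gM 1 * gN 1 = 0.
Proof. by rewrite /gM /gN -rmorphM /= preproj_rel0 //; left. Qed.

Lemma sum_gN_gM : \sum_i gN (e i) * gM (f i) = 0.
Proof.
have : pr (\sum_i inN phi (e i) * inM phi (f i)) = 0.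
  by apply: preproj_rel0; right.
by rewrite rmorph_sum => {2}<-; apply: eq_bigr => i _; rewrite rmorphM.
Qed.

Lemma preproj_ind (Q : P -> Prop) :
  (forall a, Q (scal a)) -> (forall m, Q (gM m)) ->
  (forall m, Q (gN m)) -> (forall x y, Q x -> Q y -> Q (x + y)) ->
  (forall x, Q x -> Q (- x)) -> (forall x y, Q x -> Q y -> Q (x * y)) ->
  forall x, Q x.
Proof.
move=> Qa QM QN QD QO Qmul x; have [t ->] := quot_pi_surj x.
elim/TRS_ind: t => [a|m|m|y z Qy Qz|y Qy|y z Qy Qz].
- exact: Qa.
- exact: QM.
- exact: QN.
- by rewrite (rmorphD pr); apply: QD.
- by rewrite (rmorphN pr); apply: QO.
- by rewrite (rmorphM pr); apply: Qmul.
Qed.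

Lemma preproj_lift (Q : pzRingType) (al : {rmorphism A -> Q}) (bM bN : S -> Q) :
  {morph bM : x y / x + y} -> {morph bN : x y / x + y} ->
  (forall a m, bM (phi a.1 * m) = al a * bM m) ->
  (forall a m, bM (m * a.2) = bM m * al a) ->
  (forall a m, bN (a.2 * m) = al a * bN m) ->
  (forall a m, bN (m * phi a.1) = bN m * al a) ->
  bM 1 * bN 1 = 0 -> \sum_i bN (e i) * bM (f i) = 0 ->
  exists h : {rmorphism P -> Q}, [/\ forall a, h (scal a) = al a,
    forall m, h (gM m) = bM m & forall m, h (gN m) = bN m].
Proof.
move=> MD ND Ml Mr Nl Nr r1 r2.
have [k [kA kM kN]] := TRS_lift MD ND Ml Mr Nl Nr.
have kI t : gen_ideal (preproj_rel (phi := phi) e f) t -> k t = 0.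
  elim=> {t} [|t [->|->]|x y _ ex _ ey|a x _ ex|a x _ ex].
  - exact: rmorph0.
  - by rewrite rmorphM kM kN.
  - by rewrite rmorph_sum -[RHS]r2; apply: eq_bigr => i _; rewrite rmorphM kM kN.
  - by rewrite rmorphB ex ey subrr.
  - by rewrite rmorphM ex mulr0.
  - by rewrite rmorphM ex mul0r.
pose h (x : P) : Q := k (repr x).
have hE t : h (pr t) = k t.
  apply/eqP; rewrite -subr_eq0 -rmorphB; apply/eqP/kI/quot_pi_eq.
  by rewrite /quot_pi reprK.
have h_zmod : zmod_morphism h.
  move=> x y; have [s ->] := quot_pi_surj x; have [t ->] := quot_pi_surj y.
  by rewrite -(rmorphB pr) !hE rmorphB.
have h_monoid : monoid_morphism h.
  split; first by rewrite -(rmorph1 pr) hE rmorph1.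
  move=> x y; have [s ->] := quot_pi_surj x; have [t ->] := quot_pi_surj y.
  by rewrite -(rmorphM pr) !hE rmorphM.
pose h' : {rmorphism P -> Q} := HB.pack h
  (GRing.isZmodMorphism.Build _ _ _ h_zmod)
  (GRing.isMonoidMorphism.Build _ _ _ h_monoid).
by exists h'; split=> [a|m|m]; rewrite [LHS]hE.
Qed.

Lemma preproj_scaleE r (x : P) : r *: x = scal (r, phi r) * x.
Proof. by []. Qed.

(** [R] is central because left and right multiplication agree on the generators. *)
Lemma preproj_scaleC r (x : P) : r *: x = x * scal (r, phi r).
Proof.
rewrite preproj_scaleE; elim/preproj_ind: x => [a|m|m|x y ex ey|x ex|x y ex ey].
- by rewrite -!rmorphM mulrC.
- by rewrite scal_gM gM_scal mulrC.
- by rewrite scal_gN gN_scal mulrC.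
- by rewrite mulrDl mulrDr ex ey.
- by rewrite mulNr mulrN ex.
- by rewrite mulrA ex -!mulrA ey.
Qed.

End Preprojective.

Section ThreeBlocks.
Variables (Q : pzRingType) (a b c : nat).

Definition blk3 (A00 : 'M[Q]_a) (A01 : 'M_(a, b)) (A02 : 'M_(a, c))
    (A10 : 'M_(b, a)) (A11 : 'M_b) (A12 : 'M_(b, c))
    (A20 : 'M_(c, a)) (A21 : 'M_(c, b)) (A22 : 'M_c) : 'M[Q]_(a + (b + c)) :=
  block_mx A00 (row_mx A01 A02) (col_mx A10 A20) (block_mx A11 A12 A21 A22).

Lemma blk3M A00 A01 A02 A10 A11 A12 A20 A21 A22
    B00 B01 B02 B10 B11 B12 B20 B21 B22 :
  blk3 A00 A01 A02 A10 A11 A12 A20 A21 A22 *m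
    blk3 B00 B01 B02 B10 B11 B12 B20 B21 B22 =
  blk3 (A00 *m B00 + (A01 *m B10 + A02 *m B20))
       (A00 *m B01 + (A01 *m B11 + A02 *m B21))
       (A00 *m B02 + (A01 *m B12 + A02 *m B22))
       (A10 *m B00 + (A11 *m B10 + A12 *m B20))
       (A10 *m B01 + (A11 *m B11 + A12 *m B21))
       (A10 *m B02 + (A11 *m B12 + A12 *m B22))
       (A20 *m B00 + (A21 *m B10 + A22 *m B20))
       (A20 *m B01 + (A21 *m B11 + A22 *m B21))
       (A20 *m B02 + (A21 *m B12 + A22 *m B22)).
Proof.
rewrite /blk3 mulmx_block mul_row_col mul_mx_row mul_row_block add_row_mx.
rewrite mul_col_mx mul_block_col add_col_mx mul_col_row mulmx_block.
by rewrite add_block_mx.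
Qed.

Lemma blk3D A00 A01 A02 A10 A11 A12 A20 A21 A22
    B00 B01 B02 B10 B11 B12 B20 B21 B22 :
  blk3 A00 A01 A02 A10 A11 A12 A20 A21 A22 +
    blk3 B00 B01 B02 B10 B11 B12 B20 B21 B22 =
  blk3 (A00 + B00) (A01 + B01) (A02 + B02) (A10 + B10) (A11 + B11) (A12 + B12)
    (A20 + B20) (A21 + B21) (A22 + B22).
Proof. by rewrite /blk3 !add_block_mx add_row_mx add_col_mx. Qed.

Definition mx0E := (mul0mx, mulmx0, addr0, add0r).

Lemma row_blk3 (u : 'rV[Q]_a) (v : 'rV_b) (w : 'rV_c)
    B00 B01 B02 B10 B11 B12 B20 B21 B22 :
  row_mx u (row_mx v w) *m blk3 B00 B01 B02 B10 B11 B12 B20 B21 B22 =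
  row_mx (u *m B00 + (v *m B10 + w *m B20))
    (row_mx (u *m B01 + (v *m B11 + w *m B21))
            (u *m B02 + (v *m B12 + w *m B22))).
Proof.
by rewrite /blk3 mul_row_block mul_row_col mul_mx_row mul_row_block add_row_mx.
Qed.

(** The three shapes are those of right multiplication by a scalar, by an element of M and by an
    element of N: a product that ends in M or N has only its last, respectively its middle,
    coordinate. *)
Definition diag3 D E F := blk3 D 0 0 0 E 0 0 0 F.
Definition last_col3 U V := blk3 0 0 U 0 0 V 0 0 0.
Definition mid_col3 U V := blk3 0 U 0 0 0 0 0 V 0.

Lemma diag3D D E F D' E' F' :
  diag3 D E F + diag3 D' E' F' = diag3 (D + D') (E + E') (F + F').
Proof. by rewrite /diag3 blk3D !mx0E. Qed.

Lemma diag3_1 : diag3 1%:M 1%:M 1%:M = 1%:M.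
Proof.
rewrite /diag3 /blk3 col_mx0 row_mx0 [RHS]scalar_mx_block; congr block_mx.
by rewrite [RHS]scalar_mx_block.
Qed.

Lemma diag3M D E F D' E' F' :
  diag3 D E F *m diag3 D' E' F' = diag3 (D *m D') (E *m E') (F *m F').
Proof. by rewrite /diag3 blk3M !mx0E. Qed.

Lemma last_col3D U V U' V' :
  last_col3 U V + last_col3 U' V' = last_col3 (U + U') (V + V').
Proof. by rewrite /last_col3 blk3D !mx0E. Qed.

Lemma mid_col3D U V U' V' :
  mid_col3 U V + mid_col3 U' V' = mid_col3 (U + U') (V + V').
Proof. by rewrite /mid_col3 blk3D !mx0E. Qed.

Lemma diag3_last D E F U V :
  diag3 D E F *m last_col3 U V = last_col3 (D *m U) (E *m V).
Proof. by rewrite /diag3 /last_col3 blk3M !mx0E. Qed.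

Lemma last_diag3 D E F U V :
  last_col3 U V *m diag3 D E F = last_col3 (U *m F) (V *m F).
Proof. by rewrite /diag3 /last_col3 blk3M !mx0E. Qed.

Lemma diag3_mid D E F U V :
  diag3 D E F *m mid_col3 U V = mid_col3 (D *m U) (F *m V).
Proof. by rewrite /diag3 /mid_col3 blk3M !mx0E. Qed.

Lemma mid_diag3 D E F U V :
  mid_col3 U V *m diag3 D E F = mid_col3 (U *m E) (V *m E).
Proof. by rewrite /diag3 /mid_col3 blk3M !mx0E. Qed.

Lemma row_diag3 (u : 'rV[Q]_a) (v : 'rV_b) (w : 'rV_c) D E F :
  row_mx u (row_mx v w) *m diag3 D E F =
  row_mx (u *m D) (row_mx (v *m E) (w *m F)).
Proof. by rewrite /diag3 row_blk3 !mx0E. Qed.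

Lemma row_last3 (u : 'rV[Q]_a) (v : 'rV_b) (w : 'rV_c) U V :
  row_mx u (row_mx v w) *m last_col3 U V =
  row_mx 0 (row_mx 0 (u *m U + v *m V)).
Proof. by rewrite /last_col3 row_blk3 !mx0E. Qed.

Lemma row_mid3 (u : 'rV[Q]_a) (v : 'rV_b) (w : 'rV_c) U V :
  row_mx u (row_mx v w) *m mid_col3 U V =
  row_mx 0 (row_mx (u *m U + w *m V) 0).
Proof. by rewrite /mid_col3 row_blk3 !mx0E. Qed.

End ThreeBlocks.

Section PreprojectiveRelations.
Variables (R S : comPzRingType) (phi : {rmorphism R -> S}).
Variables (n : nat) (e f : 'I_n -> S) (l : {additive S -> R}).
Hypothesis lZ : forall r x, l (phi r * x) = r * l x.
Hypothesis eE : forall y, y = \sum_i phi (l (y * f i)) * e i.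
Hypothesis fE : forall y, y = \sum_i phi (l (y * e i)) * f i.
Hypothesis ef : forall i j, l (e i * f j) = (i == j)%:R.

Local Notation A := (R * S)%type.
Local Notation T := (TRS phi).

(* P will be the preprojective algebra. *)
Variables (P : pzRingType) (sc : {rmorphism A -> P}) (M N : {additive S -> P}).
Hypothesis scM : forall a m, sc a * M m = M (phi a.1 * m).
Hypothesis Msc : forall a m, M m * sc a = M (m * a.2).
Hypothesis scN : forall a m, sc a * N m = N (a.2 * m).
Hypothesis Nsc : forall a m, N m * sc a = N (m * phi a.1).
Hypothesis M1N1 : M 1 * N 1 = 0.
Hypothesis sumNM : \sum_i N (e i) * M (f i) = 0.
Hypothesis scC : forall r x, x * sc (r, phi r) = sc (r, phi r) * x.

Local Notation rho r := (sc (r, phi r)).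

Lemma l_sum z w : \sum_k l (z * e k) * l (f k * w) = l (z * w).
Proof.
rewrite [in RHS](fE z) mulr_suml raddf_sum; apply: eq_bigr => k _.
by rewrite -mulrA lZ.
Qed.

Lemma rhoM r r' : rho (r * r') = rho r * rho r'.
Proof. by rewrite -[RHS](rmorphM sc); congr (sc _); congr pair; rewrite rmorphM. Qed.

Lemma rhoD r r' : rho (r + r') = rho r + rho r'.
Proof. by rewrite -[RHS](rmorphD sc); congr (sc _); congr pair; rewrite rmorphD. Qed.

Lemma rho_sum (I : finType) (F : I -> R) : rho (\sum_i F i) = \sum_i rho (F i).
Proof.
elim: (index_enum I) => [|i r IH]; last by rewrite !big_cons rhoD IH.
by rewrite !big_nil -(rmorph0 sc); congr (sc _); congr pair; rewrite rmorph0.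
Qed.

Lemma rho1 : rho 1 = 1.
Proof. by rewrite -[RHS](rmorph1 sc); congr (sc _); congr pair; rewrite rmorph1. Qed.

Lemma rho0 : rho 0 = 0.
Proof. by rewrite -[RHS](rmorph0 sc); congr (sc _); congr pair; rewrite rmorph0. Qed.

Lemma rho_nat k : rho k%:R = k%:R.
Proof. by elim: k => [|k IH]; rewrite ?rho0 // !mulrS rhoD rho1 IH. Qed.

Lemma M_sum w m : \sum_k rho (l (w * e k)) * M (f k * m) = M (w * m).
Proof.
rewrite [in RHS](fE w) mulr_suml raddf_sum; apply: eq_bigr => k _.
by rewrite scM mulrA.
Qed.

Lemma N_sum w : \sum_k N (e k) * rho (l (f k * w)) = N w.
Proof.
rewrite [in RHS](eE w) raddf_sum; apply: eq_bigr => k _.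
by rewrite scC scN /= mulrC [w * _]mulrC mulrC.
Qed.

(* A row (a, b, z) stands for the expression a + b * N 1 + \sum_k z k * M (f k),
   and the matrices below for right multiplication of such expressions. The
   ideal of relations moves rows into those of the form
   (0, x * M 1, fun i => y * N (e i)), which are thus the only ones that stand
   for 0. *)
Definition mx_sc (a : A) : 'M[P]_(1 + (1 + n)) :=
  diag3 (sc a)%:M (rho a.1)%:M (\matrix_(i, j) rho (l (f i * a.2 * e j))).

Definition mx_M (m : S) : 'M[P]_(1 + (1 + n)) :=
  last_col3 (\row_j (rho (l (m * e j)) * sc (1, 0)))
            (\row_j (rho (l (m * e j)) * N 1)).

Definition mx_N (m : S) : 'M[P]_(1 + (1 + n)) :=
  mid_col3 (sc (0, m))%:M (\col_i M (f i * m)).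

Fact mx_sc_zmod : zmod_morphism mx_sc.
Proof.
move=> a b; apply/eqP; rewrite eq_sym subr_eq; apply/eqP.
rewrite diag3D -raddfD -rmorphD -raddfD subrK -rhoD /= subrK; congr diag3.
apply/matrixP => i j; rewrite !mxE -rhoD -raddfD -mulrDl -mulrDr.
by rewrite subrK.
Qed.

Fact mx_sc_monoid : monoid_morphism mx_sc.
Proof.
split=> [|a b].
  rewrite -[RHS]diag3_1 /mx_sc rmorph1 rho1; congr diag3.
  by apply/matrixP => i j; rewrite !mxE mulr1 mulrC ef eq_sym rho_nat.
rewrite -[RHS]/(mx_sc a *m mx_sc b) diag3M -!scalar_mxM.
rewrite /mx_sc rmorphM -rhoM; congr diag3.
apply/matrixP => i j; rewrite !mxE.
have -> : f i * (a * b).2 * e j = f i * a.2 * (b.2 * e j) by rewrite /= !mulrA.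
rewrite -l_sum rho_sum; apply: eq_bigr => k _; rewrite !mxE rhoM.
by rewrite !mulrA.
Qed.

(** Only the tensor algebra acts on rows: the relations of the preprojective algebra need not act by
    0, and where they send a row is exactly the information wanted. *)
Lemma tens_rep : exists h : {rmorphism T -> 'M[P]_(1 + (1 + n))},
  [/\ forall a, h (tens_scal _ a) = mx_sc a,
    forall m, h (inM phi m) = mx_M m & forall m, h (inN phi m) = mx_N m].
Proof.
pose sc' : {rmorphism A -> 'M[P]_(1 + (1 + n))} := HB.pack mx_sc
  (GRing.isZmodMorphism.Build _ _ _ mx_sc_zmod)
  (GRing.isMonoidMorphism.Build _ _ _ mx_sc_monoid).
apply: (@TRS_lift R S phi 'M[P]_(1 + (1 + n)) sc' mx_M mx_N).
- move=> x y; rewrite last_col3D; congr last_col3; apply/rowP => j.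
    by rewrite !mxE mulrDl raddfD rhoD mulrDl.
  by rewrite !mxE mulrDl raddfD rhoD mulrDl.
- move=> x y; rewrite mid_col3D -raddfD -rmorphD; congr mid_col3.
    by congr (sc _)%:M; congr pair; rewrite addr0.
  by apply/colP => i; rewrite !mxE mulrDr raddfD.
- move=> a m; rewrite -[RHS]/(mx_sc a *m mx_M m) diag3_last !mul_scalar_mx.
  congr last_col3; apply/rowP => j; rewrite !mxE -mulrA lZ rhoM -mulrA.
    rewrite [LHS]mulrA scC -mulrA [RHS]mulrA scC -mulrA -!rmorphM.
    by congr (sc (_ * _)); congr pair; rewrite /= ?mulr0 ?mulr1.
  by [].
- move=> a m; rewrite -[RHS]/(mx_M m *m mx_sc a) last_diag3.
  have mulE (y : P) : (\row_j (rho (l (m * e j)) * y)) *m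
      (\matrix_(i, j) rho (l (f i * a.2 * e j))) =
      \row_j (rho (l (m * a.2 * e j)) * y).
    apply/rowP => j; rewrite !mxE -mulrA -l_sum rho_sum mulr_suml.
    by apply: eq_bigr => k _; rewrite !mxE rhoM -!mulrA scC.
  by rewrite !mulE.
- move=> a m; rewrite -[RHS]/(mx_sc a *m mx_N m) diag3_mid.
  congr mid_col3.
    rewrite -scalar_mxM -rmorphM; congr (sc _)%:M.
    by congr pair; rewrite /= mulr0.
  apply/colP => i; rewrite !mxE mulrA -M_sum.
  by apply: eq_bigr => k _; rewrite !mxE.
- move=> a m; rewrite -[RHS]/(mx_N m *m mx_sc a) mid_diag3.
  congr mid_col3.
    rewrite -scalar_mxM -rmorphM; congr (sc _)%:M.
    by congr pair; rewrite /= mul0r.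
  apply/colP => i; rewrite !mxE big_ord1 !mxE eqxx mulr1n Msc /=.
  by rewrite mulrA.
Qed.

Definition row3 (a b : P) (z : 'I_n -> P) : 'rV[P]_(1 + (1 + n)) :=
  row_mx a%:M (row_mx b%:M (\row_j z j)).

Lemma row3_surj v : exists a b z, v = row3 a b z.
Proof.
exists (v 0 (lshift _ 0)), (v 0 (rshift _ (lshift _ 0))).
exists (fun j => v 0 (rshift _ (rshift _ j))).
apply/rowP => j; case: (split_ordP j) => {}j ->.
  by rewrite row_mxEl !ord1 !mxE eqxx.
rewrite row_mxEr; case: (split_ordP j) => {}j ->.
  by rewrite row_mxEl !ord1 !mxE eqxx.
by rewrite row_mxEr !mxE.
Qed.

Lemma eq_row3 a b z a' b' z' : a = a' -> b = b' -> z =1 z' ->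
  row3 a b z = row3 a' b' z'.
Proof.
move=> -> -> zz; congr row_mx; congr row_mx.
by apply/rowP => j; rewrite !mxE.
Qed.

Lemma row3_inj a b z a' b' z' :
  row3 a b z = row3 a' b' z' -> [/\ a = a', b = b' & z =1 z'].
Proof.
move=> /eq_row_mx[/matrixP/(_ 0 0) ea /eq_row_mx[/matrixP/(_ 0 0) eb /rowP ez]].
split; first by move: ea; rewrite !mxE.
  by move: eb; rewrite !mxE.
by move=> j; have := ez j; rewrite !mxE.
Qed.

Lemma row3D a b z a' b' z' :
  row3 a b z + row3 a' b' z' = row3 (a + a') (b + b') (fun j => z j + z' j).
Proof.
rewrite !add_row_mx -!raddfD; congr row_mx; congr row_mx.
by apply/rowP => j; rewrite !mxE.
Qed.

Lemma row3N a b z : - row3 a b z = row3 (- a) (- b) (fun j => - z j).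
Proof.
rewrite !opp_row_mx -!raddfN; congr row_mx; congr row_mx.
by apply/rowP => j; rewrite !mxE.
Qed.

Lemma row3_0 : row3 0 0 (fun=> 0) = 0.
Proof.
by rewrite /row3 !raddf0 -row_mx0 -row_mx0; congr row_mx; congr row_mx;
   apply/rowP => j; rewrite !mxE.
Qed.

Lemma row3_sum (I : finType) (g : I -> 'I_n -> P) :
  \sum_i row3 0 0 (g i) = row3 0 0 (fun j => \sum_i g i j).
Proof.
rewrite /row3 (raddf0 (@scalar_mx P 1)).
transitivity (\sum_i row_mx (0 : 'M[P]_1) (row_mx (0 : 'M[P]_1) (\row_j g i j))).
  by [].
elim: (index_enum I) => [|i r IH].
  rewrite !big_nil -row_mx0 -row_mx0; congr row_mx; congr row_mx.
  by apply/rowP => j; rewrite !mxE big_nil.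
rewrite big_cons IH !add_row_mx !addr0; congr row_mx; congr row_mx.
by apply/rowP => j; rewrite !mxE big_cons.
Qed.

Lemma row3_sc a b z c : row3 a b z *m mx_sc c =
  row3 (a * sc c) (b * rho c.1) (fun j => \sum_k z k * rho (l (f k * c.2 * e j))).
Proof.
rewrite row_diag3 -!scalar_mxM; congr row_mx; congr row_mx.
by apply/rowP => j; rewrite !mxE; apply: eq_bigr => k _; rewrite !mxE.
Qed.

Lemma row3_M a b z m : row3 a b z *m mx_M m =
  row3 0 0 (fun j => (a * sc (1, 0) + b * N 1) * rho (l (m * e j))).
Proof.
rewrite row_last3 /row3 !raddf0 !mul_scalar_mx; congr row_mx; congr row_mx.
by apply/rowP => j; rewrite !mxE mulrDl -!mulrA !scC.
Qed.

Lemma row3_N a b z m : row3 a b z *m mx_N m =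
  row3 0 (a * sc (0, m) + \sum_k z k * M (f k * m)) (fun=> 0).
Proof.
rewrite row_mid3 /row3 !raddf0 -scalar_mxM; congr row_mx; congr row_mx.
  apply/matrixP => i j; rewrite !ord1 !mxE !eqxx; congr (_ + _).
  by apply: eq_bigr => k _; rewrite !mxE.
by apply/rowP => j; rewrite !mxE.
Qed.

Definition kernel_row (v : 'rV[P]_(1 + (1 + n))) : Prop :=
  exists x y, v = row3 0 (x * M 1) (fun j => y * N (e j)).

Lemma kernel_rowD u v : kernel_row u -> kernel_row v -> kernel_row (u + v).
Proof.
move=> [x [y ->]] [x' [y' ->]]; exists (x + x'), (y + y').
by rewrite row3D; apply: eq_row3 => [||j]; rewrite ?addr0 ?mulrDl.
Qed.

Lemma kernel_rowN u : kernel_row u -> kernel_row (- u).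
Proof.
move=> [x [y ->]]; exists (- x), (- y).
by rewrite row3N; apply: eq_row3 => [||j]; rewrite ?oppr0 ?mulNr.
Qed.

Lemma kernel_row0 : kernel_row 0.
Proof. by exists 0, 0; rewrite -row3_0; apply: eq_row3 => [||j]; rewrite ?mul0r. Qed.

Section Representation.
Variable h : {rmorphism T -> 'M[P]_(1 + (1 + n))}.
Hypothesis hA : forall a, h (tens_scal _ a) = mx_sc a.
Hypothesis hM : forall m, h (inM phi m) = mx_M m.
Hypothesis hN : forall m, h (inN phi m) = mx_N m.

(** A scalar merely changes [x] and [y], while M and N produce the factors [M 1 * N 1] and
    [\sum_k N (e k) * M (f k)], which are 0 in [P]. *)
Lemma kernel_row_stable t v : kernel_row v -> kernel_row (v *m h t).
Proof.
elim/TRS_ind: t v => [a|m|m|s t es et|t et|s t es et] v.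
- move=> [x [y ->]]; rewrite hA row3_sc.
  exists (x * rho a.1), (y * sc (0, a.2)).
  apply: eq_row3 => [||j]; first by rewrite mul0r.
    by rewrite -!mulrA scC.
  rewrite -mulrA scN -N_sum mulr_sumr; apply: eq_bigr => k _ /=.
  by rewrite !mulrA.
- move=> [x [y ->]]; rewrite hM row3_M -mulrA M1N1 mulr0 mul0r addr0.
  by exists 0, 0; apply: eq_row3 => [||j]; rewrite ?mul0r.
- move=> [x [y ->]]; rewrite hN row3_N.
  have -> : \sum_k y * N (e k) * M (f k * m) = 0.
    transitivity (y * (\sum_k N (e k) * M (f k)) * sc (0, m)); last first.
      by rewrite sumNM mulr0 mul0r.
    rewrite mulr_sumr mulr_suml; apply: eq_bigr => k _.
    by rewrite -!mulrA Msc.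
  by exists 0, 0; apply: eq_row3 => [||j]; rewrite ?addr0 ?mul0r.
- by move=> kv; rewrite rmorphD mulmxDr; apply: kernel_rowD; [apply: es|apply: et].
- by move=> /et; rewrite rmorphN mulmxN; apply: kernel_rowN.
- by rewrite rmorphM mulmxA => /es/et.
Qed.

(** Each defining relation sends an arbitrary row to a kernel row, and by stability the factors to
    its right keep it there. *)
Lemma kernel_row_ideal t v :
  gen_ideal (@preproj_rel R S phi n e f) t -> kernel_row (v *m h t).
Proof.
move=> It; elim: It v => {t} [|t [->|->]|x y _ ex _ ey|a x _ ex|a x _ ex] v.
- by rewrite rmorph0 mulmx0; apply: kernel_row0.
- have [a [b [z ->]]] := row3_surj v.
  rewrite rmorphM hM hN mulmxA row3_M row3_N mul0r add0r.
  exists (a + b * N 1), 0; apply: eq_row3 => [||j]; rewrite ?mul0r //.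
  transitivity ((a * sc (1, 0) + b * N 1) * M 1); last first.
    by rewrite !mulrDl -[a * _ * _]mulrA scM rmorph1 mul1r.
  have -> : M 1 = \sum_k rho (l (1 * e k)) * M (f k * 1) by rewrite M_sum mulr1.
  by rewrite mulr_sumr; apply: eq_bigr => k _; rewrite !mulrA.
- have [a [b [z ->]]] := row3_surj v.
  pose w := a * sc (0, 1) + \sum_k z k * M (f k).
  exists 0, w; rewrite rmorph_sum mulmx_sumr.
  transitivity (\sum_i row3 0 0 (fun j => w * N (e i) * rho (l (f i * e j)))).
    apply: eq_bigr => i _; rewrite rmorphM hM hN mulmxA row3_N row3_M.
    apply: eq_row3 => [||j] //; congr (_ * _); rewrite mul0r add0r /w !mulrDl.
    rewrite -!mulrA !scN mulr1 mul1r !mulr_suml; congr (_ + _).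
    apply: eq_bigr => k _; rewrite -!mulrA; congr (_ * _).
    have -> : M (f k * e i) = M (f k) * sc (0, e i) by rewrite Msc.
    by rewrite -mulrA scN mulr1.
  rewrite row3_sum; apply: eq_row3 => [||j]; rewrite ?mul0r //.
  rewrite -N_sum mulr_sumr; apply: eq_bigr => k _.
  by rewrite mulrA.
- rewrite rmorphB mulmxBr; apply: kernel_rowD; first exact: ex.
  by apply: kernel_rowN; apply: ey.
- by rewrite rmorphM mulmxA; apply: ex.
- by rewrite rmorphM mulmxA; apply/kernel_row_stable/ex.
Qed.

(** Evaluating rows to the expressions they stand for turns the representation into right
    multiplication in [P]. *)
Lemma row_theta a b z t (pr : {rmorphism T -> P}) :
  (forall a, pr (tens_scal _ a) = sc a) -> (forall m, pr (inM phi m) = M m) ->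
  (forall m, pr (inN phi m) = N m) ->
  exists a' b' z', row3 a b z *m h t = row3 a' b' z' /\
    a' + b' * N 1 + \sum_k z' k * M (f k) =
    (a + b * N 1 + \sum_k z k * M (f k)) * pr t.
Proof.
move=> prA prM prN.
have MM m m' : M m * M m' = 0.
  have -> : M m = M m * sc (0, 1) by rewrite Msc mulr1.
  by rewrite -mulrA scM /= rmorph0 mul0r raddf0 mulr0.
have NN m m' : N m * N m' = 0.
  have -> : N m = N m * sc (1, 0) by rewrite Nsc rmorph1 mulr1.
  by rewrite -mulrA scN /= mul0r raddf0 mulr0.
elim/TRS_ind: t a b z => [c|m|m|s t es et|t et|s t es et] a b z.
- rewrite hA prA row3_sc.
  exists (a * sc c), (b * rho c.1), (fun j => \sum_k z k * rho (l (f k * c.2 * e j))).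
  split=> //; rewrite !mulrDl; congr (_ + _ + _).
    by rewrite -!mulrA scN Nsc /= mulr1 mul1r.
  under eq_bigr do rewrite mulr_suml.
  rewrite exchange_big mulr_suml; apply: eq_bigr => k _ /=.
  rewrite -mulrA Msc -[f k * c.2]mulr1 -M_sum mulr_sumr.
  by apply: eq_bigr => j _; rewrite !mulr1 mulrA.
- rewrite hM prM row3_M.
  exists 0, 0, (fun j => (a * sc (1, 0) + b * N 1) * rho (l (m * e j))).
  split=> //; rewrite mul0r !add0r !mulrDl.
  have -> : (\sum_k z k * M (f k)) * M m = 0.
    by rewrite mulr_suml big1 // => k _; rewrite -mulrA MM mulr0.
  rewrite addr0; transitivity ((a * sc (1, 0) + b * N 1) * M m); last first.
    by rewrite mulrDl -mulrA scM rmorph1 mul1r.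
  rewrite -[m in RHS]mulr1 -M_sum mulr_sumr; apply: eq_bigr => k _.
  by rewrite mulr1 mulrA.
- rewrite hN prN row3_N.
  exists 0, (a * sc (0, m) + \sum_k z k * M (f k * m)), (fun=> 0).
  split=> //; rewrite add0r [X in _ + X]big1 ?addr0; last by move=> k; rewrite mul0r.
  rewrite !mulrDl -[b * _ * _]mulrA NN mulr0 addr0 -mulrA scN mulr1.
  congr (_ + _); rewrite !mulr_suml; apply: eq_bigr => k _.
  have -> : M (f k * m) = M (f k) * sc (0, m) by rewrite Msc.
  by rewrite -!mulrA scN mulr1.
- have [a1 [b1 [z1 [e1 h1]]]] := es a b z; have [a2 [b2 [z2 [e2 h2]]]] := et a b z.
  exists (a1 + a2), (b1 + b2), (fun j => z1 j + z2 j).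
  rewrite !rmorphD mulmxDr e1 e2 row3D; split=> //; rewrite mulrDr -h1 -h2.
  under eq_bigr do rewrite mulrDl.
  rewrite big_split mulrDl /= [RHS]addrACA; congr (_ + _).
  by rewrite [RHS]addrACA.
- have [a1 [b1 [z1 [e1 h1]]]] := et a b z.
  exists (- a1), (- b1), (fun j => - z1 j).
  rewrite !rmorphN mulmxN e1 row3N; split=> //; rewrite mulrN -h1 !opprD mulNr.
  by rewrite -sumrN; congr (_ + _); apply: eq_bigr => k _; rewrite mulNr.
- have [a1 [b1 [z1 [e1 h1]]]] := es a b z.
  have [a2 [b2 [z2 [e2 h2]]]] := et a1 b1 z1.
  exists a2, b2, z2; rewrite !rmorphM mulmxA e1 e2; split=> //.
  by rewrite h2 h1 mulrA.
Qed.

End Representation.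

Section Kernels.
Variable pr : {rmorphism T -> P}.
Hypothesis prA : forall a, pr (tens_scal _ a) = sc a.
Hypothesis prM : forall m, pr (inM phi m) = M m.
Hypothesis prN : forall m, pr (inN phi m) = N m.
Hypothesis pr_surj : forall x, exists t, x = pr t.
Hypothesis pr_ker : forall t, pr t = 0 -> gen_ideal (@preproj_rel R S phi n e f) t.

(** A lift of [x] moves the row of 1 to a row standing for [x]. Moved further by N 1 it becomes a
    kernel row, whose middle entry is on the one hand [x] and on the other hand a multiple of
    [M 1]. *)
Lemma ker_N1 x : x * sc (0, 1) = x -> x * N 1 = 0 -> exists v, x = v * M 1.
Proof.
move=> xS x0; have [t xt] := pr_surj x.
have [h [hA hM hN]] := tens_rep.
have [a [b [z [e1 h1]]]] := row_theta hA hM hN 1 0 (fun=> 0) t prA prM prN.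
have {}h1 : a + b * N 1 + \sum_k z k * M (f k) = x.
  rewrite h1 -xt [X in (_ + X) * _]big1 ?mul0r ?addr0 ?mul1r // => k _.
  by rewrite mul0r.
have It : gen_ideal (@preproj_rel R S phi n e f) (t * inN phi 1).
  by apply: pr_ker; rewrite rmorphM prN -xt.
have := kernel_row_ideal hA hM hN (row3 1 0 (fun=> 0)) It.
rewrite rmorphM hN mulmxA e1 row3_N => -[v [y /row3_inj[_ ev _]]].
exists v; rewrite -ev -[LHS]xS -h1 !mulrDl -[b * _ * _]mulrA Nsc /= rmorph0.
rewrite mulr0 raddf0 mulr0 addr0; congr (_ + _); rewrite mulr_suml.
by apply: eq_bigr => k _; rewrite -mulrA Msc /= !mulr1.
Qed.

(** The same argument, read off in the last coordinates: these are the [z j] because [e] and [f] are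
    dual, and a kernel row has [y * N (e j)] there. *)
Lemma ker_M z : (forall i, z i * sc (1, 0) = z i) -> \sum_i z i * M (f i) = 0 ->
  exists v, forall i, z i = v * N (e i).
Proof.
move=> zR z0; have /choice[t zt] := fun i => pr_surj (z i).
have [h [hA hM hN]] := tens_rep.
pose v0 := row3 1 0 (fun=> 0).
have It : gen_ideal (@preproj_rel R S phi n e f) (\sum_i t i * inM phi (f i)).
  apply: pr_ker; rewrite rmorph_sum -[RHS]z0; apply: eq_bigr => i _.
  by rewrite rmorphM prM zt.
have := kernel_row_ideal hA hM hN v0 It.
have -> : v0 *m h (\sum_i t i * inM phi (f i)) = row3 0 0 z.
  rewrite rmorph_sum mulmx_sumr.
  transitivity (\sum_i row3 0 0 (fun j => z i * rho (l (f i * e j)))).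
    apply: eq_bigr => i _; rewrite rmorphM hM mulmxA.
    have [a [b [y [e1 h1]]]] := row_theta hA hM hN 1 0 (fun=> 0) (t i) prA prM prN.
    rewrite e1 row3_M; apply: eq_row3 => // j; congr (_ * _).
    move: h1; rewrite -zt [X in (_ + X) * _]big1 => [|k _]; last by rewrite mul0r.
    rewrite mul0r !addr0 mul1r => h1; rewrite -[z i]zR -h1 !mulrDl.
    rewrite -[b * _ * _]mulrA Nsc rmorph1 mulr1 mulr_suml big1 ?addr0 // => k _.
    by rewrite -mulrA Msc /= mulr0 raddf0 mulr0.
  rewrite row3_sum; apply: eq_row3 => // j.
  rewrite (bigD1 j) //= mulrC ef eqxx rho1 mulr1 big1 ?addr0 // => i ij.
  by rewrite mulrC ef eq_sym (negPf ij) rho0 mulr0.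
by move=> [v [y /row3_inj[_ _ ev]]]; exists y.
Qed.

End Kernels.
End PreprojectiveRelations.

(** * Ranks of the corners *)

Section ScalarModule.
Variables (R : comPzRingType) (P : pzRingType).

(* P as an R-module through rho. *)
Definition smod (_ : {rmorphism R -> P}) : Type := P.
HB.instance Definition _ rho := GRing.Zmodule.on (smod rho).

Variable rho : {rmorphism R -> P}.
Local Notation V := (smod rho).

Definition smod_scale (r : R) (x : V) : V := rho r * (x : P).

Fact smod_scaleA r r' x : smod_scale r (smod_scale r' x) = smod_scale (r * r') x.
Proof. by rewrite /smod_scale rmorphM mulrA. Qed.

Fact smod_scale1 : left_id 1 smod_scale.
Proof. by move=> x; rewrite /smod_scale rmorph1 mul1r. Qed.

Fact smod_scaleDr : right_distributive smod_scale +%R.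
Proof. by move=> r x y; apply: mulrDr. Qed.

Fact smod_scaleDl x : {morph smod_scale^~ x : r s / r + s}.
Proof. by move=> r s; rewrite /smod_scale rmorphD; apply: mulrDl. Qed.

HB.instance Definition _ := GRing.Zmodule_isLmodule.Build R V
  smod_scaleA smod_scale1 smod_scaleDr smod_scaleDl.

Lemma smodE r (x : P) : r *: (x : V) = rho r * x. Proof. by []. Qed.

Lemma smod_comb m n (B : 'M[R]_(m, n)) (z : 'I_n -> P) i :
  mxcomb B (z : 'I_n -> V) i = \sum_j rho (B i j) * z j :> P.
Proof. by []. Qed.

Hypothesis rhoC : forall r x, x * rho r = rho r * x.

Definition mulr_by (b : P) (x : V) : V := (x : P) * b.
Definition mull_by (b : P) (x : V) : V := b * (x : P).

Fact mulr_by_linear b : linear (mulr_by b).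
Proof. by move=> a x y; rewrite /mulr_by [LHS]mulrDl !smodE mulrA. Qed.
HB.instance Definition _ b :=
  GRing.isLinear.Build R V V _ (mulr_by b) (mulr_by_linear b).

Fact mull_by_linear b : linear (mull_by b).
Proof. by move=> a x y; rewrite /mull_by [LHS]mulrDr !smodE !mulrA rhoC. Qed.
Definition mull_by_lin b : {linear V -> V} :=
  HB.pack (mull_by b) (GRing.isLinear.Build R V V _ (mull_by b) (mull_by_linear b)).

Definition row_by n (b : 'I_n -> P) (x : V) : {ffun 'I_n -> V} :=
  [ffun i => mulr_by (b i) x].

Fact row_by_linear n (b : 'I_n -> P) : linear (row_by b).
Proof. by move=> a x y; apply/ffunP => i; rewrite !ffunE linearP. Qed.
HB.instance Definition _ n b :=
  GRing.isLinear.Build R V {ffun 'I_n -> V} _ (row_by b) (@row_by_linear n b).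

Definition col_by n (b : 'I_n -> P) (z : {ffun 'I_n -> V}) : V :=
  \sum_i mulr_by (b i) (z i).

Fact col_by_linear n (b : 'I_n -> P) : linear (col_by b).
Proof.
move=> a x y; rewrite /col_by scaler_sumr -big_split; apply: eq_bigr => i _ /=.
by rewrite !ffunE linearP.
Qed.
HB.instance Definition _ n b :=
  GRing.isLinear.Build R {ffun 'I_n -> V} V _ (col_by b) (@col_by_linear n b).

End ScalarModule.

(* The booleans false and true stand for R and S, and m for the degree plus one,
   so that m = 0 is the zero module preceding the degree 0 part. *)
Definition corner_rank (a b : bool) (m : nat) : nat :=
  if odd m == a (+) b then 0 else ((a.+1 * b.+1) * m)%N.

Section CornerRanks.
Variables (R : comPzRingType) (p : prime_ideal R) (P : pzRingType).
Variables (rho : {rmorphism R -> P}).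
Hypothesis rhoC : forall r x, x * rho r = rho r * x.
Local Notation V := (smod rho).
Variables (C : bool -> bool -> nat -> P -> Prop).
Variables (M1 N1 : P) (Ne Mf : 'I_4 -> P).
Local Notation free a b m := (@locally_free R p V (C a b m) (corner_rank a b m)).
Local Notation gen a b m := (@locally_gen R p V (C a b m) (corner_rank a b m)).

Hypothesis C_submod : forall a b m, @submod R V (C a b m).
Hypothesis C_0 : forall a b x, C a b 0 x -> x = 0.
Hypothesis C_M1 : forall a m x, C a false m x -> C a true m.+1 (x * M1).
Hypothesis C_N1 : forall a m x, C a true m x -> C a false m.+1 (x * N1).
Hypothesis C_Mf : forall a m x i, C a false m x -> C a true m.+1 (x * Mf i).
Hypothesis C_Ne : forall a m x i, C a true m x -> C a false m.+1 (x * Ne i).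
Hypothesis N1_surj : forall a m x, C a false m.+2 x ->
  exists2 y, C a true m.+1 y & y * N1 = x.
Hypothesis Mf_surj : forall a m x, C a true m.+2 x ->
  exists2 z, forall i, C a false m.+1 (z i) & \sum_i z i * Mf i = x.
Hypothesis N1_ker : forall a m y, C a true m.+1 y -> y * N1 = 0 ->
  exists2 v, C a false m v & y = v * M1.
Hypothesis Mf_ker : forall a m (z : 'I_4 -> P),
  (forall i, C a false m.+1 (z i)) -> \sum_i z i * Mf i = 0 ->
  exists2 v, C a true m v & forall i, z i = v * Ne i.
Hypothesis C_left : forall b m,
  [/\ forall x, C true b m x -> C false b m.+1 (M1 * x),
      forall x, C false b m x -> C true b m.+1 (N1 * x),
      forall x, C false b m.+2 x -> exists2 y, C true b m.+1 y & M1 * y = x &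
      forall y, C true b m.+1 y -> M1 * y = 0 ->
        exists2 v, C false b m v & y = N1 * v].
Hypothesis free1 : forall a b, free a b 1.
Hypothesis genRR : forall m, gen false false m.

Lemma free0 a b : free a b 0.
Proof.
have -> : corner_rank a b 0 = 0 by rewrite /corner_rank muln0; case: ifP.
apply: locally_free0; first by case: (C_submod a b 0).
by move=> v; apply: C_0.
Qed.

Lemma genS_right a m : gen a false m -> gen a false m.+2 -> gen a true m.+1.
Proof.
move=> g0 g2.
have -> : corner_rank a true m.+1 =
    (corner_rank a false m + corner_rank a false m.+2)%N.
  by rewrite /corner_rank /= negbK; case: a {g0 g2}; case: (odd m) => //=; lia.
apply: (@exact_locally_gen _ p V V V (@mulr_by _ _ rho M1) (@mulr_by _ _ rho N1))
  g0 g2 => //.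
- exact: C_M1.
- exact: N1_surj.
- exact: C_N1.
- exact: N1_ker.
Qed.

Lemma genS_left b m : gen false b m -> gen false b m.+2 -> gen true b m.+1.
Proof.
move=> g0 g2; have [h1 h2 h3 h4] := C_left b m; have [h1' _ _ _] := C_left b m.+1.
have -> : corner_rank true b m.+1 =
    (corner_rank false b m + corner_rank false b m.+2)%N.
  by rewrite /corner_rank /= negbK; case: b {g0 g2 h1 h2 h3 h4 h1'};
    case: (odd m) => //=; lia.
by apply: (@exact_locally_gen _ p V V V (mull_by_lin rhoC N1)
  (mull_by_lin rhoC M1)) g0 g2.
Qed.

Lemma gen_all a b m : gen a b m.
Proof.
have g0 a' b' : gen a' b' 0 := locally_free_gen (free0 a' b').
have gR b' k : gen false b' k.
  by case: b' k => [[|k]|] //; apply: genS_right.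
by case: a m => // -[|m] //; apply: genS_left.
Qed.

(** Each step takes the freeness of the middle term from the preceding degree and the generators of
    the outer terms from [gen_all]. Their numbers add up because [corner_rank] is linear in [m] for
    fixed parity. *)
Lemma free_all a b m : free a b m.
Proof.
suff [] : free a b m /\ free a b m.+1 by [].
elim: m b => [|m IH] b; first by split; [apply: free0|apply: free1].
split; first by case: (IH b).
case: b.
  have [_ fY] := IH false.
  have gU := gen_all a true m; have gZ := gen_all a true m.+2.
  have rk : (4 * corner_rank a false m.+1 =
             corner_rank a true m + corner_rank a true m.+2)%N.
    by rewrite /corner_rank /= negbK; case: (a); case: (odd m) => //=; lia.
  have C00 : C a false m.+1 0 by case: (C_submod a false m.+1).
  have {}fY := locally_free_ffun 4 C00 fY; rewrite rk in fY.
  apply: (@exact_locally_free _ p V {ffun 'I_4 -> V} V (@row_by _ _ rho _ Ne)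
    (@col_by _ _ rho _ Mf)) fY gU gZ.
  - split=> [i|r x y Wx Wy i]; first by rewrite ffunE.
    by rewrite !ffunE; apply: (C_submod a false m.+1).2.
  - by move=> u Cu i; rewrite ffunE; apply: C_Ne.
  - move=> x /Mf_surj[z Cz zx]; exists [ffun i => z i] => [i|]; first by rewrite ffunE.
    by rewrite -zx; apply: eq_bigr => i _; rewrite ffunE.
  - move=> F CF; apply: submod_sum => // i; exact: C_Mf.
  - move=> F CF /(Mf_ker CF)[v Cv ev]; exists v => //.
    by apply/ffunP => i; rewrite ffunE; apply: ev.
have [_ fY] := IH true.
have rk : (corner_rank a true m.+1 =
           corner_rank a false m + corner_rank a false m.+2)%N.
  by rewrite /corner_rank /= negbK; case: (a); case: (odd m) => //=; lia.
rewrite rk in fY; have gU := gen_all a false m; have gZ := gen_all a false m.+2.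
apply: (@exact_locally_free _ p V V V (@mulr_by _ _ rho M1) (@mulr_by _ _ rho N1))
  fY gU gZ => //.
- exact: C_M1.
- exact: N1_surj.
- exact: C_N1.
- exact: N1_ker.
Qed.

End CornerRanks.

(** * Exact sequences between the corners *)

Section GradedCorners.
Variables (R S : comPzRingType) (phi : {rmorphism R -> S}).
Variables (n : nat) (e f : 'I_n -> S) (l : {additive S -> R}).
Hypothesis eE : forall y, y = \sum_i phi (l (y * f i)) * e i.
Hypothesis fE : forall y, y = \sum_i phi (l (y * e i)) * f i.

Local Notation A := (R * S)%type.

Variables (P : pzRingType) (sc : {rmorphism A -> P}) (M N : {additive S -> P}).
Hypothesis scM : forall a m, sc a * M m = M (phi a.1 * m).
Hypothesis Msc : forall a m, M m * sc a = M (m * a.2).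
Hypothesis scN : forall a m, sc a * N m = N (a.2 * m).
Hypothesis Nsc : forall a m, N m * sc a = N (m * phi a.1).
Hypothesis M1N1 : M 1 * N 1 = 0.
Hypothesis sumNM : \sum_i N (e i) * M (f i) = 0.
Hypothesis scC : forall r x, x * sc (r, phi r) = sc (r, phi r) * x.

Hypothesis P_ind : forall Q : P -> Prop,
  (forall a, Q (sc a)) -> (forall m, Q (M m)) -> (forall m, Q (N m)) ->
  (forall x y, Q x -> Q y -> Q (x + y)) -> (forall x, Q x -> Q (- x)) ->
  (forall x y, Q x -> Q y -> Q (x * y)) -> forall x, Q x.

Hypothesis P_lift : forall (Q : pzRingType) (al : {rmorphism A -> Q})
    (bM bN : S -> Q),
  {morph bM : x y / x + y} -> {morph bN : x y / x + y} ->
  (forall a m, bM (phi a.1 * m) = al a * bM m) ->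
  (forall a m, bM (m * a.2) = bM m * al a) ->
  (forall a m, bN (a.2 * m) = al a * bN m) ->
  (forall a m, bN (m * phi a.1) = bN m * al a) ->
  bM 1 * bN 1 = 0 -> \sum_i bN (e i) * bM (f i) = 0 ->
  exists h : {rmorphism P -> Q}, [/\ forall a, h (sc a) = al a,
    forall m, h (M m) = bM m & forall m, h (N m) = bN m].

Hypothesis ker_N1 : forall x,
  x * sc (0, 1) = x -> x * N 1 = 0 -> exists v, x = v * M 1.
Hypothesis ker_M : forall z : 'I_n -> P,
  (forall i, z i * sc (1, 0) = z i) -> \sum_i z i * M (f i) = 0 ->
  exists v, forall i, z i = v * N (e i).

Variable D : nat -> P -> Prop.
Hypothesis DB : forall d x y, D d x -> D d y -> D d (x - y).
Hypothesis D0 : forall x, D 0 x <-> exists a, x = sc a.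
Hypothesis DM : forall d x m, D d x -> D d.+1 (x * M m).
Hypothesis DN : forall d x m, D d x -> D d.+1 (x * N m).
Hypothesis scD : forall d a x, D d x -> D d (sc a * x).
Hypothesis D_ind : forall d (Q : P -> Prop), Q 0 ->
  (forall x y, Q x -> Q y -> Q (x - y)) ->
  (forall y m, D d y -> Q (y * M m)) -> (forall y m, D d y -> Q (y * N m)) ->
  forall x, D d.+1 x -> Q x.

Lemma D_0 d : D d 0.
Proof.
elim: d => [|d IH]; first by apply/D0; exists 0; rewrite rmorph0.
by rewrite -(mul0r (M 0)); apply: DM.
Qed.

Lemma D_N d x : D d x -> D d (- x).
Proof. by move=> Dx; rewrite -sub0r; apply: DB => //; apply: D_0. Qed.

Lemma D_D d x y : D d x -> D d y -> D d (x + y).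
Proof. by move=> Dx Dy; rewrite -[y]opprK; apply: DB => //; apply: D_N. Qed.

Lemma D_sum d (I : finType) (F : I -> P) :
  (forall i, D d (F i)) -> D d (\sum_i F i).
Proof.
move=> DF; elim/big_rec: _ => [|i x _ Dx]; first exact: D_0.
exact: D_D.
Qed.

Lemma D_mul d d' x y : D d x -> D d' y -> D (d + d') (x * y).
Proof.
move=> Dx; elim: d' y => [|d' IH] y.
  rewrite addn0 => /D0[a ->]; elim: d x Dx => [|d _] x.
    by move=> /D0[b ->]; apply/D0; exists (b * a); rewrite rmorphM.
  move: x; apply: D_ind => [|x x' Dx Dx'|z m Dz|z m Dz].
  - by rewrite mul0r; apply: D_0.
  - by rewrite mulrBl; apply: DB.
  - by rewrite -mulrA Msc; apply: DM.
  - by rewrite -mulrA Nsc; apply: DN.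
rewrite addnS; move: y; apply: D_ind => [|y y' Dy Dy'|z m Dz|z m Dz].
- by rewrite mulr0; apply: D_0.
- by rewrite mulrBr; apply: DB.
- by rewrite mulrA; apply/DM/IH.
- by rewrite mulrA; apply/DN/IH.
Qed.

Lemma D_1 : D 0 1. Proof. by apply/D0; exists 1; rewrite rmorph1. Qed.

Lemma D_M m : D 1 (M m). Proof. by rewrite -[M m]mul1r; apply/DM/D_1. Qed.

Lemma D_N1 m : D 1 (N m). Proof. by rewrite -[N m]mul1r; apply/DN/D_1. Qed.

(* The morphism putting an element of degree d on the d-th superdiagonal exhibits
   the grading of P. *)
Definition shift_mx k (x : P) : 'M[P]_k := \matrix_(i, j) (x *+ (j == i.+1 :> nat)).

Lemma shift_mxD k x y : shift_mx k (x + y) = shift_mx k x + shift_mx k y.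
Proof. by apply/matrixP => i j; rewrite !mxE mulrnDl. Qed.

Lemma mul_shift_mx k (B : 'M[P]_k) x i (j j' : 'I_k) : j = j'.+1 :> nat ->
  (B *m shift_mx k x) i j = B i j' * x.
Proof.
move=> jj'; rewrite mxE (bigD1 j') //= mxE jj' eqxx mulr1n big1 ?addr0 // => a aj'.
rewrite mxE jj' eqSS; case: eqP => [ja|_]; last by rewrite mulr0n mulr0.
by case/eqP: aj'; apply/val_inj.
Qed.

Lemma mul_shift_mx0 k (B : 'M[P]_k) x i (j : 'I_k) : j = 0 :> nat ->
  (B *m shift_mx k x) i j = 0.
Proof. by move=> j0; rewrite mxE big1 // => a _; rewrite mxE j0 mulr0n mulr0. Qed.

Lemma shift_mxM k x y x' y' :
  x * y = x' * y' -> shift_mx k x *m shift_mx k y = shift_mx k x' *m shift_mx k y'.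
Proof.
move=> xy; apply/matrixP => i j; case j0: (j : nat) => [|j'].
  by rewrite !mul_shift_mx0.
have j'k : (j' < k)%N by rewrite ltnW // -j0 ltn_ord.
rewrite !(@mul_shift_mx _ _ _ _ j (Ordinal j'k)) // !mxE.
by case: eqP => _; rewrite ?mulr1n // !mulr0n !mul0r.
Qed.

Lemma grading k : exists g : {rmorphism P -> 'M[P]_k},
  [/\ forall a, g (sc a) = (sc a)%:M, forall m, g (M m) = shift_mx k (M m) &
      forall m, g (N m) = shift_mx k (N m)].
Proof.
have scal_mul x y : (x%:M : 'M[P]_k) *m shift_mx k y = shift_mx k (x * y).
  by apply/matrixP => i j; rewrite mul_scalar_mx !mxE mulrnAr.
have mul_scal x y : shift_mx k x *m y%:M = shift_mx k (x * y).
  apply/matrixP => i j; rewrite mxE (bigD1 j) //= !mxE eqxx mulr1n big1 => [|a aj].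
    by rewrite addr0 mulrnAl.
  by rewrite !mxE (negPf aj) mulr0n mulr0.
pose al : {rmorphism A -> 'M[P]_k} := (@scalar_mx P k) \o sc.
apply: (@P_lift 'M[P]_k al (fun m => shift_mx k (M m)) (fun m => shift_mx k (N m))).
- by move=> x y; rewrite raddfD shift_mxD.
- by move=> x y; rewrite raddfD shift_mxD.
- by move=> a m; rewrite -[RHS]/((sc a)%:M *m shift_mx k (M m)) scal_mul scM.
- by move=> a m; rewrite -[RHS]/(shift_mx k (M m) *m (sc a)%:M) mul_scal Msc.
- by move=> a m; rewrite -[RHS]/((sc a)%:M *m shift_mx k (N m)) scal_mul scN.
- by move=> a m; rewrite -[RHS]/(shift_mx k (N m) *m (sc a)%:M) mul_scal Nsc.
- rewrite -[LHS]/(shift_mx k (M 1) *m shift_mx k (N 1)).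
  rewrite (@shift_mxM _ _ _ 0 0) ?mulr0 //.
  by apply/matrixP => i j; rewrite !mxE big1 // => a _; rewrite !mxE !mul0rn mul0r.
- apply/matrixP => i j; rewrite summxE mxE.
  transitivity (\sum_c (shift_mx k (N (e c)) *m shift_mx k (M (f c))) i j) => //.
  case j0: (j : nat) => [|j']; first by rewrite big1 // => c _; rewrite mul_shift_mx0.
  have j'k : (j' < k)%N by rewrite ltnW // -j0 ltn_ord.
  under eq_bigr do rewrite (@mul_shift_mx _ _ _ _ j (Ordinal j'k)) // mxE mulrnAl.
  by rewrite sumrMnl sumNM mul0rn.
Qed.

Lemma grading_D k (g : {rmorphism P -> 'M[P]_k}) :
  (forall a, g (sc a) = (sc a)%:M) -> (forall m, g (M m) = shift_mx k (M m)) ->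
  (forall m, g (N m) = shift_mx k (N m)) ->
  forall d x, D d x -> forall i j : 'I_k, g x i j = x *+ (j == i + d :> nat)%N.
Proof.
move=> gA gM gN; have shiftE x y d (i j : 'I_k) :
    (forall i j : 'I_k, g x i j = x *+ (j == i + d :> nat)%N) ->
    (g x *m shift_mx k y) i j = (x * y) *+ (j == i + d.+1 :> nat)%N.
  move=> gx; case j0: (j : nat) => [|j']; first by rewrite mul_shift_mx0 // addnS.
  have j'k : (j' < k)%N by rewrite ltnW // -j0 ltn_ord.
  by rewrite (@mul_shift_mx _ _ _ _ j (Ordinal j'k)) // gx /= addnS eqSS mulrnAl.
elim=> [|d IH] x.
  by move=> /D0[a ->] i j; rewrite gA mxE addn0 eq_sym.
move: x; apply: D_ind => [|x y gx gy|y m Dy|y m Dy] i j.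
- by rewrite rmorph0 mxE mul0rn.
- by rewrite rmorphB !mxE gx gy mulrnBl.
- by rewrite rmorphM gM; apply/shiftE/IH.
- by rewrite rmorphM gN; apply/shiftE/IH.
Qed.

(** Every entry is homogeneous, of degree the distance to the diagonal. Below the diagonal the
    natural subtraction truncates, so vanishing is stated separately. *)
Lemma grading_in k (g : {rmorphism P -> 'M[P]_k}) :
  (forall a, g (sc a) = (sc a)%:M) -> (forall m, g (M m) = shift_mx k (M m)) ->
  (forall m, g (N m) = shift_mx k (N m)) ->
  forall x (i j : 'I_k), D (j - i) (g x i j) /\ ((j < i)%N -> g x i j = 0).
Proof.
move=> gA gM gN; have shiftP y (i j : 'I_k) : D 1 y ->
    D (j - i) (shift_mx k y i j) /\ ((j < i)%N -> shift_mx k y i j = 0).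
  move=> Dy; rewrite mxE; case: eqP => [->|_]; last by split=> //; apply: D_0.
  by rewrite subSnn; split=> // /ltnW; rewrite ltnn.
elim/P_ind => [a|m|m|x y gx gy|x gx|x y gx gy] i j.
- rewrite gA mxE; case: eqP => [->|_]; last by split=> //; apply: D_0.
  by rewrite subnn ltnn; split=> //; apply/D0; exists a.
- by rewrite gM; apply/shiftP/D_M.
- by rewrite gN; apply/shiftP/D_N1.
- rewrite rmorphD mxE; have [Dx x0] := gx i j; have [Dy y0] := gy i j.
  by split=> [|ji]; [apply: D_D|rewrite x0 // y0 // addr0].
- rewrite rmorphN mxE; have [Dx x0] := gx i j.
  by split=> [|ji]; [apply: D_N|rewrite x0 // oppr0].
- rewrite rmorphM mxE; split=> [|ji].
    apply: D_sum => a; have [Dx x0] := gx i a; have [Dy y0] := gy a j.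
    have [ai|ia] := ltnP a i; first by rewrite x0 // mul0r; apply: D_0.
    have [ja|aj] := ltnP j a; first by rewrite y0 // mulr0; apply: D_0.
    have -> : (j - i = (a - i) + (j - a))%N by rewrite addnC addnBA // subnK.
    exact: D_mul.
  apply: big1 => a _; have [_ x0] := gx i a; have [_ y0] := gy a j.
  have [ai|ia] := ltnP a i; first by rewrite x0 // mul0r.
  by rewrite y0 ?mulr0 // (leq_trans ji).
Qed.

(** A common factor [v] may be replaced by its component of degree [d], which the grading morphism
    displays as the entry [(0, d)] of [g v]. *)
Lemma homogeneous_factor (I : Type) d (x : I -> P) v (y : I -> P) :
  (forall i, D d.+1 (x i)) ->
  (forall i, exists m, y i = M m \/ y i = N m) -> (forall i, x i = v * y i) ->
  exists2 w, D d w & forall i, x i = w * y i.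
Proof.
move=> Dx yE xE; have [g [gA gM gN]] := grading d.+2.
have gy i : g (y i) = shift_mx d.+2 (y i).
  by have [m [->|->]] := yE i; rewrite ?gM ?gN.
exists (g v ord0 (inord d)).
  have [h _] := grading_in gA gM gN v ord0 (inord d).
  by rewrite inordK ?subn0 // in h.
move=> i; have := grading_D gA gM gN (Dx i) ord0 ord_max.
rewrite add0n eqxx mulr1n => <-; rewrite [in LHS]xE rmorphM gy.
by rewrite (@mul_shift_mx _ _ _ _ _ (inord d)) //= inordK.
Qed.

Lemma homogeneous_factor0 x v y : D 0 x -> (exists m, y = M m \/ y = N m) ->
  x = v * y -> x = 0.
Proof.
move=> Dx yE xE; have [g [gA gM gN]] := grading 1.
have gy : g y = shift_mx 1 y by have [m [->|->]] := yE; rewrite ?gM ?gN.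
have := grading_D gA gM gN Dx ord0 ord0; rewrite addn0 eqxx mulr1n => <-.
by rewrite xE rmorphM gy mul_shift_mx0.
Qed.

Definition eps (b : bool) : P := sc (if b then (0, 1) else (1, 0)).

Definition corner (a b : bool) (m : nat) (x : P) : Prop :=
  if m is d.+1 then [/\ D d x, eps a * x = x & x * eps b = x] else x = 0.

Lemma eps_idem b : eps b * eps b = eps b.
Proof.
by rewrite -rmorphM; congr (sc _); case: b; congr pair; rewrite /= ?mulr0 ?mulr1.
Qed.

Lemma eps_orth b : eps b * eps (~~ b) = 0.
Proof.
rewrite -rmorphM -(rmorph0 sc); congr (sc _).
by case: b; congr pair; rewrite /= ?mulr0 ?mul0r.
Qed.

Lemma eps_sum : eps false + eps true = 1.
Proof.
rewrite -rmorphD -(rmorph1 sc); congr (sc _).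
by congr pair; rewrite /= ?addr0 ?add0r.
Qed.

Lemma M_eps m : M m * eps true = M m. Proof. by rewrite Msc mulr1. Qed.
Lemma eps_M m : eps false * M m = M m. Proof. by rewrite scM rmorph1 mul1r. Qed.
Lemma N_eps m : N m * eps false = N m. Proof. by rewrite Nsc rmorph1 mulr1. Qed.
Lemma eps_N m : eps true * N m = N m. Proof. by rewrite scN mul1r. Qed.

Lemma D_sc d x a : D d x -> D d (x * sc a).
Proof. by move=> Dx; rewrite -(addn0 d); apply: D_mul => //; apply/D0; exists a. Qed.

Lemma corner0 a b m : corner a b m 0.
Proof. by case: m => // d; split; rewrite ?mulr0 ?mul0r //; apply: D_0. Qed.

Lemma cornerD a b m x y : corner a b m x -> corner a b m y -> corner a b m (x + y).
Proof.
case: m => [->->|d [Dx ax xb] [Dy ay yb]] /=; first by rewrite addr0.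
by split; [apply: D_D|rewrite mulrDr ax ay|rewrite mulrDl xb yb].
Qed.

Lemma corner_rho a b m r x : corner a b m x -> corner a b m (sc (r, phi r) * x).
Proof.
case: m => [->|d [Dx ax xb]] /=; first by rewrite mulr0.
split; first exact: scD.
  by rewrite mulrA scC -mulrA ax.
by rewrite -mulrA xb.
Qed.

Lemma corner_M a m x s : corner a false m x -> corner a true m.+1 (x * M s).
Proof.
case: m => [->|d [Dx ax xb]]; first by rewrite mul0r; apply: (corner0 a true 1).
by split; [apply: DM|rewrite mulrA ax|rewrite -mulrA M_eps].
Qed.

Lemma corner_N a m x s : corner a true m x -> corner a false m.+1 (x * N s).
Proof.
case: m => [->|d [Dx ax xb]]; first by rewrite mul0r; apply: (corner0 a false 1).
by split; [apply: DN|rewrite mulrA ax|rewrite -mulrA N_eps].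
Qed.

Lemma corner_proj a b d x : D d x -> corner a b d.+1 (eps a * x * eps b).
Proof.
move=> Dx; split; first by apply/D_sc/scD.
  by rewrite !mulrA eps_idem.
by rewrite -!mulrA eps_idem.
Qed.

Lemma corner_N_surj a m x : corner a false m.+2 x ->
  exists2 y, corner a true m.+1 y & y * N 1 = x.
Proof.
(* In this form the claim holds for all elements of the degree, so that it can be proved on words:
   those ending in M are killed by [eps false]. *)
move=> [Dx ax xb]; suff [y Dy e'] : exists2 y, D m y & y * N 1 = x * eps false.
  exists (eps a * y * eps true); first exact: corner_proj.
  by rewrite -!mulrA eps_N e' xb ax.
move: x Dx {ax xb}; apply: D_ind => [|x x' [y Dy ey] [y' Dy' ey']|y s Dy|y s Dy].
- by exists 0; rewrite ?mul0r //; apply: D_0.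
- by exists (y - y'); [apply: DB|rewrite !mulrBl ey ey'].
- exists 0; first exact: D_0.
  by rewrite -mulrA -(M_eps s) -mulrA (eps_orth true) mulr0 mulr0 mul0r.
- exists (y * sc (0, s)); first exact: D_sc.
  by rewrite -!mulrA N_eps scN mulr1.
Qed.

Lemma corner_M_surj a m x : corner a true m.+2 x ->
  exists2 z, forall i, corner a false m.+1 (z i) & \sum_i z i * M (f i) = x.
Proof.
move=> [Dx ax xb].
suff [z Dz e'] : exists2 z, forall i, D m (z i) & \sum_i z i * M (f i) = x * eps true.
  exists (fun i => eps a * z i * eps false) => [i|]; first exact: corner_proj.
  under eq_bigr do rewrite -!mulrA eps_M.
  by rewrite -mulr_sumr e' xb ax.
move: x Dx {ax xb}; apply: D_ind => [|x x' [y Dy ey] [y' Dy' ey']|y s Dy|y s Dy].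
- exists (fun=> 0) => [i|]; first exact: D_0.
  by rewrite mul0r big1 // => i _; rewrite mul0r.
- exists (fun i => y i - y' i) => [i|]; first exact: DB.
  rewrite mulrBl -ey -ey' -sumrB; apply: eq_bigr => i _; by rewrite mulrBl.
- exists (fun i => y * sc (l (s * e i), phi (l (s * e i)))) => [i|]; first exact: D_sc.
  rewrite -mulrA M_eps [in RHS](fE s) raddf_sum mulr_sumr; apply: eq_bigr => i _.
  by rewrite -mulrA scM.
- exists (fun=> 0) => [i|]; first exact: D_0.
  rewrite big1 => [|i _]; last by rewrite mul0r.
  by rewrite -mulrA -(N_eps s) -mulrA (eps_orth false) !mulr0.
Qed.

Lemma corner_N_ker a m y : corner a true m.+1 y -> y * N 1 = 0 ->
  exists2 v, corner a false m v & y = v * M 1.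
Proof.
move=> [Dy ay yb] y0; have [v yv] := ker_N1 yb y0.
case: m Dy => [|m] Dy.
  exists 0 => //; rewrite mul0r; apply: homogeneous_factor0 yv => //.
  by exists 1; left.
have [//|_|//|w Dw /(_ tt) yw] := @homogeneous_factor unit m (fun=> y) v (fun=> M 1).
  by exists 1; left.
exists (eps a * w * eps false); first exact: corner_proj.
by rewrite -!mulrA eps_M -yw ay.
Qed.

Lemma corner_M_ker a m (z : 'I_n -> P) :
  (forall i, corner a false m.+1 (z i)) -> \sum_i z i * M (f i) = 0 ->
  exists2 v, corner a true m v & forall i, z i = v * N (e i).
Proof.
move=> Cz z0; have [|v zv] := ker_M _ z0; first by move=> i; have [] := Cz i.
case: m Cz => [|m] Cz.
  exists 0 => // i; rewrite mul0r; apply: homogeneous_factor0 (zv i).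
    by have [] := Cz i.
  by exists (e i); right.
have [i|i|//|w Dw zw] := @homogeneous_factor 'I_n m z v (N \o e).
- by have [] := Cz i.
- by exists (e i); right.
exists (eps a * w * eps true) => [|i]; first exact: corner_proj.
by rewrite -!mulrA eps_N -zw; have [] := Cz i.
Qed.

Lemma corner_odd a b m x : corner a b m x -> odd m = (a (+) b) -> x = 0.
Proof.
elim: m b x => [//|[|m] IH] b x.
  move=> [/D0[c ->] ac cb] /= ab.
  have {}ab : b = ~~ a by move: ab; case: (a); case: (b).
  rewrite -ac -cb !mulrA ab; apply/eqP.
  have -> : eps a * sc c * eps (~~ a) = sc c * (eps a * eps (~~ a)).
    by rewrite -!rmorphM mulrCA mulrA.
  by rewrite eps_orth mulr0.
case: b => [/corner_M_surj[z Cz <-]|/corner_N_surj[y Cy <-]] om.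
  apply: big1 => i _; rewrite (IH _ _ (Cz i)) ?mul0r //.
  by move: om => /=; case: (odd m); case: (a).
rewrite (IH _ _ Cy) ?mul0r //.
by move: om => /=; case: (odd m); case: (a).
Qed.

Lemma corner_sc_false x : corner false false 1 x <-> exists r, x = sc (r, 0).
Proof.
split=> [[/D0[c ->] ac _]|[r ->]].
  exists c.1; rewrite -ac -rmorphM; congr (sc _).
  by congr pair; rewrite /= ?mul1r ?mul0r.
split; first by apply/D0; exists (r, 0).
  by rewrite -rmorphM; congr (sc _); congr pair; rewrite /= ?mul1r ?mul0r.
by rewrite -rmorphM; congr (sc _); congr pair; rewrite /= ?mulr1 ?mul0r.
Qed.

Lemma corner_sc_true x : corner true true 1 x <-> exists s, x = sc (0, s).
Proof.
split=> [[/D0[c ->] ac _]|[r ->]].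
  exists c.2; rewrite -ac -rmorphM; congr (sc _).
  by congr pair; rewrite /= ?mul1r ?mul0r.
split; first by apply/D0; exists (0, r).
  by rewrite -rmorphM; congr (sc _); congr pair; rewrite /= ?mul1r ?mul0r.
by rewrite -rmorphM; congr (sc _); congr pair; rewrite /= ?mulr1 ?mul0r.
Qed.

(** Sending M and N to 0 respects the relations and gives a retraction onto the degree 0 part. *)
Lemma sc_inj a : sc a = 0 -> a = 0.
Proof.
have [||||||||h [hA _ _]] := @P_lift A idfun (fun=> 0) (fun=> 0).
- by move=> x y; rewrite addr0.
- by move=> x y; rewrite addr0.
- by move=> c m; rewrite mulr0.
- by move=> c m; rewrite mul0r.
- by move=> c m; rewrite mulr0.
- by move=> c m; rewrite mul0r.
- by rewrite mul0r.
- by rewrite big1 // => i _; rewrite mul0r.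
by move=> /(congr1 h); rewrite hA rmorph0.
Qed.

(** The Casimir element is symmetric: the matrix that expresses [f] through [e] is the Gram matrix
    of [f], and it is symmetric. *)
Lemma Casimir_sym : \sum_i N (f i) * M (e i) = 0.
Proof.
rewrite -[RHS]sumNM.
transitivity (\sum_i \sum_j
    N (e j) * sc (l (f i * f j), phi (l (f i * f j))) * M (e i)).
  apply: eq_bigr => i _; rewrite -mulr_suml {1}(eE (f i)) raddf_sum; congr (_ * _).
  by apply: eq_bigr => j _; rewrite Nsc /= mulrC.
rewrite exchange_big; apply: eq_bigr => j _ /=.
have -> : M (f j) = \sum_i sc (l (f i * f j), phi (l (f i * f j))) * M (e i).
  rewrite {1}(eE (f j)) raddf_sum; apply: eq_bigr => i _ /=.
  by rewrite scM /= [f j * _]mulrC.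
by rewrite mulr_sumr; apply: eq_bigr => i _; rewrite mulrA.
Qed.

(** Exchanging M and N and reversing products preserves the relations, by [Casimir_sym] for the
    second one. The universal property is applied to the opposite ring. *)
Lemma transpose : exists t : P -> P, [/\ {morph t : x y / x - y},
  forall x y, t (x * y) = t y * t x, forall a, t (sc a) = sc a,
  forall m, t (M m) = N m & forall m, t (N m) = M m].
Proof.
pose sc' (a : A) : P^c := sc a.
have sc'_zmod : zmod_morphism sc' by move=> a b; rewrite /sc' rmorphB.
have sc'_monoid : monoid_morphism sc'.
  split; first exact: (rmorph1 sc).
  by move=> a b; rewrite -[RHS]/(sc b * sc a : P) -(rmorphM sc) mulrC.
pose al : {rmorphism A -> P^c} := HB.pack sc'
  (GRing.isZmodMorphism.Build _ _ _ sc'_zmod)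
  (GRing.isMonoidMorphism.Build _ _ _ sc'_monoid).
have [||||||||h [hA hM hN]] := @P_lift P^c al N M.
- exact: raddfD.
- exact: raddfD.
- by move=> a m; rewrite -[RHS]/(N m * sc a) Nsc mulrC.
- by move=> a m; rewrite -[RHS]/(sc a * N m) scN mulrC.
- by move=> a m; rewrite -[RHS]/(M m * sc a) Msc mulrC.
- by move=> a m; rewrite -[RHS]/(sc a * M m) scM mulrC.
- exact: M1N1.
- exact: Casimir_sym.
exists h; split=> //; first exact: (rmorphB h).
by move=> x y; apply: (rmorphM h).
Qed.
(** The other two of the four corners vanish in degree [d] by parity. *)
Lemma D_decomposition d x : D d x <-> exists v1 v2,
  [/\ corner false (odd d) d.+1 v1, corner true (~~ odd d) d.+1 v2 & x = v1 + v2].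
Proof.
split=> [Dx|[v1 [v2 [[D1 _ _] [D2 _ _] ->]]]]; last exact: D_D.
exists (eps false * x * eps (odd d)), (eps true * x * eps (~~ odd d)).
split; [exact: corner_proj|exact: corner_proj|].
have z1 : eps false * x * eps (~~ odd d) = 0.
  by apply: corner_odd (corner_proj _ _ Dx) _.
have z2 : eps true * x * eps (odd d) = 0 by apply: corner_odd (corner_proj _ _ Dx) _.
have epsE a : eps a * x = eps a * x * eps (odd d) + eps a * x * eps (~~ odd d).
  rewrite -mulrDr -[LHS]mulr1 -eps_sum; case: (odd d) => //=.
  by rewrite addrC.
transitivity (eps false * x + eps true * x); first by rewrite -mulrDl eps_sum mul1r.
by congr (_ + _); rewrite [LHS]epsE ?z1 ?z2 ?addr0 ?add0r.
Qed.

Lemma corner_direct b b' m v1 v2 :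
  corner false b m.+1 v1 -> corner true b' m.+1 v2 -> v1 + v2 = 0 ->
  v1 = 0 /\ v2 = 0.
Proof.
move=> [_ e1 _] [_ e2 _] v0.
have v10 : v1 = 0.
  have := congr1 (fun x => eps false * x) v0.
  rewrite mulrDr e1 mulr0 -e2 mulrA (eps_orth false) mul0r addr0.
  by [].
by split=> //; rewrite v10 add0r in v0.
Qed.

(** These are the statements for right multiplication by [N 1] and [M 1], carried over by the
    anti-automorphism [transpose]. *)
Lemma corner_left b m :
  [/\ forall x, corner true b m x -> corner false b m.+1 (M 1 * x),
      forall x, corner false b m x -> corner true b m.+1 (N 1 * x),
      forall x, corner false b m.+2 x -> exists2 y, corner true b m.+1 y & M 1 * y = x &
      forall y, corner true b m.+1 y -> M 1 * y = 0 ->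
        exists2 v, corner false b m v & y = N 1 * v].
Proof.
have [t [tB tM tA tMM tN]] := transpose.
have t0 : t 0 = 0 by have := tB 0 0; rewrite !subrr.
have tO x : t (- x) = - t x by rewrite -sub0r tB t0 sub0r.
have tD x y : t (x + y) = t x + t y by rewrite -{1}[y]opprK tB tO opprK.
have tK x : t (t x) = x.
  elim/P_ind: x => [a|s|s|x y ex ey|x ex|x y ex ey].
  - by rewrite !tA.
  - by rewrite tMM tN.
  - by rewrite tN tMM.
  - by rewrite !tD ex ey.
  - by rewrite !tO ex.
  - by rewrite !tM ex ey.
have tD_deg d x : D d x -> D d (t x).
  elim: d x => [|d IH] x; first by move=> /D0[a ->]; rewrite tA; apply/D0; exists a.
  move: x; apply: D_ind => [|x y Dx Dy|y s Dy|y s Dy].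
  - by rewrite t0; apply: D_0.
  - by rewrite tB; apply: DB.
  - by rewrite tM tMM -add1n; apply: D_mul; [apply: D_N1|apply: IH].
  - by rewrite tM tN -add1n; apply: D_mul; [apply: D_M|apply: IH].
have t_corner a c k x : corner a c k x -> corner c a k (t x).
  case: k => [->|k [Dx ax xc]]; first exact: t0.
  have t_eps b' : t (eps b') = eps b' := tA _.
  by split; [apply: tD_deg|rewrite -{1}t_eps -tM xc|rewrite -{1}t_eps -tM ax].
split=> [x Cx|x Cx|x Cx|y Cy y0].
- by rewrite -[_ * x]tK tM tMM; apply/t_corner/corner_N/t_corner.
- by rewrite -[_ * x]tK tM tN; apply/t_corner/corner_M/t_corner.
- have [y Cy ey] := corner_N_surj (t_corner _ _ _ _ Cx).
  by exists (t y); [apply: t_corner|rewrite -tN -tM ey tK].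
- have [|v Cv ev] := corner_N_ker (t_corner _ _ _ _ Cy).
    by rewrite -(tMM 1) -tM y0 t0.
  by exists (t v); [apply: t_corner|rewrite -tMM -tM -ev tK].
Qed.
End GradedCorners.

(** * Generation of the corner of R by Clifford words *)

Section CliffordSpan.
Variables (R : comPzRingType) (P : pzRingType) (rho : {rmorphism R -> P}).
Hypothesis rhoC : forall r x, x * rho r = rho r * x.

Inductive span (G : P -> Prop) : P -> Prop :=
  | span0 : span G 0
  | span_gen x : G x -> span G x
  | spanD x y : span G x -> span G y -> span G (x + y)
  | spanZ r x : span G x -> span G (rho r * x).

Lemma spanN G x : span G x -> span G (- x).
Proof. by move=> Gx; rewrite -mulN1r -(rmorphN1 rho); apply: spanZ. Qed.

Lemma spanB G x y : span G x -> span G y -> span G (x - y).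
Proof. by move=> Gx Gy; apply: spanD => //; apply: spanN. Qed.

Lemma span_sum G (I : finType) (F : I -> P) :
  (forall i, span G (F i)) -> span G (\sum_i F i).
Proof.
by move=> h; elim/big_rec: _ => [|i x _ Gx]; [apply: span0|apply: spanD].
Qed.

Lemma span_mono (G H : P -> Prop) x :
  (forall y, G y -> span H y) -> span G x -> span H x.
Proof.
move=> GH; elim=> {x} [|x /GH //|x y _ Gx _ Gy|r x _ Gx].
- exact: span0.
- exact: spanD.
- exact: spanZ.
Qed.

Lemma span_mull G H a x :
  (forall y, G y -> span H (a * y)) -> span G x -> span H (a * x).
Proof.
move=> GH; elim=> {x} [|x /GH //|x y _ Gx _ Gy|r x _ Gx].
- by rewrite mulr0; apply: span0.
- by rewrite mulrDr; apply: spanD.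
- by rewrite mulrA rhoC -mulrA; apply: spanZ.
Qed.

Lemma span_mulr G H a x :
  (forall y, G y -> span H (y * a)) -> span G x -> span H (x * a).
Proof.
move=> GH; elim=> {x} [|x /GH //|x y _ Gx _ Gy|r x _ Gx].
- by rewrite mul0r; apply: span0.
- by rewrite mulrDl; apply: spanD.
- by rewrite -mulrA; apply: spanZ.
Qed.

Lemma span_seq (s : seq P) x : span (fun y => y \in s) x ->
  exists c : 'rV[R]_(size s), x = \sum_i rho (c 0 i) * s`_i.
Proof.
elim=> {x} [|x xs|x y _ [c ->] _ [d ->]|r x _ [c ->]].
- by exists 0; rewrite big1 // => i _; rewrite mxE rmorph0 mul0r.
- have ix : (index x s < size s)%N by rewrite index_mem.
  exists (\row_i (i == Ordinal ix)%:R); rewrite (bigD1 (Ordinal ix)) //= mxE eqxx.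
  rewrite rmorph1 mul1r nth_index // big1 ?addr0 // => i ii.
  by rewrite mxE (negPf ii) rmorph0 mul0r.
- exists (c + d); rewrite -big_split; apply: eq_bigr => i _ /=.
  by rewrite mxE rmorphD mulrDl.
- exists (r *: c); rewrite mulr_sumr; apply: eq_bigr => i _.
  by rewrite mxE rmorphM mulrA.
Qed.

Variables (x1 x2 x3 c1 c2 eR : P).
Hypotheses (ex1 : eR * x1 = x1) (ex2 : eR * x2 = x2) (ex3 : eR * x3 = x3).
Hypotheses (c1e : c1 * eR = c1) (c2e : c2 * eR = c2).
Hypothesis cc : c1 * c2 = c2 * c1.
Hypothesis cx1 : forall x, x = x1 \/ x = x2 \/ x = x3 -> x * c1 = c1 * x.
Hypothesis cx2 : forall x, x = x1 \/ x = x2 \/ x = x3 -> x * c2 = c2 * x.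

Definition pencil (q : P) : Prop := exists r s, q = rho r * c1 + rho s * c2.

Hypotheses (q11 : pencil (x1 * x1)) (q22 : pencil (x2 * x2)) (q33 : pencil (x3 * x3)).
Hypotheses (q12 : pencil (x1 * x2 + x2 * x1)) (q13 : pencil (x1 * x3 + x3 * x1))
  (q23 : pencil (x2 * x3 + x3 * x2)).

(** The index counts the factors [x1], [x2], [x3], with [c1] and [c2] counting twice. There is no
    reduction on the powers of [c1] and [c2]. *)
Inductive monomial : nat -> P -> Prop :=
  | mono0 : monomial 0 eR
  | mono1 : monomial 1 x1
  | mono2 : monomial 1 x2
  | mono3 : monomial 1 x3
  | mono12 : monomial 2 (x1 * x2)
  | mono13 : monomial 2 (x1 * x3)
  | mono23 : monomial 2 (x2 * x3)
  | mono123 : monomial 3 (x1 * x2 * x3)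
  | mono_c1 k y : monomial k y -> monomial k.+2 (c1 * y)
  | mono_c2 k y : monomial k y -> monomial k.+2 (c2 * y).

Lemma pencil_comm q x : pencil q -> x = x1 \/ x = x2 \/ x = x3 -> x * q = q * x.
Proof.
move=> [r [s ->]] xx; rewrite mulrDr mulrDl !mulrA !rhoC -!mulrA.
by rewrite cx1 // cx2.
Qed.

Lemma pencil_span k q y : pencil q -> span (monomial k) y ->
  span (monomial k.+2) (q * y).
Proof.
move=> [r [s ->]] ky; rewrite mulrDl -!mulrA; apply: spanD; apply: spanZ.
  by apply: span_mull ky => z kz; apply/span_gen/mono_c1.
by apply: span_mull ky => z kz; apply/span_gen/mono_c2.
Qed.

Lemma pencil_mono2 q : pencil q -> span (monomial 2) q.
Proof.
move=> [r [s ->]]; apply: spanD; apply: spanZ; apply: span_gen.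
  by rewrite -c1e; apply/mono_c1/mono0.
by rewrite -c2e; apply/mono_c2/mono0.
Qed.

Let x1P : x1 = x1 \/ x1 = x2 \/ x1 = x3. Proof. by left. Qed.
Let x2P : x2 = x1 \/ x2 = x2 \/ x2 = x3. Proof. by right; left. Qed.
Let e21 : x2 * x1 = (x1 * x2 + x2 * x1) - x1 * x2. Proof. by rewrite addrC addKr. Qed.
Let e31 : x3 * x1 = (x1 * x3 + x3 * x1) - x1 * x3. Proof. by rewrite addrC addKr. Qed.
Let e32 : x3 * x2 = (x2 * x3 + x3 * x2) - x2 * x3. Proof. by rewrite addrC addKr. Qed.

(** Reordering as in a Clifford algebra: a misplaced factor is moved to the left by anticommutators,
    which lie in the pencil and hence commute with the generators, until the word is increasing or a
    square appears. *)
Lemma monomial_mulr k y x : monomial k y -> x = x1 \/ x = x2 \/ x = x3 ->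
  span (monomial k.+1) (y * x).
Proof.
have [g1 g2 g3] : [/\ span (monomial 1) x1, span (monomial 1) x2
    & span (monomial 1) x3].
  by split; apply: span_gen; constructor.
have [g12 g13 g23] : [/\ span (monomial 2) (x1 * x2), span (monomial 2) (x1 * x3)
    & span (monomial 2) (x2 * x3)].
  by split; apply: span_gen; constructor.
have g123 : span (monomial 3) (x1 * x2 * x3) by apply: span_gen; constructor.
have C x' q : x' = x1 \/ x' = x2 \/ x' = x3 -> pencil q -> x' * q = q * x'.
  by move=> x'P pq; apply: pencil_comm.
have h aa bb cc' q : aa = x1 \/ aa = x2 \/ aa = x3 -> pencil q ->
    aa * (q * bb - cc') = q * (aa * bb) - aa * cc'.
  by move=> ax pq; rewrite mulrBr mulrA (C _ _ ax pq) mulrA.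
have h121 : x1 * x2 * x1 = (x1 * x2 + x2 * x1) * x1 - x1 * x1 * x2.
  by rewrite -mulrA {1}e21 mulrBr (C _ _ x1P q12) mulrA.
have h131 : x1 * x3 * x1 = (x1 * x3 + x3 * x1) * x1 - x1 * x1 * x3.
  by rewrite -mulrA {1}e31 mulrBr (C _ _ x1P q13) mulrA.
have h132 : x1 * x3 * x2 = (x2 * x3 + x3 * x2) * x1 - x1 * x2 * x3.
  by rewrite -mulrA {1}e32 mulrBr (C _ _ x1P q23) mulrA.
have h231 : x2 * x3 * x1 = (x1 * x3 + x3 * x1) * x2 -
    ((x1 * x2 + x2 * x1) * x3 - x1 * x2 * x3).
  rewrite -mulrA {1}e31 mulrBr (C _ _ x2P q13) mulrA; congr (_ - _).
  by rewrite {1}e21 mulrBl.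
have h232 : x2 * x3 * x2 = (x2 * x3 + x3 * x2) * x2 - x2 * x2 * x3.
  by rewrite -mulrA {1}e32 mulrBr (C _ _ x2P q23) mulrA.
have h122 : x1 * x2 * x2 = x2 * x2 * x1 by rewrite -mulrA (C _ _ x1P q22).
have h133 : x1 * x3 * x3 = x3 * x3 * x1 by rewrite -mulrA (C _ _ x1P q33).
have h233 : x2 * x3 * x3 = x3 * x3 * x2 by rewrite -mulrA (C _ _ x2P q33).
have h1231 : x1 * x2 * x3 * x1 = (x1 * x3 + x3 * x1) * (x1 * x2) -
    ((x1 * x2 + x2 * x1) * (x1 * x3) - x1 * x1 * (x2 * x3)).
  have -> : x1 * x2 * x3 * x1 = x1 * (x2 * x3 * x1) by rewrite !mulrA.
  rewrite h231 (h _ _ _ _ x1P q13); congr (_ - _).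
  by rewrite (h _ _ _ _ x1P q12) !mulrA.
have h1232 : x1 * x2 * x3 * x2 = (x2 * x3 + x3 * x2) * (x1 * x2) - x2 * x2 * (x1 * x3).
  have -> : x1 * x2 * x3 * x2 = x1 * (x2 * x3 * x2) by rewrite !mulrA.
  by rewrite h232 (h _ _ _ _ x1P q23) (mulrA x1) (C _ _ x1P q22) (mulrA (x2 * x2)).
have h1233 : x1 * x2 * x3 * x3 = x3 * x3 * (x1 * x2).
  have -> : x1 * x2 * x3 * x3 = x1 * (x2 * x3 * x3) by rewrite !mulrA.
  by rewrite h233 (mulrA x1) (C _ _ x1P q33) (mulrA (x3 * x3)).
have S := pencil_span; have S2 := pencil_mono2.
move=> ky xx; elim: k y / ky => [||||||||k y _ IH|k y _ IH]; last 1 first.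
- by rewrite -mulrA; apply: span_mull IH => z kz; apply/span_gen/mono_c2.
- by case: xx => [|[]] ->; rewrite ?ex1 ?ex2 ?ex3.
- by case: xx => [|[]] -> //; apply: S2.
- by case: xx => [|[]] -> //; [rewrite e21; apply: spanB => //|]; apply: S2.
- by case: xx => [|[]] ->;
    [rewrite e31; apply: spanB => //|rewrite e32; apply: spanB => //|]; apply: S2.
- case: xx => [|[]] -> //; first by rewrite h121; apply: spanB; apply: S.
  by rewrite h122; apply: S.
- case: xx => [|[]] ->; first by rewrite h131; apply: spanB; apply: S.
    by rewrite h132; apply: spanB => //; apply: S.
  by rewrite h133; apply: S.
- case: xx => [|[]] ->.
  + by rewrite h231; apply: spanB; [|apply: spanB => //]; apply: S.
  + by rewrite h232; apply: spanB; apply: S.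
  + by rewrite h233; apply: S.
- case: xx => [|[]] ->.
  + by rewrite h1231; apply: spanB; [|apply: spanB]; apply: S.
  + by rewrite h1232; apply: spanB; apply: S.
  + by rewrite h1233; apply: S.
- by rewrite -mulrA; apply: span_mull IH => z kz; apply/span_gen/mono_c1.
Qed.

(* The spanning words in which c1 does not occur. *)
Fixpoint bottom_words (k : nat) : seq P :=
  match k with
  | 0 => [:: eR]
  | 1 => [:: x1; x2; x3]
  | 2 => [:: c2; x1 * x2; x1 * x3; x2 * x3]
  | 3 => [:: c2 * x1; c2 * x2; c2 * x3; x1 * x2 * x3]
  | k'.+2 => [seq c2 * y | y <- bottom_words k']
  end.

Fixpoint words (k : nat) : seq P :=
  if k is k'.+2 then [seq c1 * y | y <- words k'] ++ bottom_words k
  else bottom_words k.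

Lemma wordsE k : words k.+2 = [seq c1 * y | y <- words k] ++ bottom_words k.+2.
Proof. by []. Qed.

(** There are 1 and 3 words in the lowest cases, and each step by two adds the four words without
    [c1]. *)
Lemma size_words k : size (words k) = k.*2.+1.
Proof.
have size_bottom j : size (bottom_words j.+2) = 4.
  elim/ltn_ind: j => -[|[|j]] IH //.
  by rewrite [bottom_words _]/= size_map IH.
elim/ltn_ind: k => -[|[|k]] IH //.
by rewrite wordsE size_cat size_map IH // size_bottom !doubleS !addnS addn0.
Qed.

(** Since [c1] and [c2] commute, all factors [c1] can be collected in front. *)
Lemma monomial_words k y : monomial k y -> span (fun z => z \in words k) y.
Proof.
have top j z : z \in bottom_words j -> z \in words j.
  by case: j => [|[|j]] // zj; rewrite wordsE mem_cat zj orbT.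
have c1_words j z : span (fun z => z \in words j) z ->
    span (fun z => z \in words j.+2) (c1 * z).
  move=> jz; apply: span_mull jz => w jw; apply: span_gen.
  by rewrite wordsE mem_cat map_f.
have c2_words j z : span (fun z => z \in words j) z ->
    span (fun z => z \in words j.+2) (c2 * z).
  elim/ltn_ind: j z => j IH z jz; apply: span_mull jz => w.
  have c2_bottom : w \in bottom_words j ->
      span (fun z => z \in words j.+2) (c2 * w).
    case: j {IH} => [|[|j]] jw; apply/span_gen/top.
    - by move: jw; rewrite !inE => /eqP ->; rewrite c2e eqxx.
    - by move: jw; rewrite !inE => /or3P[]/eqP ->; rewrite eqxx ?orbT.
    - exact: map_f.
  case: j IH c2_bottom => [|[|j]] IH c2_bottom //.
  rewrite wordsE mem_cat => /orP[/mapP[v vj ->]|//].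
  rewrite mulrA -cc -mulrA; apply: c1_words; apply: IH => //.
  exact: span_gen.
elim=> {k y} [||||||||k y _ ky|k y _ ky]; last exact: c2_words.
all: try exact: c1_words.
all: apply: span_gen; rewrite ?mem_cat !inE eqxx ?orbT //.
Qed.

Lemma words_monomial k z : z \in words k -> monomial k z.
Proof.
have bottom j w : w \in bottom_words j -> monomial j w.
  elim/ltn_ind: j w => -[|[|[|[|j]]]] IH w.
  - by rewrite inE => /eqP ->; constructor.
  - by rewrite !inE => /or3P[]/eqP ->; constructor.
  - rewrite !inE => /or4P[]/eqP ->; try constructor.
    by rewrite -c2e; apply/mono_c2/mono0.
  - by rewrite !inE => /or4P[]/eqP ->; [apply: mono_c2..|]; constructor.
  - by move=> /mapP[v vj ->]; apply/mono_c2/IH.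
elim/ltn_ind: k z => -[|[|k]] IH z; try exact: bottom.
rewrite wordsE mem_cat => /orP[/mapP[v vk ->]|]; last exact: bottom.
exact/mono_c1/IH.
Qed.

Lemma words_mulr k y x : span (fun z => z \in words k) y ->
  x = x1 \/ x = x2 \/ x = x3 -> span (fun z => z \in words k.+1) (y * x).
Proof.
move=> ky xx; apply: span_mulr ky => z /words_monomial kz.
exact: span_mono (@monomial_words k.+1) (monomial_mulr kz xx).
Qed.

End CliffordSpan.

(** * The fibre of S at a prime and the pencil of conics through it *)

Section FrobeniusFibre.
Variables (R S : comPzRingType) (phi : {rmorphism R -> S}) (l : {additive S -> R}).
Hypothesis lZ : forall r x, l (phi r * x) = r * l x.
Variable p : prime_ideal R.

(* z vanishes on the fibre at p, the trace form being nondegenerate. *)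
Definition vanishes (z : S) : Prop := forall w, l (z * w) \in p.

Lemma vanishesB x y : vanishes x -> vanishes y -> vanishes (x - y).
Proof. by move=> Zx Zy w; rewrite mulrBl raddfB; apply: primeB. Qed.

Lemma vanishesD x y : vanishes x -> vanishes y -> vanishes (x + y).
Proof. by move=> Zx Zy w; rewrite mulrDl raddfD; apply: primeD. Qed.

Lemma vanishesM x y : vanishes x -> vanishes (x * y).
Proof. by move=> Zx w; rewrite -mulrA. Qed.

Lemma vanishesMl x y : vanishes x -> vanishes (y * x).
Proof. by rewrite mulrC; apply: vanishesM. Qed.

Lemma vanishes_scale r x : r \in p -> vanishes (phi r * x).
Proof. by move=> rp w; rewrite -mulrA lZ; apply: primeMr. Qed.

Lemma vanishesI r x : r \notin p -> vanishes (phi r * x) -> vanishes x.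
Proof. by move=> rp Zx w; have := Zx w; rewrite -mulrA lZ; apply: primeMI. Qed.

Lemma vanishes_sub x y : vanishes (x - y) -> vanishes y -> vanishes x.
Proof. by move=> Zxy Zy; rewrite -[x](subrK y); apply: vanishesD. Qed.

(* A basis of the orthogonal complement of 1 in the fibre at p. *)
Variables (p1 p2 p3 : S) (u : R).
Hypotheses (l1 : l p1 = 0) (l2 : l p2 = 0) (l3 : l p3 = 0).
Hypothesis up : u \notin p.
Hypothesis orth : forall z, l (z * p1) \in p -> l (z * p2) \in p ->
  l (z * p3) \in p -> exists r, vanishes (phi u * z - phi r).
Hypothesis indep3 : forall n1 n2 n3,
  vanishes (phi n1 * p1 + phi n2 * p2 + phi n3 * p3) ->
  [/\ n1 \in p, n2 \in p & n3 \in p].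

(** Let X and Y be the two cofactors. As m X and m Y vanish on the fibre, a multiple m w orthogonal
    to [p3] is orthogonal to [p1] and [p2] too, hence equals a scalar r there. Then r X vanishes,
    being a multiple of m X; since X does not vanish, r = 0 and so m w = 0. *)
Lemma common_factor_vanishes D a1 a2 n1 n2 n3 : D \notin p ->
  let m := phi n1 * p1 + phi n2 * p2 + phi n3 * p3 in
  vanishes (m * (phi D * p1 + phi a1 * p3)) ->
  vanishes (m * (phi D * p2 + phi a2 * p3)) -> vanishes m.
Proof.
move=> Dp m; set X := phi D * p1 + _; set Y := phi D * p2 + _ => mX mY.
have XN k : vanishes (phi k * X) -> k \in p.
  move=> kX; have [|h _ _] := @indep3 (k * D) 0 (k * a1).
    suff <- : phi k * X = phi (k * D) * p1 + phi 0 * p2 + phi (k * a1) * p3 by [].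
    by rewrite rmorph0 mul0r addr0 !rmorphM mulrDr !mulrA.
  by rewrite mulrC in h; apply: primeMI h.
have p12 w : l (m * w * p3) \in p -> l (m * w * p1) \in p /\ l (m * w * p2) \in p.
  move=> h3; split; apply: (primeMI Dp).
    have : l (m * X * w) \in p by apply: mX.
    have -> : m * X * w = phi D * (m * w * p1) + phi a1 * (m * w * p3).
      by rewrite /X; ring.
    rewrite raddfD !lZ => h.
    by rewrite -[D * _](addrK (a1 * l (m * w * p3))) primeB // primeMl.
  have : l (m * Y * w) \in p by apply: mY.
  have -> : m * Y * w = phi D * (m * w * p2) + phi a2 * (m * w * p3).
    by rewrite /Y; ring.
  rewrite raddfD !lZ => h.
  by rewrite -[D * _](addrK (a2 * l (m * w * p3))) primeB // primeMl.
have scalar_part w r : vanishes (phi u * (m * w) - phi r) -> vanishes (m * w).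
  move=> Zr; have rp : r \in p.
    apply: XN; apply: (@vanishes_sub _ (phi u * w * (m * X))).
      have -> : phi r * X - phi u * w * (m * X) =
          - ((phi u * (m * w) - phi r) * X) by ring.
      by rewrite -mulN1r; apply/vanishesMl/vanishesM.
    exact: vanishesMl.
  apply: (vanishesI up); apply: (@vanishes_sub _ (phi r)) => //.
  by rewrite -[phi r]mulr1; apply: vanishes_scale.
have lm : l m = 0 by rewrite /m !raddfD /= !lZ l1 l2 l3 !mulr0 !addr0.
have [b0|b0] := boolP (l (m * p3) \in p).
  have [|h1 h2] := p12 1; first by rewrite mulr1.
  rewrite mulr1 in h1 h2.
  have [r Zr] := orth h1 h2 b0.
  by have := @scalar_part 1 r; rewrite mulr1; apply.
(* Now [b] is invertible at p. Correcting [b z] by a scalar makes [m * z'] orthogonal to [p3], so it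
   vanishes; as [l m = 0], applying [l] leaves [b * l (m * z)] in p. *)
set b := l (m * p3) in b0 => z; apply: (primeMI b0).
pose z' := phi b * z - phi (l (m * z * p3)).
have w3 : l (m * z' * p3) \in p.
  have -> : m * z' * p3 = phi b * (m * z * p3) - phi (l (m * z * p3)) * (m * p3).
    by rewrite /z'; ring.
  by rewrite raddfB !lZ /b mulrC subrr prime0.
have [w1 w2] := p12 _ w3; have [r /scalar_part Zr] := orth w1 w2 w3.
have := Zr 1; rewrite mulr1.
have -> : m * z' = phi b * (m * z) - phi (l (m * z * p3)) * m by rewrite /z'; ring.
by rewrite raddfB !lZ lm mulr0 subr0.
Qed.

(** Each y p_i is orthogonal to all p_j, hence is a scalar r_i on the fibre. From r_i p_j = r_j p_i
    and independence all r_i are 0. Then y itself is orthogonal to the p_j, so it is a scalar too,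
    and y p_1 = 0 makes it 0. *)
Lemma products_span y :
  l (p1 * p1 * y) \in p -> l (p2 * p2 * y) \in p -> l (p3 * p3 * y) \in p ->
  l (p1 * p2 * y) \in p -> l (p1 * p3 * y) \in p -> l (p2 * p3 * y) \in p ->
  vanishes y.
Proof.
move=> h11 h22 h33 h12 h13 h23.
have up1 : exists r, vanishes (phi u * (y * p1) - phi r).
  by apply: orth; [move: h11|move: h12|move: h13]; congr (l _ \in p); ring.
have up2 : exists r, vanishes (phi u * (y * p2) - phi r).
  by apply: orth; [move: h12|move: h22|move: h23]; congr (l _ \in p); ring.
have up3 : exists r, vanishes (phi u * (y * p3) - phi r).
  by apply: orth; [move: h13|move: h23|move: h33]; congr (l _ \in p); ring.
have [[r1 Z1] [r2 Z2] [r3 Z3]] := And3 up1 up2 up3.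
have key a b r s : vanishes (phi u * (y * a) - phi r) ->
    vanishes (phi u * (y * b) - phi s) -> vanishes (phi r * b - phi s * a).
  move=> Za Zb; have -> : phi r * b - phi s * a =
      (phi u * (y * b) - phi s) * a - (phi u * (y * a) - phi r) * b by ring.
  by apply: vanishesB; apply: vanishesM.
have [r2p r1p _] : [/\ - r2 \in p, r1 \in p & 0 \in p].
  apply: indep3; have := key _ _ _ _ Z1 Z2; congr vanishes.
  by rewrite rmorphN rmorph0; ring.
have [r3p _ _] : [/\ - r3 \in p, 0 \in p & r1 \in p].
  apply: indep3; have := key _ _ _ _ Z1 Z3; congr vanishes.
  by rewrite rmorphN rmorph0; ring.
have lyp a r : vanishes (phi u * (y * a) - phi r) -> r \in p ->
    vanishes (y * a).
  move=> Za rp; apply: (vanishesI up); apply: (vanishes_sub Za).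
  by rewrite -[phi r]mulr1; apply: vanishes_scale.
have yp1 := lyp _ _ Z1 r1p.
have yp2 : vanishes (y * p2) by apply: lyp Z2 _; rewrite -[r2]opprK primeN.
have yp3 : vanishes (y * p3) by apply: lyp Z3 _; rewrite -[r3]opprK primeN.
have lp a : vanishes (y * a) -> l (y * a) \in p by move=> /(_ 1); rewrite mulr1.
have [r Zr] := orth (lp _ yp1) (lp _ yp2) (lp _ yp3).
have [rp _ _] : [/\ r \in p, 0 \in p & 0 \in p].
  apply: indep3; have : vanishes (phi u * (y * p1) - (phi u * y - phi r) * p1).
    by apply: vanishesB; [apply: vanishesMl|apply: vanishesM].
  by congr vanishes; rewrite !rmorph0; ring.
apply: (vanishesI up); apply: (vanishes_sub Zr).
by rewrite -[phi r]mulr1; apply: vanishes_scale.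
Qed.

Local Notation K := (residue p).
Local Notation rho := (@to_residue R p).

(* The quadratic form a X1^2 + b X2^2 + c X3^2 + d X1 X2 + e X1 X3 + f X2 X3
   vanishes at (p1, p2, p3) on the fibre. *)
Definition conic (a b c d e f : K) : Prop := forall s : S,
  a * rho (l (p1 * p1 * s)) + b * rho (l (p2 * p2 * s)) + c * rho (l (p3 * p3 * s)) +
  d * rho (l (p1 * p2 * s)) + e * rho (l (p1 * p3 * s)) + f * rho (l (p2 * p3 * s)) = 0.

(* A syzygy X1 g1 + X2 g2 + X3 g3 = 0 between conics of a pencil vanishes: if
   g3 = al g1 + be g2 then g1 = (X2 + be X3) m and g2 = - (X1 + al X3) m for a
   linear form m. *)
Lemma conic_syzygy_pencil (al be a1 b1 c1 d1 e1 f1 a2 b2 c2 d2 e2 f2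
    a3 b3 c3 d3 e3 f3 : K) :
  conic a1 b1 c1 d1 e1 f1 -> conic a2 b2 c2 d2 e2 f2 ->
  a1 = 0 -> b2 = 0 -> c3 = 0 -> d1 + a2 = 0 -> e1 + a3 = 0 -> d2 + b1 = 0 ->
  f2 + b3 = 0 -> e3 + c1 = 0 -> f3 + c2 = 0 -> f1 + e2 + d3 = 0 ->
  a3 = al * a1 + be * a2 -> b3 = al * b1 + be * b2 -> c3 = al * c1 + be * c2 ->
  d3 = al * d1 + be * d2 -> e3 = al * e1 + be * e2 -> f3 = al * f1 + be * f2 ->
  [:: a1; b1; c1; d1; e1; f1; a2; b2; c2; d2; e2; f2; a3; b3; c3; d3; e3; f3]
    = nseq 18 0.
Proof.
move=> g1 g2 a10 b20 c30 h1 h2 h3 h4 h5 h6 h7 a3E b3E c3E d3E e3E f3E.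
have eqN (x y : K) : x + y = 0 -> x = - y by move/eqP; rewrite addr_eq0 => /eqP.
(* The linear form of the comment above is m = d1 X1 + b1 X2 + mu3 X3; the next equations express
   all coefficients of g1 and g2 through it. *)
pose mu3 := f1 - be * b1.
have f1E : f1 = mu3 + be * b1 by rewrite subrK.
have a2E : a2 = - d1 by apply: eqN; rewrite addrC.
have d2E : d2 = - b1 by apply: eqN.
have e1E : e1 = be * d1 by rewrite (eqN _ _ h2) a3E a10 a2E; ring.
have f2E : f2 = - (al * b1) by rewrite (eqN _ _ h4) b3E b20; ring.
have e2E : e2 = - (mu3 + al * d1).
  have -> : e2 = (f1 + e2 + d3) - f1 - d3 by ring.
  by rewrite h7 d3E d2E /mu3; ring.
have c1E : c1 = be * mu3.
  by rewrite (eqN _ _ (etrans (addrC _ _) h5)) e3E e1E e2E /mu3; ring.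
have c2E : c2 = - (al * mu3).
  by rewrite (eqN _ _ (etrans (addrC _ _) h6)) f3E f2E /mu3; ring.
(* The form m and the two cofactors are lifted to [R] with one common denominator [D]. *)
have [D Dp [N eN]] := residue_mx (\row_(i < 5) [:: al; be; d1; b1; mu3]`_i).
have eNi i : rho D * [:: al; be; d1; b1; mu3]`_(val i) = rho (N 0 i).
  by have /matrixP/(_ 0 i) := eN; rewrite !mxE.
pose i0 : 'I_5 := @Ordinal 5 0 isT; pose i1 : 'I_5 := @Ordinal 5 1 isT.
pose i2 : 'I_5 := @Ordinal 5 2 isT; pose i3 : 'I_5 := @Ordinal 5 3 isT.
pose i4 : 'I_5 := @Ordinal 5 4 isT.
have [n0 n1 n2 n3 n4] := And5 (eNi i0) (eNi i1) (eNi i2) (eNi i3) (eNi i4).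
rewrite /= in n0 n1 n2 n3 n4.
move: (N 0 i0) (N 0 i1) (N 0 i2) (N 0 i3) (N 0 i4) n0 n1 n2 n3 n4.
move=> A B n1 n2 n3 eA eB en1 en2 en3 {N eN eNi i0 i1 i2 i3 i4}.
pose m := phi n1 * p1 + phi n2 * p2 + phi n3 * p3.
(* On the fibre this product is -D^2 g2, and the next one is D^2 g1, so both vanish because g1 and
   g2 are conics through the fibre. *)
have mX : vanishes (m * (phi D * p1 + phi A * p3)).
  move=> w; rewrite -to_residue_eq0.
  have -> : m * (phi D * p1 + phi A * p3) * w =
      phi (n1 * D) * (p1 * p1 * w) + phi (n3 * A) * (p3 * p3 * w) +
      phi (n2 * D) * (p1 * p2 * w) + phi (n3 * D + n1 * A) * (p1 * p3 * w) +
      phi (n2 * A) * (p2 * p3 * w).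
    by rewrite /m !(rmorphD phi) !(rmorphM phi); ring.
  rewrite !(raddfD, lZ) /= !(rmorphM, raddfD) /= !rmorphM /=.
  rewrite -en1 -en2 -en3 -eA; apply/eqP.
  transitivity (- (rho D * rho D) * 0); last by rewrite mulr0.
  by rewrite -(g2 w) a2E b20 c2E d2E e2E f2E; ring.
have mY : vanishes (m * (phi D * p2 + phi B * p3)).
  move=> w; rewrite -to_residue_eq0.
  have -> : m * (phi D * p2 + phi B * p3) * w =
      phi (n2 * D) * (p2 * p2 * w) + phi (n3 * B) * (p3 * p3 * w) +
      phi (n1 * D) * (p1 * p2 * w) + phi (n1 * B) * (p1 * p3 * w) +
      phi (n3 * D + n2 * B) * (p2 * p3 * w).
    by rewrite /m !(rmorphD phi) !(rmorphM phi); ring.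
  rewrite !(raddfD, lZ) /= !(rmorphM, raddfD) /= !rmorphM /=.
  rewrite -en1 -en2 -en3 -eB; apply/eqP.
  transitivity ((rho D * rho D) * 0); last by rewrite mulr0.
  by rewrite -(g1 w) a10 c1E e1E f1E; ring.
have [k1 k2 k3] := indep3 (common_factor_vanishes Dp mX mY).
have Dn0 : rho D != 0 by rewrite to_residue_eq0.
have null x k : rho D * x = rho k -> k \in p -> x = 0.
  rewrite -to_residue_eq0 => <-; rewrite mulf_eq0 (negPf Dn0) => /eqP //.
have d10 : d1 = 0 := null _ _ en1 k1.
have b10 : b1 = 0 := null _ _ en2 k2.
have mu0 : mu3 = 0 := null _ _ en3 k3.
by rewrite a3E b3E c3E d3E e3E f3E a10 c1E e1E f1E a2E b20 c2E d2E e2E f2E d10 b10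
  mu0 !(mulr0, oppr0, addr0).
Qed.

End FrobeniusFibre.

Lemma solve_dependency (F : fieldType) (a b c x y z : F) :
  c != 0 -> a * x + b * y + c * z = 0 -> z = - (a / c) * x + - (b / c) * y.
Proof.
move=> c0 e0; have -> : z = (a * x + b * y + c * z) / c - a / c * x - b / c * y.
  by field.
by rewrite e0; ring.
Qed.

Section ConicSyzygies.
Variables (R S : comPzRingType) (phi : {rmorphism R -> S}) (l : {additive S -> R}).
Hypothesis lZ : forall r x, l (phi r * x) = r * l x.
Variable p : prime_ideal R.
Variables e f : 'I_4 -> S.
Hypothesis ef : forall i j, l (e i * f j) = (i == j)%:R.

Variables (p1 p2 p3 : S) (u : R).
Hypotheses (l1 : l p1 = 0) (l2 : l p2 = 0) (l3 : l p3 = 0).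
Hypothesis up : u \notin p.
Hypothesis orth : forall z, l (z * p1) \in p -> l (z * p2) \in p ->
  l (z * p3) \in p -> exists r, vanishes l p (phi u * z - phi r).
Hypothesis indep3 : forall n1 n2 n3,
  vanishes l p (phi n1 * p1 + phi n2 * p2 + phi n3 * p3) ->
  [/\ n1 \in p, n2 \in p & n3 \in p].

Local Notation K := (residue p).
Local Notation rho := (@to_residue R p).

Definition products : seq S :=
  [:: p1 * p1; p2 * p2; p3 * p3; p1 * p2; p1 * p3; p2 * p3].

Definition products_mx : 'M[R]_(6, 4) := \matrix_(j, a) l (products`_j * e a).

(** A vector in the kernel of the transpose lifts to an element orthogonal to all six products,
    which vanishes on the fibre by [products_span]. *)
Lemma rank_products : \rank (map_mx rho products_mx) = 4.
Proof.
rewrite -mxrank_tr; apply/eqP; rewrite -[_ == _]/(row_free _) -kermx_eq0.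
apply/eqP/row_matrixP => i; rewrite row0.
have : (row i (kermx (map_mx rho products_mx)^T) *m (map_mx rho products_mx)^T = 0).
  by rewrite -row_mul mulmx_ker row0.
move: (row i _) => y y0; have [s sp [N eN]] := residue_mx y.
pose z := \sum_a phi (N 0 a) * e a.
have zprod j : l (products`_j * z) \in p.
  have [j6|j6] := ltnP j 6; last first.
    by rewrite nth_default // mul0r raddf0 prime0.
  rewrite -to_residue_eq0; apply/eqP.
  have /rowP/(_ (Ordinal j6)) := congr1 (fun v => rho s *: v) y0.
  rewrite scaler0 scalemxAl eN !mxE => <-.
  rewrite /z mulr_sumr !raddf_sum; apply: eq_bigr => a _; rewrite !mxE /=.
  by rewrite mulrCA lZ rmorphM.
have Zz : vanishes l p z.
  apply: (products_span lZ up orth indep3).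
  - exact: (zprod 0). - exact: (zprod 1). - exact: (zprod 2).
  - exact: (zprod 3). - exact: (zprod 4). - exact: (zprod 5).
apply/rowP => a; rewrite mxE; have := Zz (f a).
have -> : l (z * f a) = N 0 a.
  rewrite /z mulr_suml raddf_sum (bigD1 a) //= -mulrA lZ ef eqxx mulr1.
  rewrite big1 ?addr0 // => b ba.
  by rewrite -mulrA lZ ef (negPf ba) mulr0.
rewrite -to_residue_eq0; have /matrixP/(_ 0 a) := eN; rewrite !mxE => <-.
by rewrite mulf_eq0 to_residue_eq0 (negPf sp) => /eqP.
Qed.

(** The ten equations are the coefficients of the cubic X1 g0 + X2 g1 + X3 g2. The conics through
    the fibre form a space of dimension 6 - 4 = 2, so three of them are dependent; a transposition
    of the variables, if necessary, makes the last one a combination of the other two, as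
    [conic_syzygy_pencil] requires. *)
Lemma conic_syzygy (g : nat -> nat -> K) :
  (forall i, (i < 3)%N ->
     conic l p1 p2 p3 (g i 0) (g i 1) (g i 2) (g i 3) (g i 4) (g i 5)) ->
  g 0 0 = 0 -> g 1 1 = 0 -> g 2 2 = 0 ->
  g 0 3 + g 1 0 = 0 -> g 0 4 + g 2 0 = 0 -> g 1 3 + g 0 1 = 0 ->
  g 1 5 + g 2 1 = 0 -> g 2 4 + g 0 2 = 0 -> g 2 5 + g 1 2 = 0 ->
  g 0 5 + g 1 4 + g 2 3 = 0 ->
  forall i j, (i < 3)%N -> (j < 6)%N -> g i j = 0.
Proof.
move=> cg.
pose G : 'M[K]_(3, 6) := \matrix_(i, j) g i j.
have Gt : G *m map_mx rho products_mx = 0.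
  apply/matrixP => i a; rewrite !mxE !big_ord_recl big_ord0 !mxE /=.
  by rewrite addr0 !addrA; apply: cg.
have rG : (\rank G <= 2)%N.
  by rewrite -(leq_add2r 4) -[X in (_ + X)%N]rank_products; apply: mulmx0_rank_max.
have [al al0 alG] : exists2 al : 'rV[K]_3, al != 0 & al *m G = 0.
  have /rowV0Pn[al /sub_kermxP alG al0] : kermx G != 0.
    by rewrite kermx_eq0 /row_free; apply: contraTneq rG => ->.
  by exists al.
have dep j : (j < 6)%N ->
    al 0 0 * g 0 j + al 0 1 * g 1 j + al 0 (lift 0 (lift 0 0)) * g 2 j = 0.
  move=> j6; have /rowP/(_ (Ordinal j6)) := alG.
  rewrite !mxE !big_ord_recl big_ord0 !mxE /= addr0 addrA.
  by congr (_ * _ + _ * _ + _ = 0); congr (al 0 _); apply/val_inj.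
move=> h00 h11 h22 h1 h2 h3 h4 h5 h6 h7.
have c13 i : (i < 3)%N ->
    conic l p3 p2 p1 (g i 2) (g i 1) (g i 0) (g i 5) (g i 4) (g i 3).
  move=> i3 s; rewrite -[RHS](cg i i3 s) (mulrC p3 p2) (mulrC p3 p1) (mulrC p2 p1).
  by ring.
have c23 i : (i < 3)%N ->
    conic l p1 p3 p2 (g i 0) (g i 2) (g i 1) (g i 4) (g i 3) (g i 5).
  by move=> i3 s; rewrite -[RHS](cg i i3 s) (mulrC p3 p2); ring.
have orth13 z : l (z * p3) \in p -> l (z * p2) \in p -> l (z * p1) \in p ->
    exists r, vanishes l p (phi u * z - phi r).
  by move=> *; apply: orth.
have orth23 z : l (z * p1) \in p -> l (z * p3) \in p -> l (z * p2) \in p ->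
    exists r, vanishes l p (phi u * z - phi r).
  by move=> *; apply: orth.
have indep13 n1 n2 n3 : vanishes l p (phi n1 * p3 + phi n2 * p2 + phi n3 * p1) ->
    [/\ n1 \in p, n2 \in p & n3 \in p].
  move=> h; have [|k1 k2 k3] := @indep3 n3 n2 n1; last by split.
  by move: h; congr vanishes; ring.
have indep23 n1 n2 n3 : vanishes l p (phi n1 * p1 + phi n2 * p3 + phi n3 * p2) ->
    [/\ n1 \in p, n2 \in p & n3 \in p].
  move=> h; have [|k1 k2 k3] := @indep3 n1 n3 n2; last by split.
  by move: h; congr vanishes; ring.
have /rV0Pn[i ali] := al0; case: i ali => -[|[|[|i]]] // i3 ali.
- have {}ali : al 0 0 != 0 by move: ali; congr (al 0 _ != 0); apply: val_inj.
  have dep' j : (j < 6)%N -> g 0 j = - (al 0 (lift 0 (lift 0 0)) / al 0 0) * g 2 j +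
      - (al 0 1 / al 0 0) * g 1 j.
    by move=> j6; apply: solve_dependency => //; rewrite -[RHS](dep j j6); ring.
  have h7' : g 2 3 + g 1 4 + g 0 5 = 0 by rewrite -[RHS]h7; ring.
  have := conic_syzygy_pencil lZ l3 l2 l1 up orth13 indep13 (c13 2 isT) (c13 1 isT)
    h22 h11 h00 h6 h5 h4 h3 h2 h1 h7' (dep' 2 isT) (dep' 1 isT) (dep' 0 isT)
    (dep' 5 isT) (dep' 4 isT) (dep' 3 isT).
  move=> /= [k0 k1 k2 k3 k4 k5 k6 k7 k8 k9 k10 k11 k12 k13 k14 k15 k16 k17].
  by move=> [|[|[|i]]] [|[|[|[|[|[|j]]]]]].
- have {}ali : al 0 1 != 0 by move: ali; congr (al 0 _ != 0); apply: val_inj.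
  have dep' j : (j < 6)%N -> g 1 j = - (al 0 0 / al 0 1) * g 0 j +
      - (al 0 (lift 0 (lift 0 0)) / al 0 1) * g 2 j.
    by move=> j6; apply: solve_dependency => //; rewrite -[RHS](dep j j6); ring.
  have h7' : g 0 5 + g 2 3 + g 1 4 = 0 by rewrite -[RHS]h7; ring.
  have := conic_syzygy_pencil lZ l1 l3 l2 up orth23 indep23 (c23 0 isT) (c23 2 isT)
    h00 h22 h11 h2 h1 h5 h6 h3 h4 h7' (dep' 0 isT) (dep' 2 isT) (dep' 1 isT)
    (dep' 4 isT) (dep' 3 isT) (dep' 5 isT).
  move=> /= [k0 k1 k2 k3 k4 k5 k6 k7 k8 k9 k10 k11 k12 k13 k14 k15 k16 k17].
  by move=> [|[|[|i]]] [|[|[|[|[|[|j]]]]]].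
- have {}ali : al 0 (lift 0 (lift 0 0)) != 0.
    by move: ali; congr (al 0 _ != 0); apply: val_inj.
  have dep' j : (j < 6)%N -> g 2 j =
      - (al 0 0 / al 0 (lift 0 (lift 0 0))) * g 0 j +
      - (al 0 1 / al 0 (lift 0 (lift 0 0))) * g 1 j.
    by move=> j6; apply: solve_dependency => //; apply: dep.
  have := conic_syzygy_pencil lZ l1 l2 l3 up orth indep3 (cg 0 isT) (cg 1 isT)
    h00 h11 h22 h1 h2 h3 h4 h5 h6 h7 (dep' 0 isT) (dep' 1 isT) (dep' 2 isT)
    (dep' 3 isT) (dep' 4 isT) (dep' 5 isT).
  move=> /= [k0 k1 k2 k3 k4 k5 k6 k7 k8 k9 k10 k11 k12 k13 k14 k15 k16 k17].
  by move=> [|[|[|i]]] [|[|[|[|[|[|j]]]]]].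
Qed.

End ConicSyzygies.

Section CommutatorIdentities.
Variable P : pzRingType.
Implicit Types a b c : P.

(** These identities correspond to the monomials X_i^3, X_i^2 X_j and X1 X2 X3 of a syzygy: a linear
    form that respects them satisfies the matching coefficient equations of [conic_syzygy]. *)
Lemma comm_square a : a * (a * a) - a * a * a = 0.
Proof. by rewrite mulrA subrr. Qed.

Lemma comm_polar_l a b :
  a * (a * b + b * a) - (a * b + b * a) * a + (b * (a * a) - a * a * b) = 0.
Proof.
rewrite !(mulrDl, mulrDr) !mulrA !opprD !addrA.
by rewrite [LHS](ACl ((1*6)*(2*3)*(5*4))) /= !subrr !addr0.
Qed.

Lemma comm_polar_r a b :
  a * (b * a + a * b) - (b * a + a * b) * a + (b * (a * a) - a * a * b) = 0.
Proof. by rewrite [b * a + _]addrC comm_polar_l. Qed.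

Lemma comm_jacobi a b c :
  a * (b * c + c * b) - (b * c + c * b) * a +
  (b * (a * c + c * a) - (a * c + c * a) * b) +
  (c * (a * b + b * a) - (a * b + b * a) * c) = 0.
Proof.
rewrite !(mulrDl, mulrDr) !mulrA !opprD !addrA.
by rewrite [LHS](ACl ((1*11)*(2*7)*(6*3)*(10*4)*(5*12)*(9*8))) /= !subrr !addr0.
Qed.

End CommutatorIdentities.

(** * Local Clifford relations between the loops at R *)

Section CliffordGeneration.
Variables (R S : comPzRingType) (phi : {rmorphism R -> S}) (l : {additive S -> R}).
Hypothesis lZ : forall r x, l (phi r * x) = r * l x.
Variables e f : 'I_4 -> S.
Hypothesis eE : forall y, y = \sum_i phi (l (y * f i)) * e i.
Hypothesis fE : forall y, y = \sum_i phi (l (y * e i)) * f i.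
Hypothesis ef : forall i j, l (e i * f j) = (i == j)%:R.

Variables (P : pzRingType) (rho : {rmorphism R -> P}) (x : {additive S -> P}) (eR : P).
Hypothesis rhoC : forall r y, y * rho r = rho r * y.
Hypothesis xZ : forall r y, x (phi r * y) = rho r * x y.
Hypothesis x1 : x 1 = 0.
Hypothesis x_rel : forall s, \sum_i x (s * e i) * x (f i) = 0.
Hypotheses (eRx : forall s, eR * x s = x s) (xeR : forall s, x s * eR = x s).

Variable C : nat -> P -> Prop.
Hypothesis C_submod : forall m, @submod R (smod rho) (C m).
Hypothesis C1 : forall y, C 1 y <-> exists r, y = rho r * eR.
Hypothesis C_mulr : forall m s y, C m.+1 y -> C m.+3 (y * x s).
Hypothesis C_mull : forall m s y, C m.+1 y -> C m.+3 (x s * y).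
Hypothesis C_step : forall m y, C m.+3 y ->
  exists2 z, forall i, C m.+1 (z i) & y = \sum_i z i * x (f i).
Hypothesis C_even : forall m y, ~~ odd m -> C m y -> y = 0.

Variable p : prime_ideal R.

(** The [l (f i)] are the coordinates of 1 in the basis [e], and 1 does not vanish on the fibre. *)
Lemma unit_coordinate : exists i, l (f i) \notin p.
Proof.
apply/existsP; apply: contrapT => /negP; rewrite negb_exists => /forallP h.
have /negP := prime1N p; apply.
have <- : l (e 0 * f 0) = 1 by rewrite ef eqxx.
rewrite -[e 0 * f 0]mulr1 (eE 1) mulr_sumr raddf_sum; apply: prime_sum => i.
by rewrite /= mulrCA lZ mul1r primeMr //; have := h i; rewrite negbK.
Qed.

Section Coordinates.
Variable i0 : 'I_4.
Hypothesis i0p : l (f i0) \notin p.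
Local Notation u := (l (f i0)).

(** The dual basis vectors other than [f i0], scaled by [u] and corrected by [f i0] to become
    orthogonal to 1. They remain dual, up to [u], to the remaining [e]. *)
Definition ortho (k : 'I_3) : S :=
  phi u * f (lift i0 k) - phi (l (f (lift i0 k))) * f i0.

Lemma l_ortho k : l (ortho k) = 0.
Proof. by rewrite raddfB /= !lZ mulrC subrr. Qed.

Lemma l_ortho_e k j : l (ortho k * e (lift i0 j)) = u * (k == j)%:R.
Proof.
rewrite mulrBl raddfB /= -!mulrA !lZ [f (lift i0 k) * _]mulrC [f i0 * _]mulrC !ef.
rewrite eq_sym (inj_eq lift_inj) [lift _ _ == _]eq_sym (negPf (neq_lift _ _)).
by rewrite mulr0 subr0.
Qed.

Lemma sum_ortho z : \sum_k phi (l (z * ortho k)) * e (lift i0 k) =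
  phi u * z - phi (l (z * f i0)).
Proof.
have -> : phi u * z - phi (l (z * f i0)) =
    \sum_i phi (u * l (z * f i) - l (z * f i0) * l (f i)) * e i.
  rewrite {1}(eE z) -[phi (l (z * f i0))]mulr1 {1}(eE 1) !mulr_sumr -sumrB.
  by apply: eq_bigr => i _; rewrite rmorphB !rmorphM mul1r mulrBl !mulrA.
rewrite (bigD1_ord i0) //= [u * _]mulrC subrr rmorph0 mul0r add0r.
apply: eq_bigr => k _; congr (phi _ * _).
have -> : z * ortho k = phi u * (z * f (lift i0 k)) -
    phi (l (f (lift i0 k))) * (z * f i0) by rewrite /ortho; ring.
by rewrite raddfB /= !lZ [l (z * f i0) * _]mulrC.
Qed.

Definition xk (k : 'I_3) : P := x (e (lift i0 k)).

(** As [x] kills 1, one of the four coordinates can be eliminated once [u] is inverted. *)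
Lemma x_expand z : rho u * x z = \sum_k rho (l (z * ortho k)) * xk k.
Proof.
have -> : rho u * x z = x (phi u * z - phi (l (z * f i0))).
  by rewrite raddfB /= xZ -[phi (l _)]mulr1 xZ x1 mulr0 subr0.
by rewrite -sum_ortho raddf_sum; apply: eq_bigr => k _; rewrite /= xZ.
Qed.

(** This is [u * u] times [x_rel]: each factor is expanded by [x_expand], and [l_sum] contracts the
    dual bases. *)
Lemma xk_rel s : \sum_j \sum_k rho (l (ortho j * ortho k * s)) * (xk j * xk k) = 0.
Proof.
transitivity (rho (u * u) * \sum_i x (s * e i) * x (f i)); last by rewrite x_rel mulr0.
rewrite mulr_sumr.
transitivity (\sum_i (\sum_j rho (l (s * e i * ortho j)) * xk j) *
    (\sum_k rho (l (f i * ortho k)) * xk k)); last first.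
  apply: eq_bigr => i _; rewrite -!x_expand rmorphM.
  by rewrite -!mulrA; congr (_ * _); rewrite !mulrA rhoC.
under [RHS]eq_bigr do rewrite mulr_suml.
rewrite [RHS]exchange_big; apply: eq_bigr => j _ /=.
under [RHS]eq_bigr do rewrite mulr_sumr.
rewrite [RHS]exchange_big; apply: eq_bigr => k _ /=.
have -> : l (ortho j * ortho k * s) =
    \sum_i l (s * e i * ortho j) * l (f i * ortho k).
  have -> : ortho j * ortho k * s = s * ortho j * ortho k by ring.
  rewrite -(l_sum lZ fE); apply: eq_bigr => i _; congr (l _ * _); ring.
rewrite raddf_sum mulr_suml; apply: eq_bigr => i _ /=.
rewrite rmorphM -!mulrA; congr (_ * _).
by rewrite !mulrA rhoC.
Qed.

Lemma ortho_orth z : (forall k, l (z * ortho k) \in p) ->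
  exists r, vanishes l p (phi u * z - phi r).
Proof.
move=> h; exists (l (z * f i0)); rewrite -sum_ortho => w.
rewrite mulr_suml raddf_sum; apply: prime_sum => k.
by rewrite /= -mulrA lZ primeMr.
Qed.

Lemma ortho_indep (c : 'I_3 -> R) :
  vanishes l p (\sum_k phi (c k) * ortho k) -> forall k, c k \in p.
Proof.
move=> Z k; have := Z (e (lift i0 k)); rewrite mulr_suml raddf_sum (bigD1 k) //=.
rewrite -mulrA lZ l_ortho_e eqxx mulr1 big1 ?addr0 => [|j jk].
  by rewrite mulrC; apply: primeMI.
by rewrite -mulrA lZ l_ortho_e (negPf jk) !mulr0.
Qed.

Local Notation p1 := (ortho 0).
Local Notation p2 := (ortho 1).
Local Notation p3 := (ortho (lift 0 (lift 0 0))).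
Local Notation y1 := (xk 0).
Local Notation y2 := (xk 1).
Local Notation y3 := (xk (lift 0 (lift 0 0))).

Definition quads : seq P := [:: y1 * y1; y2 * y2; y3 * y3;
  y1 * y2 + y2 * y1; y1 * y3 + y3 * y1; y2 * y3 + y3 * y2].

Lemma sum3 (V : nmodType) (F : 'I_3 -> V) :
  \sum_k F k = F 0 + F 1 + F (lift 0 (lift 0 0)).
Proof.
rewrite !big_ord_recl big_ord0 addr0 addrA; congr (_ + F _ + _).
exact/val_inj.
Qed.

(** The coefficients of [xk_rel] are symmetric in [j] and [k], so only squares and anticommutators
    occur. *)
Lemma quads_rel s :
  \sum_(j < 6) rho (l ((products p1 p2 p3)`_j * s)) * quads`_j = 0.
Proof.
transitivity (\sum_j \sum_k rho (l (ortho j * ortho k * s)) * (xk j * xk k));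
  last exact: xk_rel.
rewrite [RHS]sum3 ![\sum_(k < 3) _]sum3 !big_ord_recl big_ord0 /= addr0.
rewrite (mulrC p2 p1) (mulrC p3 p1) (mulrC p3 p2) !mulrDr !addrA.
by rewrite [LHS](ACl (1*4*6*5*2*8*7*9*3)).
Qed.

Lemma ord3P (Q : 'I_3 -> Prop) : Q 0 -> Q 1 -> Q (lift 0 (lift 0 0)) -> forall k, Q k.
Proof.
move=> Q0 Q1 Q2 [[|[|[|k]]] k3] //.
- by move: Q0; congr Q; apply/val_inj.
- by move: Q1; congr Q; apply/val_inj.
- by move: Q2; congr Q; apply/val_inj.
Qed.

Lemma orth3 z : l (z * p1) \in p -> l (z * p2) \in p -> l (z * p3) \in p ->
  exists r, vanishes l p (phi u * z - phi r).
Proof. by move=> h1 h2 h3; apply: ortho_orth; apply: ord3P. Qed.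

Lemma indep3 n1 n2 n3 : vanishes l p (phi n1 * p1 + phi n2 * p2 + phi n3 * p3) ->
  [/\ n1 \in p, n2 \in p & n3 \in p].
Proof.
move=> Z; have := @ortho_indep (fun k => [:: n1; n2; n3]`_k); rewrite sum3 /=.
by move=> /(_ Z) h; split; [apply: (h 0)|apply: (h 1)|apply: (h (lift 0 (lift 0 0)))].
Qed.

Definition commutators : seq P :=
  [seq y * q - q * y | y <- [:: y1; y2; y3], q <- quads].

(* A locally trivial family of commutators: the linear forms killing their
   relations are syzygies between conics. *)
Lemma commutators_torsion : exists2 s, s \notin p &
  forall y q, y \in [:: y1; y2; y3] -> q \in quads -> rho s * (y * q - q * y) = 0.
Proof.
pose z (k : 'I_18) : smod rho := commutators`_k.
have rel0 (G : 'M[residue p]_18) (cs : seq R) a :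
    (forall c : 'rV[R]_18, mxcomb c z 0 = 0 -> map_mx (@to_residue R p) c *m G = 0) ->
    \sum_(k < 18) rho cs`_k * commutators`_k = 0 ->
    \sum_(k < 18) @to_residue R p cs`_k * G k a = 0.
  move=> hG h; have : mxcomb (\row_k cs`_k) z 0 = 0.
    transitivity (\sum_(k < 18) rho cs`_k * commutators`_k); last exact: h.
    rewrite smod_comb; apply: eq_bigr => k _; rewrite mxE; reflexivity.
  move/hG/rowP/(_ a); rewrite !mxE => h1; rewrite -[RHS]h1.
  by apply: eq_bigr => k _; rewrite !mxE.
(* Generation by zero elements means that a denominator outside p kills the family. A column [h] of
   [G], cut into three rows of six, is the candidate syzygy [g]. *)
have [G hG|s sp [B [D hs]]] := @nakayama R p (smod rho) 18 z 0.
  rewrite leqn0 mxrank_eq0; apply/eqP/matrixP => k a; rewrite mxE.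
  pose h (j : nat) := G (inord j) a.
  have Gh (j : 'I_18) : G j a = h j by rewrite /h inord_val.
  have rel cs : \sum_(k < 18) rho cs`_k * commutators`_k = 0 ->
      \sum_(0 <= j < 18) @to_residue R p cs`_j * h j = 0.
    move=> h0; rewrite big_mkord -[RHS](rel0 G cs a hG h0).
    by apply: eq_bigr => j _; rewrite Gh.
  have sumE (cs : seq R) : \sum_(k < 18) rho cs`_k * commutators`_k =
      \sum_(0 <= j < 18) rho cs`_j * commutators`_j by rewrite big_mkord.
  pose g i j := h (6 * i + j)%N.
    have ucomb (c : nat -> nat) :
        \sum_(0 <= j < 18) (c j)%:R * commutators`_j = 0 ->
        \sum_(0 <= j < 18) (c j)%:R * h j = 0.
      have nthE j : (0 <= j < 18)%N -> (mkseq (fun i => (c i)%:R : R) 18)`_j = (c j)%:R.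
        by move=> j18; rewrite nth_mkseq.
      move=> h0; rewrite -[RHS](rel (mkseq (fun i => (c i)%:R) 18)).
        by apply: eq_big_nat => j /nthE ->; rewrite rmorph_nat.
      by rewrite sumE -[RHS]h0; apply: eq_big_nat => j /nthE ->; rewrite rmorph_nat.
    have sumc (V : pzRingType) (F : nat -> V) i : (i < 18)%N ->
        \sum_(0 <= j < 18) (j == i)%:R * F j = F i.
      move=> i18; rewrite (bigD1_seq i) ?mem_index_iota ?iota_uniq //= eqxx mul1r.
      by rewrite big1 ?addr0 // => j /negPf ->; rewrite mul0r.
    have sumD (V : pzRingType) (F : nat -> V) (c d : nat -> nat) :
        \sum_(0 <= j < 18) (c j + d j)%:R * F j =
        \sum_(0 <= j < 18) (c j)%:R * F j + \sum_(0 <= j < 18) (d j)%:R * F j.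
      by rewrite -big_split; apply: eq_bigr => j _; rewrite natrD mulrDl.
    have uc1 i : (i < 18)%N -> commutators`_i = 0 -> h i = 0.
      by move=> i18 c0; have := ucomb (fun j => j == i); rewrite !sumc //; apply.
    have uc2 i j : (i < 18)%N -> (j < 18)%N ->
        commutators`_i + commutators`_j = 0 -> h i + h j = 0.
      move=> i18 j18 c0; have := ucomb (fun k => (k == i) + (k == j))%N.
      by rewrite !sumD !sumc //; apply.
    have uc3 i j k0 : (i < 18)%N -> (j < 18)%N -> (k0 < 18)%N ->
        commutators`_i + commutators`_j + commutators`_k0 = 0 -> h i + h j + h k0 = 0.
      move=> i18 j18 k18 c0; have := ucomb (fun k => (k == i) + (k == j) + (k == k0))%N.
      by rewrite !sumD !sumc //; apply.
    (* The commutator of [y] with a relation between the [quads] is a relation between commutators;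
       hence each row of [g] is a conic through the fibre. *)
    have qcomm y t : \sum_(0 <= j < 6) rho (l ((products p1 p2 p3)`_j * t)) *
        (y * quads`_j - quads`_j * y) = 0.
      rewrite big_mkord; have qr := quads_rel t.
      transitivity (y * (\sum_(j < 6) rho (l ((products p1 p2 p3)`_j * t)) * quads`_j) -
        (\sum_(j < 6) rho (l ((products p1 p2 p3)`_j * t)) * quads`_j) * y).
        rewrite mulr_sumr mulr_suml -sumrB; apply: eq_bigr => j _.
        by rewrite mulrBr !mulrA rhoC.
      by rewrite qr mulr0 mul0r subrr.
    have gk : g (k %/ 6)%N (k %% 6)%N = 0.
      apply: (conic_syzygy lZ ef (l_ortho _) (l_ortho _) (l_ortho _) i0p orth3 indep3
        (g := g)); rewrite ?ltn_pmod ?ltn_divLR // /g /=.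
      + move=> i i3 t.
        have := rel (nseq (6 * i) 0 ++ [seq l (q * t) | q <- products p1 p2 p3]).
        rewrite sumE; case: i i3 => [|[|[|i]]] // _ h1.
        * move: (qcomm y1 t) h1; rewrite unlock /= => q0.
          rewrite !rmorph0 !mul0r !addr0 in q0 *.
          by move=> /(_ q0) <-; rewrite ![h _ * _]mulrC !addrA.
        * move: (qcomm y2 t) h1; rewrite unlock /= => q0.
          rewrite !rmorph0 !mul0r !add0r !addr0 in q0 *.
          by move=> /(_ q0) <-; rewrite ![h _ * _]mulrC !addrA.
        * move: (qcomm y3 t) h1; rewrite unlock /= => q0.
          rewrite !rmorph0 !mul0r !add0r !addr0 in q0 *.
          by move=> /(_ q0) <-; rewrite ![h _ * _]mulrC !addrA.
      (* The commutator of the generator i with the quadratic element j has position 6 i + j. *)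
      + apply: (uc1 0%N) => //; exact: comm_square.
      + apply: (uc1 7%N) => //; exact: comm_square.
      + apply: (uc1 14%N) => //; exact: comm_square.
      + apply: (uc2 3%N 6%N) => //; exact: comm_polar_l.
      + apply: (uc2 4%N 12%N) => //; exact: comm_polar_l.
      + rewrite addrC; apply: (uc2 1%N 9%N) => //; rewrite addrC; exact: comm_polar_r.
      + apply: (uc2 11%N 13%N) => //; exact: comm_polar_l.
      + rewrite addrC; apply: (uc2 2%N 16%N) => //; rewrite addrC; exact: comm_polar_r.
      + rewrite addrC; apply: (uc2 8%N 17%N) => //; rewrite addrC; exact: comm_polar_r.
      + apply: (uc3 5%N 10%N 15%N) => //; exact: comm_jacobi.
    by rewrite -gk /g [(6 * _)%N]mulnC -divn_eq -Gh.
exists s => // y q yy qq.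
set w := y * q - q * y; have cq : w \in commutators by apply/allpairsP; exists (y, q).
have i18 : (index w commutators < 18)%N by rewrite -[18%N]/(size commutators) index_mem.
have := hs (Ordinal i18); rewrite /mxcomb [RHS]big_ord0 /z /= nth_index // => <-.
Qed.

(** The relations [quads_rel] for [s = e a] reduce to a matrix of rank 4, which leaves linear forms
    of rank at most 6 - 4 = 2. *)
Lemma quads_pencil : exists2 s, s \notin p & exists a : 'I_2 -> P,
  (forall i, exists b : 'I_6 -> R, a i = \sum_j rho (b j) * quads`_j) /\
  forall j : 'I_6, exists d : 'I_2 -> R, rho s * quads`_j = \sum_i rho (d i) * a i.
Proof.
pose z (j : 'I_6) : smod rho := quads`_j.
have [G hG|s sp [B [D hs]]] := @nakayama R p (smod rho) 6 z 2.
  rewrite -(leq_add2l 4) -[X in (X + _)%N](rank_products lZ ef i0p orth3 indep3).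
  rewrite -mxrank_tr; apply: mulmx0_rank_max.
  apply/matrixP => a k; rewrite !mxE.
  have : mxcomb (\row_j l ((products p1 p2 p3)`_j * e a)) z 0 = 0.
    rewrite smod_comb -[RHS](quads_rel (e a)); apply: eq_bigr => j _.
    by rewrite mxE; reflexivity.
  move=> /hG/rowP/(_ k); rewrite !mxE => h; rewrite -[RHS]h.
  by apply: eq_bigr => j _; rewrite !mxE.
exists s => //; exists (mxcomb B z); split=> [i|j].
  by exists (B i).
exists (D j); exact: hs.
Qed.

(** [P] may have torsion, so commutation at p is only known after multiplication by a denominator,
    until the generators are rescaled. *)
Definition comm_up_to (s : R) (a b : P) : Prop := rho s * (a * b) = rho s * (b * a).

Lemma rho_swap r s w : rho s * (rho r * w) = rho r * (rho s * w).
Proof. by rewrite !mulrA rhoC. Qed.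

Lemma mul_rho a r w : a * (rho r * w) = rho r * (a * w).
Proof. by rewrite !mulrA rhoC. Qed.

Lemma comm_up_toM s a b b' : comm_up_to s a b -> comm_up_to s a b' ->
  comm_up_to s a (b * b').
Proof.
rewrite /comm_up_to => h h'; transitivity (rho s * (b * a) * b').
  by rewrite -h !mulrA.
by rewrite -!mulrA -mul_rho h' mul_rho !mulrA.
Qed.

Lemma comm_up_toD s a b b' : comm_up_to s a b -> comm_up_to s a b' ->
  comm_up_to s a (b + b').
Proof. by rewrite /comm_up_to !(mulrDl, mulrDr) => -> ->. Qed.

Lemma comm_up_to_sum s a (I : finType) (r : I -> R) (b : I -> P) :
  (forall i, comm_up_to s a (b i)) -> comm_up_to s a (\sum_i rho (r i) * b i).
Proof.
rewrite /comm_up_to => h; rewrite !(mulr_sumr, mulr_suml); apply: eq_bigr => i _.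
by rewrite (mul_rho a) -[rho (r i) * _ * a]mulrA !(rho_swap (r i) s) h.
Qed.

Lemma quad_ind (Q : P -> Prop) :
  (forall y y', y \in [:: y1; y2; y3] -> y' \in [:: y1; y2; y3] -> Q (y * y')) ->
  (forall a b, Q a -> Q b -> Q (a + b)) -> forall q, q \in quads -> Q q.
Proof.
move=> QM QD q; rewrite !inE => /orP[/eqP ->|/orP[/eqP ->|/or4P[]/eqP ->]].
all: by [apply: QM; rewrite !inE eqxx ?orbT|
  apply: QD; apply: QM; rewrite !inE eqxx ?orbT].
Qed.

Lemma C0 m : C m 0. Proof. by case: (C_submod m). Qed.

Lemma CD m a b : C m a -> C m b -> C m (a + b).
Proof. exact: (submodD (V := smod rho) (C_submod m)). Qed.

Lemma CZ m r a : C m a -> C m (rho r * a).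
Proof. exact: (submodZ (V := smod rho) r (C_submod m)). Qed.

Lemma C_eR : C 1 eR.
Proof. by apply/C1; exists 1; rewrite rmorph1 mul1r. Qed.

Lemma C_x s : C 3 (x s).
Proof. by rewrite -eRx; apply: C_mulr; apply: C_eR. Qed.

Lemma C_quads_mull m q y : q \in quads -> C m.+1 y -> C m.+1.+4 (q * y).
Proof.
move=> qq Cy; move: q qq; apply: quad_ind => [a b|a b ha hb]; last first.
  by rewrite mulrDl; apply: CD.
by rewrite !inE => /or3P[]/eqP-> /or3P[]/eqP->; rewrite -mulrA;
  exact: (C_mull (m := m.+2) _ (C_mull _ Cy)).
Qed.

Lemma quads_eR q : q \in quads -> q * eR = q.
Proof.
move: q; apply: quad_ind => [a b _|a b ha hb]; last by rewrite mulrDl ha hb.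
by rewrite !inE -mulrA => /or3P[]/eqP ->; rewrite /xk xeR.
Qed.

Lemma locally_gen_clifford k :
  @locally_gen R p (smod rho) (C k.*2.+1) k.*2.+1.
Proof.
have [s1 s1p comm] := commutators_torsion.
have [s2 s2p [a [aE qE]]] := quads_pencil.
(* Rescaling all generators by [sg] turns relations that hold up to [s1] or [s2] into exact ones.
   The existential keeps [sg] opaque. *)
have [sg sgE] : exists sg, sg = s1 * s2 by exists (s1 * s2).
pose x1' := rho sg * y1; pose x2' := rho sg * y2; pose x3' := rho sg * y3.
pose c1' := rho sg * a 0; pose c2' := rho sg * a 1.
have quadP j : (j < 6)%N -> quads`_j \in quads by move=> j6; apply: mem_nth.
have comm_ya y i : y \in [:: y1; y2; y3] -> comm_up_to s1 y (a i).
  move=> yy; have [b ->] := aE i; apply: comm_up_to_sum => j.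
  by apply/subr0_eq; rewrite -mulrBr; apply: comm => //; apply: quadP.
have comm_aa i i' : comm_up_to s1 (a i) (a i').
  have [b ->] := aE i'; apply: comm_up_to_sum => j.
  have := quadP _ (ltn_ord j); move: (quads`_j); apply: quad_ind => [y y' yy yy'|*].
    by apply: comm_up_toM; apply/esym/comm_ya.
  exact: comm_up_toD.
have scaled b b' : comm_up_to s1 b b' ->
    rho sg * b * (rho sg * b') = rho sg * b' * (rho sg * b).
  move=> h; rewrite -[LHS]mulrA -[RHS]mulrA !mul_rho sgE rmorphM -!mulrA.
  by congr (_ * _); congr (_ * _); rewrite !(rho_swap s2 s1) h.
have c_eR i : rho sg * a i * eR = rho sg * a i.
  rewrite -mulrA; congr (_ * _); have [b ->] := aE i; rewrite mulr_suml.
  by apply: eq_bigr => j _; rewrite -mulrA quads_eR // quadP.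
have Cc m i y : C m.+1 y -> C m.+1.+4 (rho sg * a i * y).
  move=> Cy; rewrite -mulrA; apply: CZ; have [b ->] := aE i; rewrite mulr_suml.
  apply: (submod_sum (V := smod rho)) => // j; rewrite -mulrA; apply: CZ.
  by apply: C_quads_mull => //; apply: quadP.
(* Of the two factors [sg], one supplies the [s2] needed to express the element through [a], the
   other is absorbed into [c1'] and [c2']. *)
have q_pencil j : (j < 6)%N -> pencil rho c1' c2' (rho sg * (rho sg * quads`_j)).
  move=> j6; have [d dE] := qE (Ordinal j6).
  exists (s1 * d 0), (s1 * d 1).
  transitivity (rho sg * (rho s1 * (rho s2 * quads`_j))).
    by congr (_ * _); rewrite mulrA -rmorphM -sgE.
  have e1 : lift 0 0 = 1 :> 'I_2 by apply/val_inj.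
  rewrite dE !big_ord_recl big_ord0 addr0 e1 !mulrDr /c1' /c2'.
  rewrite !(rmorphM rho s1) -!mulrA.
  by rewrite !(mul_rho (rho sg)).
have y1P : y1 \in [:: y1; y2; y3] by rewrite !inE eqxx.
have y2P : y2 \in [:: y1; y2; y3] by rewrite !inE eqxx orbT.
have y3P : y3 \in [:: y1; y2; y3] by rewrite !inE eqxx !orbT.
have eRy i : eR * (rho sg * xk i) = rho sg * xk i by rewrite mul_rho eRx.
have cx i : forall y, y = x1' \/ y = x2' \/ y = x3' ->
    y * (rho sg * a i) = rho sg * a i * y.
  by move=> y [|[|]] ->; apply: scaled; apply: comm_ya.
have sqP b b' : rho sg * b * (rho sg * b') = rho sg * (rho sg * (b * b')).
  by rewrite -mulrA mul_rho.
have sqD b b' : rho sg * b * (rho sg * b') + rho sg * b' * (rho sg * b) =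
    rho sg * (rho sg * (b * b' + b' * b)).
  by rewrite !sqP !mulrDr.
have pen11 : pencil rho c1' c2' (x1' * x1') by rewrite sqP; apply: (q_pencil 0%N).
have pen22 : pencil rho c1' c2' (x2' * x2') by rewrite sqP; apply: (q_pencil 1%N).
have pen33 : pencil rho c1' c2' (x3' * x3') by rewrite sqP; apply: (q_pencil 2%N).
have pen12 : pencil rho c1' c2' (x1' * x2' + x2' * x1').
  by rewrite sqD; apply: (q_pencil 3%N).
have pen13 : pencil rho c1' c2' (x1' * x3' + x3' * x1').
  by rewrite sqD; apply: (q_pencil 4%N).
have pen23 : pencil rho c1' c2' (x2' * x3' + x3' * x2').
  by rewrite sqD; apply: (q_pencil 5%N).
pose W := words x1' x2' x3' c1' c2' eR.
have Wmulr j y i : span rho (fun z => z \in W j) y ->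
    span rho (fun z => z \in W j.+1) (y * (rho sg * xk i)).
  move=> Wy; apply: (words_mulr rhoC (eRy _) (eRy _) (eRy _) (c_eR 0) (c_eR 1)
    (scaled _ _ (comm_aa _ _)) (cx 0) (cx 1) pen11 pen22 pen33 pen12 pen13 pen23 Wy).
  by move: i; apply: ord3P; [left|right; left|right; right].
(* Each loop costs a factor [sg * u]: [u] expands [x (f i)] in the three generators, and [sg]
   replaces these by the rescaled ones. *)
have CW j y : C j.*2.+1 y -> span rho (fun z => z \in W j) (rho ((sg * u) ^+ j) * y).
  elim: j y => [|j IH] y Cy.
    have [r ->] := (C1 y).1 Cy; apply: spanZ; apply: spanZ; apply: span_gen.
    by rewrite /W /= inE.
  have [z Cz ->] := C_step Cy; rewrite mulr_sumr; apply: span_sum => i.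
  rewrite exprSr rmorphM -mulrA -(mul_rho _ (sg * u)) rmorphM.
  rewrite -[rho sg * _ * _]mulrA x_expand.
  rewrite !mulr_sumr; apply: span_sum => i'.
  rewrite (mul_rho (rho sg)) (mul_rho (z i)) rho_swap [_ * (z i * _)]mulrA.
  by apply: spanZ; apply: Wmulr; apply: IH.
have WC j z : z \in W j -> C j.*2.+1 z.
  have Cx s : C 3 (rho sg * x s) by apply/CZ/C_x.
  have Cxr m y s : C m.+1 y -> C m.+3 (y * (rho sg * x s)).
    by move=> Cy; rewrite mul_rho; apply/CZ/C_mulr.
  move=> /(words_monomial (c_eR 1)); elim=> {j z} //.
  - exact: C_eR.
  - exact: Cx.
  - exact: Cx.
  - exact: Cx.
  - exact/(Cxr 2)/Cx.
  - exact/(Cxr 2)/Cx.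
  - exact/(Cxr 2)/Cx.
  - exact/(Cxr 4)/(Cxr 2)/Cx.
  - by move=> j y _ Cy; apply: Cc.
  - by move=> j y _ Cy; apply: Cc.
exists (fun i => (W k)`_i), ((sg * u) ^+ k); split.
- elim: k => [|k IH]; first by rewrite expr0 prime1N.
  by rewrite exprS primeMN ?IH ?primeMN ?sgE ?primeMN.
- by move=> i; apply: WC; apply: mem_nth; rewrite size_words.
- move=> y /CW/span_seq; rewrite size_words => -[c cE]; exists c; exact: cE.
Qed.

Lemma locally_gen_C m : @locally_gen R p (smod rho) (C m) (corner_rank false false m).
Proof.
have [om|em] := boolP (odd m).
  have -> : corner_rank false false m = m by rewrite /corner_rank om !mul1n.
  by rewrite -(odd_double_half m) om; apply: locally_gen_clifford.
have -> : corner_rank false false m = 0%N by rewrite /corner_rank (negPf em).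
apply: locally_free_gen; apply: locally_free0; first exact: C0.
by move=> v; apply: C_even.
Qed.

End Coordinates.
End CliffordGeneration.

(** * Ranks of the homogeneous parts *)

Section PreprojectiveCorners.
Variables (R S : comPzRingType) (phi : {rmorphism R -> S}).
Variables (e f : 'I_4 -> S) (l : {additive S -> R}).
Hypothesis lZ : forall r x, l (phi r * x) = r * l x.
Hypothesis eE : forall y, y = \sum_i phi (l (y * f i)) * e i.
Hypothesis fE : forall y, y = \sum_i phi (l (y * e i)) * f i.
Hypothesis ef : forall i j, l (e i * f j) = (i == j)%:R.

Local Notation A := (R * S)%type.

Variables (P : pzRingType) (sc : {rmorphism A -> P}) (M N : {additive S -> P}).
Hypothesis scM : forall a m, sc a * M m = M (phi a.1 * m).
Hypothesis Msc : forall a m, M m * sc a = M (m * a.2).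
Hypothesis scN : forall a m, sc a * N m = N (a.2 * m).
Hypothesis Nsc : forall a m, N m * sc a = N (m * phi a.1).
Hypothesis M1N1 : M 1 * N 1 = 0.
Hypothesis sumNM : \sum_i N (e i) * M (f i) = 0.

Hypothesis P_ind : forall Q : P -> Prop,
  (forall a, Q (sc a)) -> (forall m, Q (M m)) -> (forall m, Q (N m)) ->
  (forall x y, Q x -> Q y -> Q (x + y)) -> (forall x, Q x -> Q (- x)) ->
  (forall x y, Q x -> Q y -> Q (x * y)) -> forall x, Q x.

Hypothesis P_lift : forall (Q : pzRingType) (al : {rmorphism A -> Q})
    (bM bN : S -> Q),
  {morph bM : x y / x + y} -> {morph bN : x y / x + y} ->
  (forall a m, bM (phi a.1 * m) = al a * bM m) ->
  (forall a m, bM (m * a.2) = bM m * al a) ->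
  (forall a m, bN (a.2 * m) = al a * bN m) ->
  (forall a m, bN (m * phi a.1) = bN m * al a) ->
  bM 1 * bN 1 = 0 -> \sum_i bN (e i) * bM (f i) = 0 ->
  exists h : {rmorphism P -> Q}, [/\ forall a, h (sc a) = al a,
    forall m, h (M m) = bM m & forall m, h (N m) = bN m].

Hypothesis ker_N1 : forall x,
  x * sc (0, 1) = x -> x * N 1 = 0 -> exists v, x = v * M 1.
Hypothesis ker_M : forall z : 'I_4 -> P,
  (forall i, z i * sc (1, 0) = z i) -> \sum_i z i * M (f i) = 0 ->
  exists v, forall i, z i = v * N (e i).

Variable D : nat -> P -> Prop.
Hypothesis DB : forall d x y, D d x -> D d y -> D d (x - y).
Hypothesis D0 : forall x, D 0 x <-> exists a, x = sc a.
Hypothesis DM : forall d x m, D d x -> D d.+1 (x * M m).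
Hypothesis DN : forall d x m, D d x -> D d.+1 (x * N m).
Hypothesis scD : forall d a x, D d x -> D d (sc a * x).
Hypothesis D_ind : forall d (Q : P -> Prop), Q 0 ->
  (forall x y, Q x -> Q y -> Q (x - y)) ->
  (forall y m, D d y -> Q (y * M m)) -> (forall y m, D d y -> Q (y * N m)) ->
  forall x, D d.+1 x -> Q x.

Variable rho : {rmorphism R -> P}.
Hypothesis rhoE : forall r, rho r = sc (r, phi r).
Hypothesis rhoC : forall r x, x * rho r = rho r * x.
Variable p : prime_ideal R.
Local Notation C := (corner sc D).
Local Notation V := (smod rho).

Definition loop (s : S) : P := M s * N 1.
Fact loop_zmod : zmod_morphism loop.
Proof. by move=> s t; rewrite /loop raddfB mulrBl. Qed.
HB.instance Definition _ := GRing.isZmodMorphism.Build S P loop loop_zmod.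

Lemma corner_submod a b m : @submod R V (C a b m).
Proof.
split=> [|r x y Cx Cy]; first exact: (corner0 D0 DM).
apply: (cornerD DB D0 DM) => //; rewrite smodE rhoE.
by apply: corner_rho => // r' x'; rewrite -rhoE.
Qed.

Lemma M_mulN s t : M (s * t) * N 1 = M s * N t.
Proof. by have -> : N t = sc (0, t) * N 1; [rewrite scN mulr1|rewrite mulrA Msc]. Qed.

Lemma loop_rel s : \sum_i loop (s * e i) * loop (f i) = 0.
Proof.
transitivity (M s * (\sum_i N (e i) * M (f i)) * N 1).
  by rewrite mulr_sumr mulr_suml; apply: eq_bigr => i _; rewrite /loop M_mulN !mulrA.
by rewrite sumNM mulr0 mul0r.
Qed.

Lemma rho_sc0 r s : sc (0, phi r * s) = rho r * sc (0, s).
Proof. by rewrite rhoE -rmorphM; congr (sc _); congr pair; rewrite mulr0. Qed.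

Lemma sc0_sum (I : finType) (F : I -> S) :
  sc (0, \sum_i F i) = \sum_i sc (0, F i).
Proof.
apply: (big_morph (fun s => sc (0, s))) => [s t|]; last exact: rmorph0.
by rewrite -rmorphD; congr (sc _); congr pair; rewrite addr0.
Qed.

Lemma free1 a b : locally_free p (C a b 1 : V -> Prop) (corner_rank a b 1).
Proof.
have odd0 : a (+) b -> forall x, C a b 1 x -> x = 0.
  move=> ab x Cx; apply: (corner_odd fE scM Msc scN Nsc DB D0 DM DN scD D_ind Cx).
  by rewrite ab.
have C0 : C a b 1 0 by apply: (corner0 D0 DM).
have [e1|e1] := boolP (a (+) b).
  have -> : corner_rank a b 1 = 0%N by rewrite /corner_rank e1.
  by apply: locally_free0 => //; apply: odd0.
have {e1 odd0} : a = b by case: (a) (b) e1 => [] [].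
move=> ab; rewrite -ab in C0 *; case: a C0 {ab} => C0.
  have -> : corner_rank true true 1 = 4 by [].
  exists (fun i => sc (0, f i)), 1; split.
    split=> [|i|v /(corner_sc_true D0)[s ->]]; first exact: prime1N.
      by apply/(corner_sc_true D0); exists (f i).
    exists (\row_i l (s * e i)); rewrite scale1r smod_comb.
    rewrite {1}(fE s) sc0_sum; apply: eq_bigr => i _; rewrite mxE -rho_sc0.
    by [].
  move=> c c0; rewrite scale1r; apply/rowP => j; rewrite !mxE.
  have : sc (0, \sum_i phi (c 0 i) * f i) = 0.
    by rewrite sc0_sum -[RHS]c0 smod_comb; apply: eq_bigr => i _; rewrite -rho_sc0.
  move=> /(sc_inj P_lift)[] /(congr1 (fun s => l (e j * s))).
  rewrite mulr0 raddf0 => <-; rewrite mulr_sumr raddf_sum (bigD1 j) //=.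
  rewrite mulrCA lZ ef eqxx mulr1 big1 ?addr0 // => i ij.
  by rewrite mulrCA lZ ef eq_sym (negPf ij) mulr0.
have -> : corner_rank false false 1 = 1%N by [].
exists (fun=> sc (1, 0)), 1; split.
  split=> [|i|v /(corner_sc_false D0)[r ->]]; first exact: prime1N.
    by apply/(corner_sc_false D0); exists 1.
  exists (const_mx r); rewrite scale1r smod_comb big_ord1 mxE rhoE -rmorphM.
  by congr (sc _); congr pair; rewrite /= ?mulr1 ?mulr0.
move=> c; rewrite smod_comb big_ord1 rhoE -rmorphM => /(sc_inj P_lift)[c0 _].
by apply/rowP => j; rewrite ord1 !mxE mul1r -c0 mulr1.
Qed.

Lemma gen_loop m :
  locally_gen p (C false false m : V -> Prop) (corner_rank false false m).
Proof.
have [i0 i0p] := unit_coordinate lZ eE ef p.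
apply: (@locally_gen_C R S phi l lZ e f eE fE ef P rho loop (sc (1, 0))
  rhoC _ M1N1 loop_rel _ _ (C false false) (corner_submod false false)
  _ _ _ _ _ p i0 i0p).
- by move=> r y; rewrite /= /loop rhoE mulrA scM.
- by move=> s; rewrite /= /loop mulrA scM rmorph1 mul1r.
- by move=> s; rewrite /= /loop -mulrA Nsc rmorph1 mulr1.
- move=> y; split=> [/(corner_sc_false D0)|] [r ->];
    [exists r|apply/(corner_sc_false D0); exists r].
    by rewrite rhoE -rmorphM; congr (sc _); congr pair; rewrite /= ?mulr1 ?mulr0.
  by rewrite rhoE -rmorphM; congr (sc _); congr pair; rewrite /= ?mulr1 ?mulr0.
- move=> k s y Cy; rewrite /= /loop mulrA; apply: (corner_N Nsc D0 DM DN).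
  exact: (corner_M Msc D0 DM).
- move=> k s y [Dy ey ye]; split.
  + apply: (D_mul Msc Nsc DB D0 DM DN D_ind (d := 2)) Dy.
    by rewrite /= /loop -[M s]mul1r; apply/DN/DM/D0; exists 1; rewrite rmorph1.
  + by rewrite /= /loop !mulrA scM rmorph1 mul1r.
  + by rewrite -mulrA ye.
- move=> k y /(corner_N_surj Msc scN Nsc DB D0 DM DN scD D_ind)[z Cz <-].
  have [w Cw <-] := corner_M_surj fE scM Msc Nsc DB D0 DM DN scD D_ind Cz.
  exists w => //; rewrite mulr_suml; apply: eq_bigr => i _.
  by rewrite /= /loop mulrA.
- move=> k y ok Cy; apply: (corner_odd fE scM Msc scN Nsc DB D0 DM DN scD D_ind Cy).
  exact: negPf.
Qed.

Lemma free_corner a b m : locally_free p (C a b m : V -> Prop) (corner_rank a b m).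
Proof.
apply: (free_all rhoC corner_submod _ _ _ _ _ _ _ _ _ _ free1 gen_loop
  (M1 := M 1) (N1 := N 1) (Ne := fun i => N (e i)) (Mf := fun i => M (f i))) => //.
- by move=> a' k x; apply: (corner_M Msc D0 DM).
- by move=> a' k x; apply: (corner_N Nsc D0 DM DN).
- by move=> a' k x i; apply: (corner_M Msc D0 DM).
- by move=> a' k x i; apply: (corner_N Nsc D0 DM DN).
- exact: (corner_N_surj Msc scN Nsc DB D0 DM DN scD D_ind).
- exact: (corner_M_surj fE scM Msc Nsc DB D0 DM DN scD D_ind).
- exact: (corner_N_ker scM Msc scN Nsc M1N1 sumNM P_ind P_lift ker_N1
    DB D0 DM DN scD D_ind).
- exact: (corner_M_ker scM Msc scN Nsc M1N1 sumNM P_ind P_lift ker_M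
    DB D0 DM DN scD D_ind).
- exact: (corner_left eE scM Msc scN Nsc M1N1 sumNM P_ind P_lift ker_N1
    DB D0 DM DN scD D_ind).
Qed.

(** With m = d + 1, even degrees consist of the corners RR and SS of ranks m and 4 m, odd degrees of
    RS and SR of rank 2 m each. *)
Lemma free_degree d :
  locally_free p (D d : V -> Prop) (if odd d then 4 * d.+1 else 5 * d.+1)%N.
Proof.
have -> : (if odd d then 4 * d.+1 else 5 * d.+1)%N =
    (corner_rank false (odd d) d.+1 + corner_rank true (~~ odd d) d.+1)%N.
  by rewrite /corner_rank /=; case: (odd d) => /=; lia.
apply: (@locally_free_add R p V (D d) (C false (odd d) d.+1) (C true (~~ odd d) d.+1)).
- exact: (D_decomposition fE scM Msc scN Nsc DB D0 DM DN scD D_ind).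
- exact: corner_submod.
- exact: corner_submod.
- exact: corner_direct.
- exact: free_corner.
- exact: free_corner.
Qed.

End PreprojectiveCorners.

(** * Degrees in the tensor algebra and the passage to the concrete algebra *)

Section TensorDegree.
Variables (A : pzRingType) (B : bimodule A).
Implicit Type t : tens B.

Lemma tens_degSr d t (v : B) : tens_deg d t -> tens_deg d.+1 (t * tens_vec v).
Proof.
elim=> [a u|s s' _ ds _ ds']; last by rewrite mulrBl; apply: tens_degB.
pose w (i : 'I_d.+1) := if unlift ord_max i is Some j then u j else v.
have := tens_deg_pure a w; rewrite big_ord_recr /= /w unlift_none mulrA.
congr (tens_deg _ (_ * _ * _)); apply: eq_bigr => i _; congr tens_vec.
rewrite (_ : widen_ord _ i = lift ord_max i) ?liftK //.
by apply/val_inj; rewrite /= /bump leqNgt ltn_ord.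
Qed.

Lemma tens_deg0E t : tens_deg 0 t -> exists a, t = tens_scal B a.
Proof.
elim=> [a u|s s' _ [a ->] _ [a' ->]]; first by exists a; rewrite big_ord0 mulr1.
by exists (a - a'); apply/eqP; rewrite subr_eq -tens_scalD subrK.
Qed.

Lemma tens_degS_ind d (Q : tens B -> Prop) :
  (forall s s', Q s -> Q s' -> Q (s - s')) ->
  (forall s v, tens_deg d s -> Q (s * tens_vec v)) ->
  forall t, tens_deg d.+1 t -> Q t.
Proof.
move=> QB QV t; elim=> [a u|s s' _ Qs _ Qs']; last exact: QB.
by rewrite big_ord_recr mulrA; apply: QV; apply: tens_deg_pure.
Qed.

End TensorDegree.

Section ScalarMorphism.
Variables (R S : comPzRingType) (phi : {rmorphism R -> S}).
Variables (n : nat) (e f : 'I_n -> S).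
Local Notation P := (preproj phi e f).
Local Notation pr := (@preproj_of R S phi n e f).

Definition preproj_rho (r : R) : P := scal phi e f (r, phi r).

Fact preproj_rho_zmod : zmod_morphism preproj_rho.
Proof.
move=> r s; rewrite /preproj_rho -raddfB; congr scal.
by congr pair; rewrite rmorphB.
Qed.
HB.instance Definition _ :=
  GRing.isZmodMorphism.Build R P preproj_rho preproj_rho_zmod.

Fact preproj_rho_monoid : monoid_morphism preproj_rho.
Proof.
split=> [|r s]; rewrite /preproj_rho.
  by rewrite -[RHS](rmorph1 (scal phi e f)); congr scal; congr pair; rewrite rmorph1.
by rewrite -rmorphM; congr scal; congr pair; rewrite rmorphM.
Qed.
HB.instance Definition _ :=
  GRing.isMonoidMorphism.Build R P preproj_rho preproj_rho_monoid.

Definition in_degree (d : nat) (x : P) : Prop := x \in @preproj_deg R S phi n e f d.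

Lemma in_degreeP d x : in_degree d x <-> exists2 t, tens_deg d t & x = pr t.
Proof. by split=> [/asboolP|h] //; apply/asboolP. Qed.

Lemma in_degreeB d x y : in_degree d x -> in_degree d y -> in_degree d (x - y).
Proof.
move=> /in_degreeP[s ds ->] /in_degreeP[t dt ->]; apply/in_degreeP.
by exists (s - t); rewrite ?rmorphB //; apply: tens_degB.
Qed.

Lemma in_degree_scal d a x : in_degree d x -> in_degree d (scal phi e f a * x).
Proof.
move=> /in_degreeP[t dt ->]; apply/in_degreeP; exists (tens_scal _ a * t).
  exact: tens_deg_scal.
by rewrite [RHS]rmorphM.
Qed.

Lemma in_degree0 x : in_degree 0 x <-> exists a, x = scal phi e f a.
Proof.
split=> [/in_degreeP[t /tens_deg0E[a ->] ->]|[a ->]]; first by exists a.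
apply/in_degreeP; exists (tens_scal _ a) => //.
have := @tens_deg_pure _ (bim_sum (bimM phi) (bimN phi)) 0 a (fun=> 0).
by rewrite big_ord0 mulr1.
Qed.

Lemma in_degree_gM d x m : in_degree d x -> in_degree d.+1 (x * gM phi e f m).
Proof.
move=> /in_degreeP[t dt ->]; apply/in_degreeP; exists (t * inM phi m).
  exact: tens_degSr.
by rewrite [RHS]rmorphM.
Qed.

Lemma in_degree_gN d x m : in_degree d x -> in_degree d.+1 (x * gN phi e f m).
Proof.
move=> /in_degreeP[t dt ->]; apply/in_degreeP; exists (t * inN phi m).
  exact: tens_degSr.
by rewrite [RHS]rmorphM.
Qed.

Lemma in_degreeS_ind d (Q : P -> Prop) : Q 0 ->
  (forall x y, Q x -> Q y -> Q (x - y)) ->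
  (forall y m, in_degree d y -> Q (y * gM phi e f m)) ->
  (forall y m, in_degree d y -> Q (y * gN phi e f m)) ->
  forall x, in_degree d.+1 x -> Q x.
Proof.
move=> Q0 QB QM QN x /in_degreeP[t dt ->]; move: t dt.
apply: tens_degS_ind => [s s' Qs Qs'|s v ds]; first by rewrite rmorphB; apply: QB.
have ds' : in_degree d (pr s) by apply/in_degreeP; exists s.
rewrite TRS_vec mulrDr rmorphD !rmorphM.
rewrite -[_ * pr (inN _ _)]opprK -[- (_ * pr (inN _ _))]sub0r.
by apply: (QB); [apply: QM|apply: (QB) => //; apply: QN].
Qed.

End ScalarMorphism.

Lemma locally_free_inj (R : comPzRingType) (p : prime_ideal R) (U V : lmodType R)
    (g : {linear U -> V}) (W : V -> Prop) n :
  injective g -> (forall v, W v <-> exists u, g u = v) ->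
  locally_free p W n -> locally_free p (fun _ : U => True) n.
Proof.
move=> gI WE [y [s [[sp Wy hy] iy]]].
have /choice[x xy] i := (WE (y i)).1 (Wy i).
have gx m (A : 'M[R]_(m, n)) i : g (mxcomb A x i) = mxcomb A y i.
  by rewrite linear_sum; apply: eq_bigr => j _; rewrite linearZ xy.
exists x, s; split.
  split=> // v _; have [|c cE] := hy (g v); first by apply/WE; exists v.
  by exists c; apply: gI; rewrite linearZ gx.
by move=> c /(congr1 g); rewrite gx linear0 => /iy.
Qed.

Section PreprojectiveParts.
Variables (R S : comPzRingType) (phi : {rmorphism R -> S}).
Variables (e f : 'I_4 -> S) (l : {additive S -> R}).
Hypothesis lZ : forall r x, l (phi r * x) = r * l x.
Hypothesis eE : forall y, y = \sum_i phi (l (y * f i)) * e i.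
Hypothesis fE : forall y, y = \sum_i phi (l (y * e i)) * f i.
Hypothesis ef : forall i j, l (e i * f j) = (i == j)%:R.
Local Notation P := (preproj phi e f).
Local Notation rho := (preproj_rho phi e f).
Local Notation pr := (@preproj_of R S phi 4 e f).
Local Notation sc := (scal phi e f).
Local Notation M := (gM phi e f).
Local Notation N := (gN phi e f).

Lemma preproj_rhoC r (x : P) : x * rho r = rho r * x.
Proof. by rewrite -preproj_scaleC preproj_scaleE. Qed.

Lemma free_preproj_degree p d :
  locally_free p (in_degree (phi := phi) (e := e) (f := f) d : smod rho -> Prop)
    (if odd d then 4 * d.+1 else 5 * d.+1)%N.
Proof.
have pr_ker t : pr t = 0 -> gen_ideal (@preproj_rel R S phi 4 e f) t.
  by move=> t0; rewrite -[t]subr0; apply/quot_pi_eq; rewrite [LHS]t0;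
    exact/esym/(rmorph0 pr).
have scM := @scal_gM R S phi 4 e f; have Msc := @gM_scal R S phi 4 e f.
have scN := @scal_gN R S phi 4 e f; have Nsc := @gN_scal R S phi 4 e f.
have M1N1 := @gM1_gN1 R S phi 4 e f; have sumNM := @sum_gN_gM R S phi 4 e f.
have kN := @ker_N1 R S phi 4 e f l lZ eE fE ef P sc M N scM Msc scN Nsc M1N1 sumNM
  preproj_rhoC pr (fun=> erefl) (fun=> erefl) (fun=> erefl) (@quot_pi_surj _ _) pr_ker.
have kM := @ker_M R S phi 4 e f l lZ eE fE ef P sc M N scM Msc scN Nsc M1N1 sumNM
  preproj_rhoC pr (fun=> erefl) (fun=> erefl) (fun=> erefl) (@quot_pi_surj _ _) pr_ker.
exact: (@free_degree R S phi e f l lZ eE fE ef P sc M N scM Msc scN Nsc M1N1 sumNM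
  (@preproj_ind R S phi 4 e f) (@preproj_lift R S phi 4 e f) kN kM
  _ (@in_degreeB R S phi 4 e f) (@in_degree0 R S phi 4 e f)
  (@in_degree_gM R S phi 4 e f) (@in_degree_gN R S phi 4 e f)
  (@in_degree_scal R S phi 4 e f) (@in_degreeS_ind R S phi 4 e f)
  rho (fun=> erefl) preproj_rhoC p d).
Qed.

Lemma free_preproj_part p d :
  locally_free p (fun _ : preproj_part phi e f d => True)
    (if odd d then 4 * d.+1 else 5 * d.+1)%N.
Proof.
have lin : linear (fun x : preproj_part phi e f d => preproj_part_val x : smod rho).
  by move=> a x y; rewrite [LHS](linearP val).
pose g : {linear preproj_part phi e f d -> smod rho} := HB.pack
  (fun x : preproj_part phi e f d => preproj_part_val x : smod rho)
  (GRing.isLinear.Build _ _ _ _ _ lin).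
apply: (locally_free_inj (g := g)) (free_preproj_degree p d); first exact: val_inj.
by move=> v; split=> [dv|[u <-]]; [exists (PreprojPart dv)|apply: preproj_partP].
Qed.

End PreprojectiveParts.

Theorem theorem3p8 (R S : comPzRingType) (phi : {rmorphism R -> S})
    (R_noetherian : noetherian R) (frob : relative_frobenius phi 4)
    (lam : dual phi) (lam_gen : generates_dual lam)
    (e f : 'I_4 -> restr phi) (e_basis : is_basis e) (f_basis : is_basis f)
    (ef_dual : forall i j : 'I_4, lam ((e i : S) * (f j : S)) = (i == j)%:R)
    (d : nat) :
  projective_of_rank (preproj_part phi e f d)
    (if odd d then 4 * d.+1 else 5 * d.+1)%N.
Proof.
have lamP : linear (lam : restr phi -> R^o) := dual_predP _ (dualP lam).
have lamB : zmod_morphism (lam : S -> R).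
  move=> x y; have h := lamP (-1) y x; rewrite !scaleN1r in h.
  by rewrite [x - y]addrC [RHS]addrC; exact: h.
have [l lE] : exists l : {additive S -> R}, forall x, l x = lam x.
  pose l : {additive S -> R} := HB.pack (lam : S -> R)
    (GRing.isZmodMorphism.Build _ _ _ lamB).
  by exists l.
have lZ r x : l (phi r * x) = r * l x.
  by have := lamP r x 0; rewrite addr0 -!lE raddf0 addr0.
have ef i j : l (e i * f j) = (i == j)%:R by rewrite lE ef_dual.
(* The coordinates in the basis [e] are read off by pairing with the dual basis. *)
have eE y : y = \sum_i phi (l (y * f i)) * e i.
  have [c [yc _]] := e_basis y.
  have yE : y = \sum_i phi (c i) * e i := yc; rewrite {1}yE; apply: eq_bigr => i _.
  congr (phi _ * _); rewrite yE mulr_suml raddf_sum (bigD1 i) //=.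
  rewrite -mulrA lZ ef eqxx mulr1 big1 ?addr0 // => j ji.
  by rewrite -mulrA lZ ef (negPf ji) mulr0.
have fE y : y = \sum_i phi (l (y * e i)) * f i.
  have [c [yc _]] := f_basis y.
  have yE : y = \sum_i phi (c i) * f i := yc; rewrite {1}yE; apply: eq_bigr => i _.
  congr (phi _ * _); rewrite yE mulr_suml raddf_sum (bigD1 i) //=.
  rewrite -mulrA lZ mulrC [f i * _]mulrC ef eqxx mul1r big1 ?addr0 // => j ji.
  by rewrite -mulrA lZ [f j * _]mulrC ef eq_sym (negPf ji) mulr0.
apply: locally_free_projective_of_rank => p.
exact: (free_preproj_part lZ eE fE ef).
Qed.
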